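(* Let $p$ be a prime number, let $\Gamma$ be a free group of finite rank $n>1$, let $\bullet\in\{S,Z\}$ and let $k\geq 1$ be an integer. (1) There is a non-central extension of groups $$0\longrightarrow \mathrm{Hom}(\mathcal{N}_1^\bullet,\mathcal{L}_{k+1}^\bullet)\xrightarrow{\ i\ }\mathrm{Aut}(\mathcal{N}_{k+1}^\bullet)\xrightarrow{\ \psi_k^\bullet\ }\mathrm{Aut}(\mathcal{N}_k^\bullet)\longrightarrow 1.$$ (2) This extension splits if and only if: in the case $\bullet=Z$, $k=1$ and $p$ is odd; in the case $\bullet=S$, $k=1$ and $(p,n)\in\{(3,2),(2,2)\}$. (3) The restriction of this extension to $IA^p(\mathcal{N}_{k+1}^\bullet)$ gives a non-split central extension of groups $$0\longrightarrow \mathrm{Hom}(\mathcal{N}_1^\bullet,\mathcal{L}_{k+1}^\bullet)\xrightarrow{\ i\ } IA^p(\mathcal{N}_{k+1}^\bullet)\xrightarrow{\ \psi_k^\bullet\ } IA^p(\mathcal{N}_k^\bullet)\longrightarrow 1.$$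
   Context: For a group $G$, write $[x,y]=xyx^{-1}y^{-1}$; the lower central series is $G_1=G$, $G_{k+1}=[G,G_k]$. For a subgroup $H$ and integer $m$, $H^m$ is the subgroup generated by $m$-th powers of elements of $H$. Fix a prime $p$. The Stallings mod-$p$ central series of $G$ is $G_1^S=G$, $G_k^S=[G,G_{k-1}^S](G_{k-1}^S)^p$ for $k\ge2$. The Zassenhaus mod-$p$ central series of $G$ is $G_k^Z=\prod_{ip^j\geq k}(G_i)^{p^j}$ (over $i\ge1$, $j\ge0$), $k\ge1$. All these subgroups are characteristic in $G$. For the free group $\Gamma$ and $\bullet\in\{S,Z\}$ put $\mathcal{N}_k^\bullet=\Gamma/\Gamma_{k+1}^\bullet$ and $\mathcal{L}_k^\bullet=\Gamma_k^\bullet/\Gamma_{k+1}^\bullet$. Thus $\mathcal{N}_1^\bullet\cong(\mathbb{Z}/p)^n$, and $\mathcal{L}_{k+1}^\bullet$ is an elementary abelian $p$-group which is a central characteristic subgroup of $\mathcal{N}_{k+1}^\bullet$ with quotient $\mathcal{N}_k^\bullet$. The map $\psi_k^\bullet$ is the homomorphism induced by the quotient $\mathcal{N}_{k+1}^\bullet\to\mathcal{N}_{k+1}^\bullet/\mathcal{L}_{k+1}^\bullet=\mathcal{N}_k^\bullet$. The map $i$ sends $f$ to the automorphism $\gamma\mapsto f([\gamma])\gamma$, where $[\gamma]$ is the class of $\gamma\in\mathcal{N}_{k+1}^\bullet$ in $\mathcal{N}_1^\bullet$. $IA^p(\mathcal{N}_k^\bullet)$ is the subgroup of $\mathrm{Aut}(\mathcal{N}_k^\bullet)$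 of automorphisms acting trivially on $\mathcal{N}_1^\bullet$. An extension is central if the image of its kernel map lies in the center of the middle group, and it splits if its surjection admits a section that is a group homomorphism.
   Formalization: In (2), k=1, p=2, n=2 or 3 are added as split cases for both S and Z: explicit complements exist there, so the printed list is false. In (3), ''non-split'' is replaced by ''splits iff k=1'', since IA^p(N_1) is trivial and the extension splits at k=1. *)

(* Defs.v *)
From HB Require Import structures.
From mathcomp Require Import all_boot.
From mathcomp Require Import boolp classical_sets functions.

Set Implicit Arguments.
Unset Strict Implicit.
Unset Printing Implicit Defensive.

Local Open Scope classical_set_scope.
Local Open Scope group_scope.
Local Open Scope quotient_scope.

Definition free_of_rank (n : nat) (G : groupType) : Prop :=
  exists x : 'I_n -> G,
    forall (H : groupType) (y : 'I_n -> H),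
      exists f : {multiplicative G -> H},
        (forall j, f (x j) = y j) /\
        (forall g : {multiplicative G -> H}, (forall j, g (x j) = y j) -> g =1 f).

Section Subgroups.
Variable G : groupType.
Implicit Types A B H : set G.

Definition is_subgroup H := H 1 /\ (forall x y, H x -> H y -> H (x / y)).

Definition is_normal H :=
  is_subgroup H /\ (forall g x, H x -> H (g * x * g^-1)).

Definition generated A : set G := smallest is_subgroup A.

(* [commg] is the other convention, x^-1 * y^-1 * x * y. *)
Definition commutator (x y : G) : G := x * y * x^-1 * y^-1.

Definition comm_subgroup A B : set G :=
  generated [set z | exists x y, [/\ A x, B y & z = commutator x y]].

Definition power_subgroup (m : nat) A : set G :=
  generated [set x ^+ m | x in A].

(* Each series below is indexed from 1, the index 0 being a dummy value. *)
Definition lower_central (k : nat) : set G :=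
  iter k.-1 (comm_subgroup setT) setT.

(* A product of normal subgroups is the subgroup generated by their union. *)
Definition stallings (p k : nat) : set G :=
  iter k.-1 (fun H => generated (comm_subgroup setT H `|` power_subgroup p H))
       setT.

Definition zassenhaus (p k : nat) : set G :=
  generated [set x | exists i j,
    [/\ (1 <= i)%N, (k <= i * p ^ j)%N
      & power_subgroup (p ^ j) (lower_central i) x]].

Lemma subgroupT : is_subgroup setT. Proof. by []. Qed.

Lemma generated_subgroup A : is_subgroup (generated A).
Proof.
split=> [H [[H1 _] _] //|x y Ax Ay H HA].
by case: (HA) => -[_ Hdiv] _; apply: Hdiv; [apply: Ax | apply: Ay].
Qed.

Definition conj_stable A := forall g x, A x -> A (g * x * g^-1).

Lemma conj_divg (g x y : G) :
  g * (x / y) * g^-1 = (g * x * g^-1) / (g * y * g^-1).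
Proof. by rewrite !invgM invgK !mulgA mulgVK. Qed.

Lemma generated_conj A : conj_stable A -> conj_stable (generated A).
Proof.
move=> cA g x; pose P := [set z | generated A (g * z * g^-1)].
suff sub : generated A `<=` P by apply: sub.
apply: smallest_sub; last by move=> z Az; apply: sub_gen_smallest; apply: cA.
have [g1 gdiv] := generated_subgroup A.
split=> [|z t Pz Pt]; rewrite /P /=; first by rewrite mulg1 mulgV.
by rewrite conj_divg; apply: gdiv.
Qed.

Lemma conj_commutator (g x y : G) :
  g * commutator x y * g^-1 = commutator (g * x * g^-1) (g * y * g^-1).
Proof. by rewrite /commutator !invgM !invgK !mulgA !mulgVK. Qed.

Lemma comm_subgroup_conj B : conj_stable B -> conj_stable (comm_subgroup setT B).
Proof.
move=> cB; apply: generated_conj => g _ [x [y [_ By ->]]].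
exists (g * x * g^-1), (g * y * g^-1); split=> //; first exact: cB.
exact: conj_commutator.
Qed.

Lemma conj_expg (g x : G) m : g * x ^+ m * g^-1 = (g * x * g^-1) ^+ m.
Proof.
elim: m => [|m IH]; first by rewrite mulg1 mulgV.
by rewrite !expgS -IH !mulgA mulgVK.
Qed.

Lemma power_subgroup_conj m A : conj_stable A -> conj_stable (power_subgroup m A).
Proof.
move=> cA; apply: generated_conj => g _ [x Ax <-].
by exists (g * x * g^-1); [exact: cA | rewrite conj_expg].
Qed.

Lemma lower_central_conj k : conj_stable (lower_central k).
Proof.
rewrite /lower_central; elim: k.-1 => [//|m IH].
exact: comm_subgroup_conj.
Qed.

Lemma stallings_normal p k : is_normal (stallings p k).
Proof.
rewrite /stallings; elim: k.-1 => [|m [_ IH]]; first by split.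
split; first exact: generated_subgroup.
apply: generated_conj => g x [Hx|Hx]; [left|right].
- exact: comm_subgroup_conj.
- exact: power_subgroup_conj.
Qed.

Lemma zassenhaus_normal p k : is_normal (zassenhaus p k).
Proof.
split; first exact: generated_subgroup.
apply: generated_conj => g x [i [j [i1 kij Hx]]]; exists i, j; split=> //.
by apply: power_subgroup_conj => //; apply: lower_central_conj.
Qed.

End Subgroups.

Record normal_subgroup (G : groupType) := Normal {
  normal_set :> set G;
  normalP : is_normal normal_set
}.

Section Quotient.
Variables (G : groupType) (N : normal_subgroup G).

Definition coset_rel : rel G := fun x y => `[< normal_set N (x^-1 * y) >].

Lemma normal1 : normal_set N 1. Proof. by case: (normalP N) => -[]. Qed.

Lemma normalV x : normal_set N x -> normal_set N x^-1.
Proof.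
by case: (normalP N) => -[N1 Nd] _ Nx; rewrite -(mul1g x^-1); apply: Nd.
Qed.

Lemma normalM x y : normal_set N x -> normal_set N y -> normal_set N (x * y).
Proof.
case: (normalP N) => -[N1 Nd] _ Nx Ny.
by rewrite -(invgK y); apply: Nd => //; apply: normalV.
Qed.

Lemma normalJ g x : normal_set N x -> normal_set N (g * x * g^-1).
Proof. by case: (normalP N) => _; apply. Qed.

Lemma coset_rel_refl : reflexive coset_rel.
Proof. by move=> x; apply/asboolP; rewrite mulVg; apply: normal1. Qed.

Lemma coset_rel_sym : symmetric coset_rel.
Proof.
move=> x y; apply/asboolP/asboolP => /normalV; by rewrite invgM invgK.
Qed.

Lemma coset_rel_trans : transitive coset_rel.
Proof.
move=> y x z /asboolP Nxy /asboolP Nyz; apply/asboolP.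
by have := normalM Nxy Nyz; rewrite mulgA mulgK.
Qed.

Canonical coset_equiv :=
  EquivRel coset_rel coset_rel_refl coset_rel_sym coset_rel_trans.

Definition quotient_group := {eq_quot coset_rel}.
HB.instance Definition _ := Choice.on quotient_group.

Definition coset_class (x : G) : quotient_group := \pi_{eq_quot coset_rel} x.
Definition coset_repr (u : quotient_group) : G := repr (u : {eq_quot coset_rel}).

Lemma coset_reprK : cancel coset_repr coset_class.
Proof. by move=> u; apply: reprK. Qed.

Lemma coset_eqP x y : coset_class x = coset_class y <-> normal_set N (x^-1 * y).
Proof.
split=> [/eqmodP/asboolP //|Nxy].
by apply/eqmodP/asboolP.
Qed.

Lemma coset_reprP x : normal_set N (x^-1 * coset_repr (coset_class x)).
Proof. by apply/coset_eqP; rewrite coset_reprK. Qed.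

Definition quotient_mul (u v : quotient_group) : quotient_group :=
  coset_class (coset_repr u * coset_repr v).
Definition quotient_inv (u : quotient_group) : quotient_group := coset_class (coset_repr u)^-1.

Lemma coset_ofM_subproof x y :
  coset_class (x * y) = quotient_mul (coset_class x) (coset_class y).
Proof.
apply/coset_eqP; set a := coset_repr _; set b := coset_repr _.
have Na : normal_set N (x^-1 * a) by apply: coset_reprP.
have Nb : normal_set N (y^-1 * b) by apply: coset_reprP.
have -> : (x * y)^-1 * (a * b) = (y^-1 * (x^-1 * a) * y^-1^-1) * (y^-1 * b).
  by rewrite invgK invgM !mulgA mulgK.
by apply: normalM => //; apply: normalJ.
Qed.

Lemma coset_ofV_subproof x : coset_class x^-1 = quotient_inv (coset_class x).
Proof.
apply/coset_eqP; set a := coset_repr _; rewrite invgK.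
have /normalV Na : normal_set N (x^-1 * a) by apply: coset_reprP.
have -> : x * a^-1 = x * (x^-1 * a)^-1 * x^-1.
  by rewrite invgM invgK !mulgA mulgK.
exact: normalJ.
Qed.

Lemma quotient_mulA : associative quotient_mul.
Proof.
move=> u v w; rewrite -(coset_reprK u) -(coset_reprK v) -(coset_reprK w).
by rewrite -!coset_ofM_subproof mulgA.
Qed.

Lemma quotient_mul1 : left_id (coset_class 1) quotient_mul.
Proof.
by move=> u; rewrite -(coset_reprK u) -coset_ofM_subproof mul1g.
Qed.

Lemma quotient_mulg1 : right_id (coset_class 1) quotient_mul.
Proof.
by move=> u; rewrite -(coset_reprK u) -coset_ofM_subproof mulg1.
Qed.

Lemma quotient_mulV : left_inverse (coset_class 1) quotient_inv quotient_mul.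
Proof.
move=> u; rewrite -(coset_reprK u) -coset_ofV_subproof -coset_ofM_subproof.
by rewrite mulVg.
Qed.

Lemma quotient_mulgV : right_inverse (coset_class 1) quotient_inv quotient_mul.
Proof.
move=> u; rewrite -(coset_reprK u) -coset_ofV_subproof -coset_ofM_subproof.
by rewrite mulgV.
Qed.

HB.instance Definition _ := isGroup.Build quotient_group
  quotient_mulA quotient_mul1 quotient_mulg1 quotient_mulV quotient_mulgV.

HB.instance Definition _ :=
  isMultiplicative.Build G quotient_group coset_class coset_ofM_subproof.

End Quotient.

(* The canonical map G/M -> G/N; it does not depend on the choice of coset
   representatives when M is contained in N, the only case used below. *)
Definition quotient_map (G : groupType) (M N : normal_subgroup G) (u : quotient_group M) :
  quotient_group N := coset_class N (coset_repr u).

Record automorphism (G : groupType) := Automorphism {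
  aut_fun :> G -> G;
  autM : {morph aut_fun : x y / x * y};
  aut_bij : bijective aut_fun
}.

HB.instance Definition _ (G : groupType) := gen_eqMixin (automorphism G).
HB.instance Definition _ (G : groupType) := gen_choiceMixin (automorphism G).

Section AutomorphismGroup.
Variable G : groupType.
Implicit Types a b c : automorphism G.

Lemma aut_ext a b : a =1 b -> a = b.
Proof.
case: a b => [f fM fb] [g gM gb] /= /funext fg; subst g.
by rewrite (Prop_irrelevance fM gM) (Prop_irrelevance fb gb).
Qed.

Definition aut_one := @Automorphism G id (fun _ _ => erefl) (inv_bij (fun _ => erefl)).

Lemma aut_compM a b : {morph a \o b : x y / x * y}.
Proof. by move=> x y; rewrite /= !autM. Qed.

Definition aut_mul a b :=
  Automorphism (aut_compM a b) (bij_comp (aut_bij a) (aut_bij b)).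

Lemma aut_invP a : {g : G -> G | cancel a g /\ cancel g a}.
Proof. by apply: cid; case: (aut_bij a) => g; exists g. Qed.

Definition aut_inv_fun a := sval (aut_invP a).

Lemma aut_funK a : cancel a (aut_inv_fun a).
Proof. by rewrite /aut_inv_fun; case: (aut_invP a) => g []. Qed.

Lemma aut_inv_funK a : cancel (aut_inv_fun a) a.
Proof. by rewrite /aut_inv_fun; case: (aut_invP a) => g []. Qed.

Lemma aut_inv_funM a : {morph aut_inv_fun a : x y / x * y}.
Proof.
by move=> x y; apply: (can_inj (aut_funK a)); rewrite autM !aut_inv_funK.
Qed.

Definition aut_inv a :=
  Automorphism (aut_inv_funM a) (Bijective (aut_inv_funK a) (aut_funK a)).

Lemma aut_mulA : associative aut_mul. Proof. by move=> a b c; apply: aut_ext. Qed.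
Lemma aut_mul1 : left_id aut_one aut_mul. Proof. by move=> a; apply: aut_ext. Qed.
Lemma aut_mulg1 : right_id aut_one aut_mul. Proof. by move=> a; apply: aut_ext. Qed.
Lemma aut_mulV : left_inverse aut_one aut_inv aut_mul.
Proof. by move=> a; apply: aut_ext => x; apply: aut_funK. Qed.
Lemma aut_mulgV : right_inverse aut_one aut_inv aut_mul.
Proof. by move=> a; apply: aut_ext => x; apply: aut_inv_funK. Qed.

HB.instance Definition _ := isGroup.Build (automorphism G)
  aut_mulA aut_mul1 aut_mulg1 aut_mulV aut_mulgV.

End AutomorphismGroup.

(* All functions T -> G, with pointwise multiplication. *)
Definition fun_group (T : Type) (G : groupType) := T -> G.

HB.instance Definition _ T (G : groupType) := gen_eqMixin (fun_group T G).
HB.instance Definition _ T (G : groupType) := gen_choiceMixin (fun_group T G).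

Section FunGroup.
Variables (T : Type) (G : groupType).
Local Notation F := (fun_group T G).

Definition fun_mul (f g : F) : F := fun x => f x * g x.
Definition fun_one : F := fun _ => 1.
Definition fun_inv (f : F) : F := fun x => (f x)^-1.

Lemma fun_mulA : associative fun_mul.
Proof. by move=> f g h; apply/funext => x; apply: mulgA. Qed.
Lemma fun_mul1 : left_id fun_one fun_mul.
Proof. by move=> f; apply/funext => x; apply: mul1g. Qed.
Lemma fun_mulg1 : right_id fun_one fun_mul.
Proof. by move=> f; apply/funext => x; apply: mulg1. Qed.
Lemma fun_mulV : left_inverse fun_one fun_inv fun_mul.
Proof. by move=> f; apply/funext => x; apply: mulVg. Qed.
Lemma fun_mulgV : right_inverse fun_one fun_inv fun_mul.
Proof. by move=> f; apply/funext => x; apply: mulgV. Qed.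

HB.instance Definition _ := isGroup.Build F
  fun_mulA fun_mul1 fun_mulg1 fun_mulV fun_mulgV.

End FunGroup.

(* Hom(H, L) for a subset L of G, as a subset of the group of all functions
   H -> G. *)
Definition homs (H G : groupType) (L : set G) : set (fun_group H G) :=
  [set f | {morph f : x y / x * y} /\ (forall x, L (f x))].
Arguments homs H {G} L.

Section Extensions.
Variables (A B C : groupType).

Definition is_hom_on (X Y : groupType) (D : set X) (D' : set Y) (f : X -> Y) :=
  [/\ is_subgroup D, is_subgroup D', set_fun D D' f
    & forall x y, D x -> D y -> f (x * y) = f x * f y].

(* 1 -> K --i--> E --psi--> Q -> 1 is a short exact sequence of groups, where
   K, E and Q are given as subgroups of A, B and C. *)
Definition is_extension (K : set A) (E : set B) (Q : set C)
    (i : A -> B) (psi : B -> C) :=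
  [/\ is_hom_on K E i, is_hom_on E Q psi, set_inj K i, set_surj E Q psi
    & i @` K = E `&` [set e | psi e = 1]].

Definition is_central_extension (K : set A) (E : set B) (i : A -> B) :=
  forall a e, K a -> E e -> commute (i a) e.

Definition is_split_extension (E : set B) (Q : set C) (psi : B -> C) :=
  exists s : C -> B, is_hom_on Q E s /\ (forall q, Q q -> psi (s q) = q).

End Extensions.

Variant series_kind := Stallings | Zassenhaus.

Section Tower.
Variables (b : series_kind) (p : nat) (G : groupType).

Definition series (k : nat) : normal_subgroup G :=
  match b with
  | Stallings => Normal (stallings_normal G p k)
  | Zassenhaus => Normal (zassenhaus_normal G p k)
  end.

Definition NN (k : nat) : groupType := quotient_group (series k.+1).

(* The canonical projection NN j -> NN k, for k <= j. *)
Definition NN_proj (j k : nat) : NN j -> NN k :=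
  @quotient_map G (series j.+1) (series k.+1).

(* series k / series k.+1, as a subgroup of NN k. *)
Definition LL (k : nat) : set (NN k) := coset_class (series k.+1) @` series k.

Definition IA (k : nat) : set (automorphism (NN k)) :=
  [set phi | forall g, NN_proj 1 (phi g) = NN_proj 1 g].

End Tower.
Arguments NN_proj b p {G j} k _.
Arguments LL b p G k _ : clear implicits.
Arguments IA b p G k _ : clear implicits.

Definition listed_split_case (b : series_kind) (p n k : nat) : Prop :=
  match b with
  | Zassenhaus => k = 1%N /\ odd p
  | Stallings => k = 1%N /\ ((p, n) = (3, 2) \/ (p, n) = (2, 2))
  end.

(* The cases missing from the published list.  For p = 2 the two series have
   the same terms of index 2 and 3, hence the same extension for k = 1.  It
   splits for n = 2, since the automorphisms x |-> y, y |-> y^-1 x^-1 and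
   x |-> y^-1, y |-> x^-1 of the free group generate a lift of GL_2(F_2), and
   for n = 3, where GL_3(F_2) is lifted by the subgroup generated by
     x |-> z,    y |-> x^2 y^3 z^2 [z, x],   z |-> x   and
     x |-> y^3,  y |-> x^3 z^3,              z |-> x y. *)
Definition unlisted_split_case (p n k : nat) : Prop :=
  [/\ k = 1%N, p = 2 & n = 2 \/ n = 3].

(* Main.v *)
(** The filtration by the two series is handled uniformly once three facts are
    known: each term is central modulo the next one, p-th powers descend by one
    step, and an endomorphism that is trivial modulo the second term is trivial
    on every graded piece.  For the Zassenhaus series they follow from a
    Hall-Petrescu expansion of (z y)^q y^-q, obtained from polynomial sequences
    adapted to the filtrations lower_central s and
    <lower_central s.+1, (lower_central s)^p>.

    Exactness: automorphisms of N_k lift to endomorphisms of the free group, and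
    an endomorphism of N_{k+1} that is trivial modulo L_{k+1} is bijective, since
    it fixes L_{k+1}.  For k > 1 the extension of IA^p does not split because a
    nontrivial element of its central kernel, the conjugation by an iterated
    commutator [x, [x, .., [x, y]]] of weight k, is a commutator in IA^p; that
    this conjugation is not the identity is seen in unitriangular matrices over
    F_p.

    For k = 1 and the Zassenhaus series with p odd, the lifts commuting with
    x_j |-> x_j^-1 form a complement, because this involution inverts the kernel.
    For (p, n) = (2, 2), (3, 2), (2, 3) an explicit complement is checked by
    computation.  In the other cases a splitting would split
    GL_n(Z/p^2) -> GL_n(Z/p), which is refuted on a few elementary matrices. *)

From HB Require Import structures.
From mathcomp Require Import all_boot fingroup all_algebra.
From mathcomp Require Import boolp classical_sets functions.
Require Import Defs.

Set Implicit Arguments.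
Unset Strict Implicit.
Unset Printing Implicit Defensive.

Local Open Scope classical_set_scope.
Local Open Scope group_scope.

(** Stallings terms are defined recursively, so the three facts follow by direct induction. A
    Zassenhaus term is generated by p^j-th powers from several layers of the lower central series,
    and these powers are not multiplicative. What makes the layers fit together is that y^(p^j),
    modulo the next Zassenhaus term, depends only on y modulo [LCp i].

    For k = 1 the group IA^p(N_1) is trivial, so the restricted extension splits for a trivial
    reason. Obstructions must then come from Aut(N_1), and exponent sums modulo p^2 detect them only
    when they vanish on the third term of the series, which holds for Stallings and for p = 2.

    The exceptional ranks come from binomial coefficients. A lift 1 + X of an elementary matrix has
    X^4 = 0, so its p-th power involves only p, C(p, 2) and C(p, 3). For p >= 5 all three are
    divisible by p and one matrix gives a contradiction. For p = 3 the coefficient C(3, 3) = 1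
    survives and a second commuting matrix is used, which takes three indices. For p = 2 the
    coefficient C(2, 2) = 1 survives and four commuting matrices on four indices are used. *)

Definition free_red (G : groupType) :=
  (@invgM G, @invgK G, @mulgA G, @mulgK G, @mulgVK G, @mulg1 G, @mul1g G,
   @invg1 G, @mulgV G, @mulVg G).

(** * Subgroups and quotients *)

Section Subgroup.
Variable G : groupType.
Implicit Types (A H : set G) (x y g : G).

Lemma subgroup1 H : is_subgroup H -> H 1. Proof. by case. Qed.

Lemma subgroupV H x : is_subgroup H -> H x -> H x^-1.
Proof. by move=> [H1 Hd] Hx; rewrite -(mul1g x^-1); apply: Hd. Qed.

Lemma subgroupM H x y : is_subgroup H -> H x -> H y -> H (x * y).
Proof. by move=> sH Hx Hy; rewrite -(invgK y); apply: sH.2 => //; apply: subgroupV. Qed.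

Lemma subgroupX H x m : is_subgroup H -> H x -> H (x ^+ m).
Proof.
move=> sH Hx; elim: m => [|m IH]; first exact: subgroup1.
by rewrite expgS; apply: subgroupM.
Qed.

Lemma generated_in A x : A x -> generated A x.
Proof. exact: sub_gen_smallest. Qed.

Lemma generated_min A H : is_subgroup H -> A `<=` H -> generated A `<=` H.
Proof. by move=> sH AH; apply: smallest_sub. Qed.

Lemma comm_subgroup_in A B x y : A x -> B y -> comm_subgroup A B (commutator x y).
Proof. by move=> Ax By; apply: generated_in; exists x, y. Qed.

Lemma power_subgroup_in m A x : A x -> power_subgroup m A (x ^+ m).
Proof. by move=> Ax; apply: generated_in; exists x. Qed.

Lemma normal_conj H g x : is_normal H -> H x -> H (g * x * g^-1).
Proof. by case=> _; apply. Qed.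

Lemma normal_comm H g x : is_normal H -> H x -> H (commutator g x).
Proof.
by move=> nH Hx; apply: nH.1.2 => //; apply: nH.2.
Qed.

Lemma commutatorV x y : (commutator x y)^-1 = commutator y x.
Proof. by rewrite /commutator !free_red. Qed.

Lemma commutator1P x y : commutator x y = 1 <-> x * y = y * x.
Proof.
rewrite /commutator; split=> [|->]; last by rewrite !free_red.
by move=> h; rewrite -[LHS](mulgVK x) -[X in X * x](mulgVK y) h mul1g.
Qed.

Lemma commutatorX x y m : x * commutator x y = commutator x y * x ->
  y * commutator x y = commutator x y * y ->
  commutator x (y ^+ m) = commutator x y ^+ m.
Proof.
set c := commutator x y => _ cy.
have xy : x * y * x^-1 = c * y by rewrite /c /commutator !free_red.
rewrite {1}/commutator conj_expg xy.
by rewrite expgMn ?mulgK //; exact/esym.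
Qed.

End Subgroup.

Section Morphism.
Variables (G H : groupType) (f : G -> H).
Hypothesis fM : {morph f : x y / x * y}.

Lemma morph1 : f 1 = 1.
Proof. by apply: (mulgI (f 1)); rewrite -fM !mulg1. Qed.

Lemma morphV x : f x^-1 = (f x)^-1.
Proof. by apply: (mulgI (f x)); rewrite -fM !mulgV morph1. Qed.

Lemma morphX x m : f (x ^+ m) = f x ^+ m.
Proof. by elim: m => [|m IH]; [exact: morph1 | rewrite !expgS fM IH]. Qed.

Lemma morphR x y : f (commutator x y) = commutator (f x) (f y).
Proof. by rewrite /commutator !(fM, morphV). Qed.

Lemma preim_subgroup (K : set H) : is_subgroup K -> is_subgroup (f @^-1` K).
Proof.
move=> [K1 Kd]; split=> [|x y Kx Ky]; rewrite /preimage /= ?morph1 //.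
by rewrite fM morphV; apply: Kd.
Qed.

Lemma equalizer_subgroup (g : G -> H) : {morph g : x y / x * y} ->
  is_subgroup [set x | f x = g x].
Proof.
move=> gM; have g1 : g 1 = 1 by apply: (mulgI (g 1)); rewrite -gM !mulg1.
have gV x : g x^-1 = (g x)^-1.
  by apply: (mulgI (g x)); rewrite -gM !mulgV g1.
by split=> [|x y]; rewrite /= ?morph1 ?g1 // fM gM morphV gV => -> ->.
Qed.
End Morphism.

(* The Hall-Witt argument, in the case where two of the three terms of the
   identity are known to vanish. *)
Lemma three_subgroups (G : groupType) (U V Y : G) :
  let C := commutator V^-1 Y in let D := commutator U^-1 Y in
  U^-1 * C = C * U^-1 -> D * C = C * D -> V^-1 * D = D * V^-1 ->
  commutator U V * Y = Y * commutator U V.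
Proof.
move=> C D; rewrite {}/C {}/D.
have -> : commutator U V = commutator U^-1^-1 V^-1^-1 by rewrite !invgK.
move: (U^-1) (V^-1) => {}U {}V cU cCD cD.
have eU : U * Y = commutator U Y * Y * U by rewrite /commutator !free_red.
have eV : V * Y = commutator V Y * Y * V by rewrite /commutator !free_red.
(* The two sides reduce to [C * D * Y] and [D * C * Y]; their equality says that
   [(V * U)^-1 * (U * V)] commutes with [Y]. *)
have key : U * V * Y * (U * V)^-1 = V * U * Y * (V * U)^-1.
  move: (commutator U Y) (commutator V Y) cU cCD cD eU eV => D C cU cCD cD eU eV.
  rewrite -[U * V * Y]mulgA eV -[V * U * Y]mulgA eU !mulgA cU cD.
  rewrite -[_ * U * Y]mulgA eU -[_ * V * Y]mulgA eV !mulgA cCD.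
  by rewrite !invgM !free_red.
have -> : commutator U^-1 V^-1 = (V * U)^-1 * (U * V).
  by rewrite /commutator !free_red.
by apply: (mulgI (V * U)); apply: (mulIg (U * V)^-1); rewrite ?free_red; rewrite !free_red in key.
Qed.

Section Quo.
Variables (G : groupType) (N : normal_subgroup G).
Local Notation pi := (coset_class N).

Lemma classM : {morph pi : x y / x * y}. Proof. exact: gmulfM. Qed.
Definition class1 := morph1 classM.
Definition classV := morphV classM.
Definition classX := morphX classM.
Definition classR := morphR classM.
Lemma class_eq1 x : pi x = 1 <-> normal_set N x.
Proof.
rewrite -class1; split=> [/esym/coset_eqP|Nx]; first by rewrite invg1 mul1g.
by apply/esym/coset_eqP; rewrite invg1 mul1g.
Qed.
Lemma class_eq x y : pi x = pi y <-> normal_set N (x * y^-1).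
Proof.
rewrite -class_eq1 classM classV; split=> [->|/divg1_eq //].
by rewrite mulgV.
Qed.
Lemma comm_classP x y : normal_set N (commutator x y) <-> pi x * pi y = pi y * pi x.
Proof. by rewrite -class_eq1 classR commutator1P. Qed.

Lemma centralizer_subgroup y : is_subgroup [set z | normal_set N (commutator z y)].
Proof.
split=> [|u v /comm_classP uy /comm_classP vy]; apply/comm_classP.
  by rewrite class1 mul1g mulg1.
rewrite classM classV -mulgA -(commuteV (esym vy : commute (pi y) (pi v))).
by rewrite mulgA uy mulgA.
Qed.

Lemma class_surj u : exists x, u = pi x.
Proof. by exists (coset_repr u); rewrite coset_reprK. Qed.
End Quo.

Section LowerCentral.
Variable G : groupType.
Local Notation LC := (@lower_central G).

Lemma LC_normal k : is_normal (LC k).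
Proof.
split; last exact: lower_central_conj.
by case: k => [|[|k]]; [exact: subgroupT | exact: subgroupT | exact: generated_subgroup].
Qed.

Lemma LC_in k x y : LC k y -> LC k.+1 (commutator x y).
Proof. by case: k => [|k] Ly //; apply: comm_subgroup_in. Qed.

Lemma LC_decr k : LC k.+1 `<=` LC k.
Proof.
case: k => [|k] //; apply: generated_min; first exact: (LC_normal _).1.
by move=> _ [x [y [_ Ly ->]]]; apply: normal_comm => //; apply: LC_normal.
Qed.

Lemma LC_le a b : (a <= b)%N -> LC b `<=` LC a.
Proof.
move=> /subnK <-; elim: (b - a)%N => [//|m IH] x Lx.
by apply/IH/LC_decr.
Qed.

(** Induction on the weight of the first argument, for all [b] at once. For a generator [u, v], the
    element [v^-1, y] is central modulo [N], and [v^-1, [u^-1, y]] lies in [N] by induction with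
    [b.+1], so [three_subgroups] applies. *)
Lemma LC_comm a b x y : LC a x -> LC b y -> LC (a + b) (commutator x y).
Proof.
elim: a b x y => [|a IH] b x y Lx Ly; first by apply: normal_comm => //; apply: LC_normal.
case: a IH Lx => [|a] IH Lx; first by rewrite add1n; apply: LC_in.
pose N := Normal (LC_normal (a.+2 + b)).
suff sub : LC a.+2 `<=` [set z | normal_set N (commutator z y)] by apply: sub.
apply: generated_min; first exact: centralizer_subgroup.
move=> _ [u [v [_ Lv ->]]]; apply/comm_classP; rewrite classR.
have Lv' : LC a.+1 v^-1 by apply: subgroupV => //; apply: (LC_normal _).1.
have cC g : coset_class N g * coset_class N (commutator v^-1 y) =
    coset_class N (commutator v^-1 y) * coset_class N g.
  by apply/comm_classP; rewrite /= addSn; apply: LC_in; apply: IH.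
apply: three_subgroups; rewrite -!classV -!classR; [exact: cC|exact: cC|].
by apply/comm_classP; rewrite /= addSnnS; apply: IH => //; apply: LC_in.
Qed.
End LowerCentral.

(** * Polynomial sequences in filtered groups *)

Section Polynomial.
Variables (G : groupType) (i : nat).

Definition diff (h : nat -> G) t := h t.+1 * (h t)^-1.

(* Polynomial sequences in the sense of Lazard and Leibman, to order m. *)
Fixpoint poly (A : nat -> set G) m a (h : nat -> G) : Prop :=
  (forall t, A a (h t)) /\ (if m is m'.+1 then poly A m' (a + i) (diff h) else True).

Variables A B : nat -> set G.
Hypothesis B_sub : forall a, is_subgroup (B a).
Hypothesis B_decr : forall a, B a.+1 `<=` B a.
Hypothesis BA : forall a, B a `<=` A a.
Hypothesis AB_comm : forall a b x y, A a x -> B b y -> B (a + b) (commutator x y).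

Lemma poly_val C m a h t : poly C m a h -> C a (h t).
Proof. by case: m => [|m] [] . Qed.

Lemma eq_poly C m a h h' : h =1 h' -> poly C m a h -> poly C m a h'.
Proof. by move/funext->. Qed.

Lemma B_le a b : (a <= b)%N -> B b `<=` B a.
Proof.
move=> /subnK <-; elim: (b - a)%N => [//|m IH] x Lx.
by apply/IH/B_decr.
Qed.

Lemma poly_le m a b h : (a <= b)%N -> poly B m b h -> poly B m a h.
Proof.
elim: m a b h => [|m IH] a b h ab [hb hD]; (split=> [t|//]); try exact: B_le (hb t).
by apply: IH hD; rewrite leq_add2r.
Qed.

Lemma poly_pred C m a h : poly C m.+1 a h -> poly C m a h.
Proof.
elim: m a h => [|m IH] a h [h0 hD]; split=> //.
exact: IH.
Qed.

Lemma polyBA m a h : poly B m a h -> poly A m a h.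
Proof.
elim: m a h => [|m IH] a h [h0 hD]; split=> //; try exact: IH.
all: by move=> t; apply: BA.
Qed.

Lemma poly1 m a : poly B m a (fun=> 1).
Proof.
elim: m a => [|m IH] a; (split=> [t|//]); try exact: subgroup1.
by apply: (@eq_poly _ _ _ (fun=> 1)) => // t; rewrite /diff mulgV.
Qed.

(** One induction on the order serves all three operations: the difference of a product contains a
    conjugate, which is a commutator times the sequence, and the difference of a commutator is a
    product of conjugates of commutators. The mixed form, with [g] in [A] and [h] in [B], fits
    [pow_poly], where the powers of [z * y] live in the lower central series and [z] in [LCp]. *)
Lemma poly_closure m :
  [/\ forall a g h, poly B m a g -> poly B m a h -> poly B m a (fun t => g t * h t),
      forall a h, poly B m a h -> poly B m a (fun t => (h t)^-1)
    & forall a b g h, poly A m a g -> poly B m b h ->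
        poly B m (a + b) (fun t => commutator (g t) (h t))].
Proof.
elim: m => [|m [IHM IHV IHR]].
  split=> [a g h [ga _] [ha _]|a h [ha _]|a b g h [ga _] [hb _]]; split=> // t.
  - exact: subgroupM.
  - exact: subgroupV.
  - exact: AB_comm.
have IHJ a b g x : poly A m a g -> poly B m b x ->
    poly B m b (fun t => g t * x t * (g t)^-1).
  move=> Pg Px; apply: (@eq_poly _ _ _ (fun t => commutator (g t) (x t) * x t)).
    by move=> t; rewrite /commutator mulgVK.
  by apply: IHM => //; apply: poly_le (IHR _ _ _ _ Pg Px); apply: leq_addl.
split=> [a g h Pg Ph|a h Ph|a b g h Pg Ph].
- have [[ga gD] [ha hD]] := (Pg, Ph); split=> [t|]; first exact: subgroupM.
  apply: (@eq_poly _ _ _ (fun t => diff g t * (g t * diff h t * (g t)^-1))).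
    by move=> t; rewrite /diff !free_red.
  by apply: IHM => //; apply: IHJ => //; apply/polyBA/poly_pred/Pg.
- have [ha hD] := Ph; split=> [t|]; first exact: subgroupV.
  apply: (@eq_poly _ _ _ (fun t => (h t)^-1 * (diff h t)^-1 * (h t)^-1^-1)).
    by move=> t; rewrite /diff !free_red.
  apply: IHJ; last exact: IHV.
  by apply: polyBA; apply: IHV; apply: poly_pred Ph.
- have [[ga gD] [hb hD]] := (Pg, Ph); split=> [t|]; first exact: AB_comm.
  have {}Pg := poly_pred Pg; have {}Ph := poly_pred Ph.
  have Pc := IHR _ _ _ _ Pg Ph.
  pose c t := commutator (g t) (h t).
  (* An identity of free groups. Every commutator on the right has a difference among its arguments,
     hence gains at least the weight [i]; [le1] to [le5] are these weight counts. *)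
  apply: (@eq_poly _ _ _ (fun t =>
     (diff g t * commutator (g t) (diff h t) * (diff g t)^-1) *
     ((diff g t * commutator (diff h t) (c t) * (diff g t)^-1) *
      commutator (diff g t) (c t)) *
     (c t * (commutator (diff g t) (diff h t) *
       (diff h t * commutator (diff g t) (h t) * (diff h t)^-1)) * (c t)^-1))).
    by move=> t; rewrite /c /diff /commutator !free_red.
  have le1 : (a + b + i <= a + (b + i))%N by rewrite addnA.
  have le2 : (a + b + i <= a + i + b)%N by rewrite addnAC.
  have le3 : (a + b + i <= b + i + (a + b))%N by rewrite [leqRHS]addnC leq_add2l leq_addl.
  have le4 : (a + b + i <= a + i + (a + b))%N by rewrite [leqRHS]addnC leq_add2l leq_addl.
  have le5 : (a + b + i <= a + i + (b + i))%N by rewrite [leqRHS]addnAC leq_add2r leq_add2l leq_addr.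
  have hDA := polyBA hD.
  have R x y u v : (a + b + i <= x + y)%N -> poly A m x u -> poly B m y v ->
     poly B m (a + b + i) (fun t => commutator (u t) (v t)).
    by move=> xy Pu Pv; apply: poly_le xy _; apply: IHR.
  apply: (IHM); [apply: (IHM); [|apply: (IHM)]|].
  + by apply: IHJ gD _; apply: R le1 Pg hD.
  + by apply: IHJ gD _; apply: R le3 hDA Pc.
  + exact: R le4 gD Pc.
  + apply: (IHJ) (polyBA Pc) _; apply: IHM; first exact: R le5 gD hD.
    by apply: (IHJ) hDA _; apply: R le2 gD Ph.
Qed.

Lemma polyM m a g h : poly B m a g -> poly B m a h -> poly B m a (fun t => g t * h t).
Proof. by case: (poly_closure m) => + _ _; apply. Qed.

Lemma polyV m a h : poly B m a h -> poly B m a (fun t => (h t)^-1).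
Proof. by case: (poly_closure m) => _ + _; apply. Qed.

Lemma polyJ m a b g x : poly A m a g -> poly B m b x ->
  poly B m b (fun t => g t * x t * (g t)^-1).
Proof.
move=> Pg Px; apply: (@eq_poly _ _ _ (fun t => commutator (g t) (x t) * x t)).
  by move=> t; rewrite /commutator mulgVK.
apply: polyM => //; apply: (@poly_le _ _ (a + b)); first exact: leq_addl.
by case: (poly_closure m) => _ _; apply.
Qed.

(** Pascal's rule: the difference of [c ^+ 'C(t, l.+1)] is [c ^+ 'C(t, l)]. It must have weight
    higher by [i], while [l] drops by one, so the hypothesis on [c] keeps its form. *)
Lemma poly_binom m a l c : B (a + i * l) c -> poly B m a (fun t => c ^+ 'C(t, l)).
Proof.
elim: m a l => [|m IH] a l Bc.
  by split=> // t; apply: subgroupX => //; apply: B_le Bc; apply: leq_addr.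
split=> [t|]; first by apply: subgroupX => //; apply: B_le Bc; apply: leq_addr.
case: l Bc => [|l] Bc.
  by apply: (eq_poly _ (poly1 _ _)) => t; rewrite /diff !bin0 mulgV.
apply: (@eq_poly _ _ _ (fun t => c ^+ 'C(t, l))); last first.
  by apply: IH; rewrite -addnA -mulnS.
by move=> t; rewrite /diff binS addnC expgnDr mulgK.
Qed.

Lemma poly_const m a c : B a c -> poly B m a (fun=> c).
Proof.
move=> Bc; apply: (@eq_poly _ _ _ (fun t => c ^+ 'C(t, 0))).
  by move=> t; rewrite bin0.
by apply: poly_binom; rewrite muln0 addn0.
Qed.

(** The value [h m] is then the [m]-th difference of [h] at 0, and each difference gains the weight
    [i]. *)
Lemma poly_lead m a h : poly B m a h -> (forall t, (t < m)%N -> h t = 1) ->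
  B (a + i * m) (h m).
Proof.
elim: m a h => [|m IH] a h Ph h1.
  by rewrite muln0 addn0; apply: poly_val Ph.
have [_ hD] := Ph; rewrite mulnS addnA.
have <- : diff h m = h m.+1 by rewrite /diff (h1 m) // invg1 mulg1.
apply: IH => // t tm; rewrite /diff !h1 ?mulgV //.
by rewrite ltnS ltnW.
Qed.

(** Newton interpolation: dividing by [c ^+ 'C(t, l)] with [c = h l] keeps the trivial values below
    [l] and creates one at [l]; once [l] exceeds [q], what remains of [h q] is 1. The weight of each
    [c] comes from [poly_lead]. *)
Lemma poly_expand_from (Z : set G) q l h : is_subgroup Z ->
  (forall m, poly B m 0 h) -> (forall t, (t < l)%N -> h t = 1) ->
  (forall s c, (l <= s <= q)%N -> B (i * s) c -> Z (c ^+ 'C(q, s))) -> Z (h q).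
Proof.
move=> sZ; have [d ldq] := ubnP (q.+1 - l).
elim: d l h ldq => // d IH l h ldq Ph h1 HZ.
have [ql|lq] := ltnP q l; first by rewrite h1 //; apply: subgroup1.
pose c := h l.
have Bc : B (i * l) c by have := poly_lead (Ph l) h1; rewrite add0n.
have -> : h q = h q * (c ^+ 'C(q, l))^-1 * c ^+ 'C(q, l) by rewrite mulgVK.
apply: subgroupM => //; last by apply: HZ => //; rewrite leqnn lq.
apply: (IH l.+1 (fun t => h t * (c ^+ 'C(t, l))^-1)).
- rewrite subSS; apply: (@leq_trans (q.+1 - l)) => //.
  by rewrite subSn.
- by move=> m; apply: polyM => //; apply: polyV; apply: poly_binom.
- move=> t; rewrite ltnS leq_eqVlt => /predU1P[->|tl]; first by rewrite binn mulgV.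
  by rewrite h1 // bin_small // mulgV.
- by move=> s e /andP[ls sq]; apply: HZ; rewrite (ltnW ls).
Qed.

(* The Hall-Petrescu formula for h q, except that the linear term is known. *)
Lemma poly_expand (Z : set G) q h : is_subgroup Z ->
  (forall m, poly B m 0 h) -> h 0%N = 1 -> Z (h 1%N ^+ q) ->
  (forall s c, (2 <= s <= q)%N -> B (i * s) c -> Z (c ^+ 'C(q, s))) -> Z (h q).
Proof.
move=> sZ Ph h0 Z1 HZ.
have -> : h q = h q * (h 1%N ^+ q)^-1 * h 1%N ^+ q by rewrite mulgVK.
apply: subgroupM => //.
apply: (@poly_expand_from Z q 2 (fun t => h t * (h 1%N ^+ t)^-1)) => //.
  have B1 : B (0 + i * 1) (h 1%N) by apply: (poly_lead (Ph 1%N)); case.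
  move=> m; apply: polyM => //; apply: polyV.
  by apply: (eq_poly _ (poly_binom m B1)) => t; rewrite bin1.
by case=> [|[|t]] // _; rewrite ?h0 ?mulgV // expg0 mulg1.
Qed.

End Polynomial.

(** * The Zassenhaus series *)

(** Read off from l C(p^r, l) = p^r C(p^r - 1, l - 1). *)
Lemma dvdn_bin_pow p r l : prime p -> (0 < l)%N ->
  p ^ (r - logn p l) %| 'C(p ^ r, l).
Proof.
move=> p_pr l0; case: (posnP 'C(p ^ r, l)) => [->|C0]; first exact: dvdn0.
rewrite pfactor_dvdn // leq_subLR -lognM // -pfactor_dvdn // ?muln_gt0 ?l0 //.
by case: l l0 {C0} => // l _; rewrite -mul_bin_diag dvdn_mulr.
Qed.

(** [V] is asked to commute with [B] but not with [A]: for an endomorphism that is trivial modulo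
    the second term, [V] has weight two and [A] is arbitrary, and only [V, B] is deep enough to
    vanish. *)
Lemma commutator_central (G : groupType) (U V A B : G) :
  U * (V * A) = V * A * U -> V * B = B * V ->
  V * commutator A B = commutator A B * V ->
  U * commutator A B = commutator A B * U ->
  commutator (V * A) (U * B) = commutator A B.
Proof.
move=> cU cB VR UR.
have -> : commutator (V * A) (U * B) =
    (V * A) * U * (V * A)^-1 * commutator (V * A) B * U^-1.
  by rewrite /commutator !free_red.
have -> : commutator (V * A) B = V * commutator A B * (B * V * B^-1)^-1.
  by rewrite /commutator !free_red.
by rewrite -cU mulgK -cB mulgK VR mulgK UR mulgK.
Qed.

Section PowerFiltration.
Variables (G : groupType) (p : nat).
Hypothesis p_prime : prime p.
Local Notation LC := (@lower_central G).
Local Notation Z := (@zassenhaus G p).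

(* The elements of LC s that die in the F_p-vector space
   (LC s / LC s.+1) (x) F_p. *)
Definition LCp s : set G := generated (LC s.+1 `|` power_subgroup p (LC s)).

Lemma power_subgroup_min m (A H : set G) : is_subgroup H ->
  (forall x, A x -> H (x ^+ m)) -> power_subgroup m A `<=` H.
Proof. by move=> sH AH; apply: generated_min => // _ [x Ax <-]; apply: AH. Qed.

Lemma LCp_normal s : is_normal (LCp s).
Proof.
split; first exact: generated_subgroup.
apply: generated_conj => g x [Lx|Px]; [left|right].
- exact: lower_central_conj.
- by apply: power_subgroup_conj => //; apply: lower_central_conj.
Qed.

Lemma LC_LCp s : LC s.+1 `<=` LCp s.
Proof. by move=> x Lx; apply: generated_in; left. Qed.

Lemma LCX_LCp s x : LC s x -> LCp s (x ^+ p).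
Proof. by move=> Lx; apply: generated_in; right; apply: power_subgroup_in. Qed.

Lemma LCp_sub s (H : set G) : is_subgroup H -> LC s.+1 `<=` H ->
  (forall x, LC s x -> H (x ^+ p)) -> LCp s `<=` H.
Proof.
by move=> sH h1 h2; apply: generated_min => // x [/h1 //|]; apply: power_subgroup_min.
Qed.

Lemma LCp_LC s : LCp s `<=` LC s.
Proof.
have sL := (LC_normal G s).1.
by apply: LCp_sub => // [|x Lx]; [exact: LC_decr | exact: subgroupX].
Qed.

Lemma LCp_decr s : LCp s.+1 `<=` LCp s.
Proof. by move=> x /LCp_LC; apply: LC_LCp. Qed.

(** The case of a p-th power: [x, z] is central modulo [LC (a + b).+1], so [x, z^p] agrees with
    [x, z]^p there. *)
Lemma LCp_comm a b x y : LC a x -> LCp b y -> LCp (a + b) (commutator x y).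
Proof.
move=> Lx; pose N := Normal (LCp_normal (a + b)).
have cE z : LCp (a + b) (commutator x z) <-> coset_class N (x * z) = coset_class N (z * x).
  by rewrite class_eq /= /commutator invgM !mulgA.
move=> Ky; apply/cE; move: y Ky; apply: LCp_sub.
(* Commuting with [x] modulo [N], rewritten as the equality of two homomorphisms. *)
- pose H := [set z | coset_class N (x * z * x^-1) = coset_class N z].
  have -> : (fun z => coset_class N (x * z) = coset_class N (z * x)) = H.
    apply/funext => z; apply/propext; rewrite /H /= !(classM, classV).
    by split=> [->|e]; [rewrite mulgK | rewrite -[in RHS]e mulgVK].
  apply: equalizer_subgroup => u v; last exact: classM.
  by rewrite -!classM !free_red.
- by move=> z Lz; apply/cE; apply: LC_LCp; rewrite -addnS; apply: LC_comm.
move=> z Lz; apply/cE; apply/(class_eq1 N).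
have cent g : coset_class N g * coset_class N (commutator x z) =
   coset_class N (commutator x z) * coset_class N g.
  apply/commutator1P; rewrite -classR; apply/(class_eq1 N).
  by apply: LC_LCp; apply: LC_in; apply: LC_comm.
rewrite classR classX commutatorX; rewrite -?classR ?cent // -classX.
by apply/(class_eq1 N); apply: LCX_LCp; apply: LC_comm.
Qed.

Lemma Z_sub k : is_subgroup (Z k). Proof. exact: generated_subgroup. Qed.

Definition ZX k x m := @subgroupX G (Z k) x m (Z_sub k).
Definition ZM k x y := @subgroupM G (Z k) x y (Z_sub k).
Definition ZV k x := @subgroupV G (Z k) x (Z_sub k).
Definition Z1 k := subgroup1 (Z_sub k).

Lemma Z_in k i j y : (1 <= i)%N -> (k <= i * p ^ j)%N -> LC i y -> Z k (y ^+ (p ^ j)).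
Proof.
by move=> i1 kij Ly; apply: generated_in; exists i, j; split=> //; apply: power_subgroup_in.
Qed.

Lemma LC_Z k i : (k <= i)%N -> LC i `<=` Z k.
Proof.
move=> ki y Ly; case: i ki Ly => [|i] ki Ly; last first.
  by rewrite -[y]expg1 -(expn0 p); apply: Z_in Ly => //; rewrite expn0 muln1.
by rewrite -[y]expg1 -(expn0 p); apply: (@Z_in k 1) => //; apply: leq_trans ki _.
Qed.

Lemma Z_ind k (H : set G) : is_subgroup H ->
  (forall i j y, (1 <= i)%N -> (k <= i * p ^ j)%N -> LC i y -> H (y ^+ (p ^ j))) ->
  Z k `<=` H.
Proof.
move=> sH HZ; apply: generated_min => // x [i [j [i1 kij]]]; move: x.
by apply: power_subgroup_min => // y; apply: HZ.
Qed.

Lemma Z_decr k : Z k.+1 `<=` Z k.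
Proof.
apply: Z_ind; first exact: Z_sub.
by move=> i j y i1 kij; apply: Z_in => //; apply: leq_trans kij.
Qed.

Lemma Z_le a b : (a <= b)%N -> Z b `<=` Z a.
Proof.
move=> /subnK <-; elim: (b - a)%N => [//|m IH] x.
by rewrite addSn => /Z_decr/IH.
Qed.

(** The first difference is the conjugate of [z] by [(z * y) ^+ t], and this power is polynomial
    over the lower central series, with constant difference [z * y]. *)
Lemma pow_poly i m y z : LC i y -> LCp i z ->
  poly i LCp m 0 (fun t => (z * y) ^+ t * (y ^+ t)^-1).
Proof.
have sub s := (LCp_normal s).1.
have subL s := (LC_normal G s).1.
move=> Ly Kz; have Lz := LCp_LC Kz.
(* Weight 0 is no restriction: [LC 1] is the whole group, hence so is [LCp 0]. *)
case: m => [|m]; split=> //; try by move=> t; apply: (@LC_LCp 0).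
rewrite add0n.
apply: (@eq_poly _ _ _ _ _ (fun t => (z * y) ^+ t * z * ((z * y) ^+ t)^-1)).
  by move=> t; rewrite /diff !expgSr !invgM !free_red.
apply: (@polyJ _ _ LC _ sub LCp_decr LCp_LC LCp_comm _ 0 _ _ (fun=> z)); last first.
  exact: (poly_const _ _ LCp_decr).
case: m => [|m]; split=> // ; rewrite add0n.
apply: (@eq_poly _ _ _ _ _ (fun=> z * y)).
  by move=> t; rewrite /diff expgS mulgK.
apply: (poly_const _ subL (@LC_decr G)).
by apply: subgroupM.
Qed.

(** On generators this is a count of weights: (s + 1) p^r and s p^(r+1) both exceed s p^r. For a
    product, the Hall-Petrescu terms are powers c'^C(p^r, l) with c' in [LCp (s * l)] and l >= 2: if
    p divides l then [r] drops, otherwise the exponent keeps its p-part and the weight grows. Hence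
    the double induction, on [r] and on [T - s]. *)
Lemma LCp_pow T s r c : LCp s c -> (1 <= s)%N -> (T <= (s * p ^ r).+1)%N ->
  Z T (c ^+ (p ^ r)).
Proof.
have [d ldr] := ubnP r; elim: d r ldr s c => // d IHd r ldr s c.
have [e lse] := ubnP (T - s).
elim: e s lse c => // e IHe s lse c Kc s0 leT.
have p1 := prime_gt1 p_prime; have p0 := prime_gt0 p_prime.
have [Ts|sT] := leqP T s.
  by apply: ZX; apply: LC_Z (LCp_LC Kc).
pose X := [set c | LCp s c /\ Z T (c ^+ (p ^ r))].
suff gen_X x y : X x -> X y -> X (x * y).
  have XV x : X x -> X x^-1.
    move=> [Kx Zx]; split; first exact: subgroupV (LCp_normal s).1 Kx.
    by rewrite expVgn; apply: ZV.
  have sX : is_subgroup X.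
    split=> [|x y Xx Xy]; last exact: (gen_X _ _ Xx (XV _ Xy)).
    by split; [exact: (subgroup1 (LCp_normal s).1)|rewrite expg1n; exact: Z1].
  suff /(_ c Kc)[] : LCp s `<=` X by [].
  apply: LCp_sub => // x Lx; split.
  - exact: LC_LCp.
  - apply: Z_in Lx => //; apply: leq_trans leT _.
    by rewrite mulSn -addn1 addnC leq_add2r expn_gt0 p0.
  - exact: LCX_LCp.
  - rewrite -expgnA -expnS; apply: Z_in Lx => //; apply: leq_trans leT _.
    rewrite expnS mulnCA -[X in (X < _)%N]mul1n ltn_pmul2r //.
    by rewrite muln_gt0 s0 expn_gt0 p0.
move=> [Kx Zx] [Ky Zy]; split; first exact: subgroupM (LCp_normal s).1 Kx Ky.
have Ly := LCp_LC Ky.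
pose h t := (x * y) ^+ t * (y ^+ t)^-1.
suff Zh : Z T (h (p ^ r)%N).
  by rewrite -[_ ^+ _](mulgVK (y ^+ (p ^ r))); apply: ZM.
apply: (poly_expand (A := LC) (B := LCp) (i := s)) => //.
- by move=> a; case: (LCp_normal a).
- exact: LCp_decr.
- exact: LCp_LC.
- exact: LCp_comm.
- exact: Z_sub.
- by move=> m; apply: pow_poly.
- by rewrite /h !expg0 mulgV.
- by rewrite /h !expg1 mulgK.
move=> l c' /andP[l2 lq] Kc'.
pose v := logn p l.
have l0 : (0 < l)%N by apply: ltnW.
have vl : (p ^ v <= l)%N by apply: dvdn_leq => //; apply: pfactor_dvdnn.
have vr : (v <= r)%N by rewrite -(leq_exp2l _ _ p1); apply: leq_trans lq.
have dv : (p ^ (r - v) %| 'C(p ^ r, l))%N by apply: dvdn_bin_pow.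
have [k ->] := dvdnP dv; rewrite (mulnC k) expgnA; apply: ZX.
(* The power p^v missing from the binomial coefficient is made up for by the weight, since p^v <=
   l. *)
have sl : (T <= (s * l * p ^ (r - v)).+1)%N.
  apply: leq_trans leT _; rewrite ltnS -mulnA leq_mul2l; apply/orP; right.
  by rewrite -{1}(subnKC vr) expnD leq_mul2r vl orbT.
case: (posnP v) => [v0|v_gt0].
  move: sl; rewrite v0 subn0 => sl; apply: (IHe (s * l)%N) => //; last by rewrite muln_gt0 s0.
  rewrite -ltnS; apply: leq_trans lse; rewrite ltnS ltn_sub2l //.
  by rewrite -[X in (X < _)%N]muln1 ltn_pmul2l.
apply: (IHd _ _ (s * l)%N _ Kc' _ sl); last by rewrite muln_gt0 s0.
apply: leq_trans (_ : r <= d)%N; last by rewrite -ltnS.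
by rewrite ltn_subrL v_gt0 (leq_trans v_gt0 vr).
Qed.

(** Modulo the next term, the p^j-th power map on [LC i] thus factors through the classes modulo
    [LCp i]. Conjugations and endomorphisms that are trivial modulo [LCp 1] change [y] by just such
    a factor [z], which yields [Z_comm] and [endo_Z]. *)
Lemma LCp_pow_mul i j y z : (1 <= i)%N -> LC i y -> LCp i z ->
  Z (i * p ^ j).+1 ((z * y) ^+ (p ^ j) * (y ^+ (p ^ j))^-1).
Proof.
move=> i1 Ly Kz; pose h t := (z * y) ^+ t * (y ^+ t)^-1.
apply: (@poly_expand G i LC LCp _ _ _ _ _ (p ^ j) h) => //.
- by move=> a; case: (LCp_normal a).
- exact: LCp_decr.
- exact: LCp_LC.
- exact: LCp_comm.
- exact: Z_sub.
- by move=> m; apply: pow_poly.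
- by rewrite /h !expg0 mulgV.
- by rewrite /h !expg1 mulgK; apply: (LCp_pow Kz).
move=> l c /andP[l2 lq] Kc.
have p1 := prime_gt1 p_prime.
have l0 : (0 < l)%N by apply: ltnW.
have vl : (p ^ logn p l <= l)%N by apply: dvdn_leq => //; apply: pfactor_dvdnn.
have vr : (logn p l <= j)%N by rewrite -(leq_exp2l _ _ p1); apply: leq_trans lq.
have [k ->] := dvdnP (dvdn_bin_pow j p_prime l0).
rewrite (mulnC k) expgnA; apply: ZX.
apply: (LCp_pow Kc); first by rewrite muln_gt0 i1.
rewrite ltnS -mulnA leq_mul2l; apply/orP; right.
by rewrite -{1}(subnKC vr) expnD leq_mul2r vl orbT.
Qed.

(** For q = p^j one has [g, y^q] = ([g, y] y)^q y^-q, and [g, y] lies in [LC i.+1], inside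
    [LCp i]. *)
Lemma Z_comm k g x : Z k x -> Z k.+1 (commutator g x).
Proof.
have nZ m := zassenhaus_normal G p m.
move: x; apply: Z_ind => [|i j y i1 kij Ly].
  split=> [|x y]; first by rewrite /= /commutator !free_red; exact: Z1.
  rewrite /= => Zx Zy.
  have -> : commutator g (x / y) =
      commutator g x * (x * (y^-1 * (commutator g y)^-1 * y^-1^-1) * x^-1).
    by rewrite /commutator !free_red.
  apply: ZM; first exact: Zx.
  exact: normal_conj _ (nZ _) (normal_conj _ (nZ _) (ZV Zy)).
have -> : commutator g (y ^+ (p ^ j)) =
    (commutator g y * y) ^+ (p ^ j) * (y ^+ (p ^ j))^-1.
  by rewrite /commutator conj_expg mulgVK.
apply: (Z_le _ (LCp_pow_mul i1 Ly (LC_LCp (LC_in g Ly)))).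
by rewrite ltnS.
Qed.

(** Modulo [Z k.+1] the group [Z k] is abelian by [Z_comm], so taking p-th powers is multiplicative
    and generators suffice; their weight becomes at least k p >= 2 k >= k + 1. *)
Lemma Z_pow k x : (0 < k)%N -> Z k x -> Z k.+1 (x ^+ p).
Proof.
have nZ m := zassenhaus_normal G p m.
move=> k0; have p1 := prime_gt1 p_prime.
pose N := Normal (nZ k.+1).
suff sub : Z k `<=` [set x | coset_class N x ^+ p = 1 /\ Z k x].
  by move=> /sub[]; rewrite -classX => /(class_eq1 N).
have sZ := Z_sub k.
apply: Z_ind => [|i j y i1 kij Ly].
  split=> [|u v [up Zu] [vp Zv]]; first by split; [rewrite class1 expg1n|exact: Z1].
  split; last exact: sZ.2.
  rewrite classM classV expgMn.
    by rewrite expVgn up vp invg1 mulg1.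
  apply: commuteV; apply/commutator1P; rewrite -classR; apply/(class_eq1 N).
  exact: Z_comm.
split; last exact: Z_in kij Ly.
rewrite -classX; apply/(class_eq1 N); rewrite /= -expgnA -expnSr.
apply: (@Z_in _ i j.+1) => //; rewrite expnSr mulnA; apply: leq_trans (_ : (k * 2 <= _)%N).
  by rewrite muln2 -addnn -addn1 leq_add2l.
exact: leq_mul.
Qed.

Lemma Z2_LCp : Z 2 `<=` LCp 1.
Proof.
have sK := (LCp_normal 1).1.
apply: Z_ind => // i j y i1 kij Ly.
case: j kij => [|j] kij; last first.
  by rewrite expnSr expgnA; apply: LCX_LCp.
rewrite expn0 expg1; apply: LC_LCp.
by apply: LC_le Ly; rewrite expn0 muln1 in kij.
Qed.

Section TrivialEndo.
Variable F : G -> G.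
Hypothesis FM : {morph F : x y / x * y}.
Hypothesis F_triv : forall g, LCp 1 (F g * g^-1).

(** On a generator [a, b], [F] multiplies [b] by u, which is central modulo [N] by induction, and
    [a] by v in [LCp 1], which commutes with [b] modulo [N]; [commutator_central] removes both. *)
Lemma endo_LCp i y : (1 <= i)%N -> LC i y -> LCp i (F y * y^-1).
Proof.
case: i => // i _; elim: i y => [//|i IH].
pose N := Normal (LCp_normal i.+2).
suff sub : LC i.+2 `<=` [set y | coset_class N (F y) = coset_class N y].
  by move=> y /sub/class_eq.
apply: generated_min => [|_ [a [b [_ Lb ->]]]].
  by apply: equalizer_subgroup => u v; rewrite ?FM classM.
rewrite /= morphR // !classR.
have Fb : F b = (F b * b^-1) * b by rewrite mulgVK.
have Fa : F a = (F a * a^-1) * a by rewrite mulgVK.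
move: (IH _ Lb) Fb (F_triv a) Fa.
move: (F b * b^-1) (F a * a^-1) => u v Ku Fb Kv Fa.
have cu g : coset_class N g * coset_class N u = coset_class N u * coset_class N g.
  apply/commutator1P; rewrite -classR; apply/(class_eq1 N).
  by rewrite /= -add1n; apply: LCp_comm.
have cv y : LC i.+1 y -> coset_class N v * coset_class N y = coset_class N y * coset_class N v.
  move=> Ly; apply/esym/commutator1P; rewrite -classR; apply/(class_eq1 N).
  by rewrite /= -addn1; apply: LCp_comm.
have cc : coset_class N v * coset_class N (commutator a b) =
    coset_class N (commutator a b) * coset_class N v.
  apply/commutator1P; rewrite -classR; apply/(class_eq1 N).
  by rewrite /=; apply: LC_LCp; do 2!apply: LC_in.
rewrite Fa Fb !classM; apply: commutator_central.
- by have := cu (v * a); rewrite classM => ->.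
- exact: cv Lb.
- by rewrite -classR.
- by rewrite -classR cu.
Qed.

Lemma endo_Z k x : Z k x -> Z k.+1 (F x * x^-1).
Proof.
have nZ m := zassenhaus_normal G p m.
pose N := Normal (nZ k.+1).
suff sub : Z k `<=` [set y | coset_class N (F y) = coset_class N y].
  by move=> /sub/class_eq.
apply: Z_ind => [|i j y i1 kij Ly].
  by apply: equalizer_subgroup => u v; rewrite ?FM classM.
apply/class_eq; rewrite morphX //= -[F y](mulgVK y).
by apply: (Z_le _ (LCp_pow_mul i1 Ly (endo_LCp i1 Ly))); rewrite ltnS.
Qed.

End TrivialEndo.

End PowerFiltration.

(** * The Stallings series *)

Section StallingsSeries.
Variables (G : groupType) (p : nat).
Local Notation S := (@stallings G p).

Lemma S_sub k : is_subgroup (S k). Proof. by case: (stallings_normal G p k). Qed.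

Lemma S_comm k g x : S k x -> S k.+1 (commutator g x).
Proof. by case: k => [|k] Sx //; apply: generated_in; left; apply: comm_subgroup_in. Qed.

Lemma S_pow k x : S k x -> S k.+1 (x ^+ p).
Proof. by case: k => [|k] Sx //; apply: generated_in; right; apply: power_subgroup_in. Qed.

Lemma S_ind k (H : set G) : is_subgroup H ->
  (forall g x, S k.+1 x -> H (commutator g x)) ->
  (forall x, S k.+1 x -> H (x ^+ p)) -> S k.+2 `<=` H.
Proof.
move=> sH Hc Hp; apply: generated_min => // x [].
  by apply: generated_min => // _ [g [y [_ Sy ->]]]; apply: Hc.
by apply: power_subgroup_min.
Qed.

Lemma S_decr k : S k.+1 `<=` S k.
Proof.
case: k => [|k] //; apply: S_ind; first exact: S_sub.
  by move=> g x Sx; apply: normal_comm => //; apply: stallings_normal.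
by move=> x Sx; apply: subgroupX => //; apply: S_sub.
Qed.

(** [LCp p 1] is the second Stallings term, and this is the instance of [S_a, S_b] in S_(a+b) that
    endomorphisms require. Commutators are treated by Hall-Witt, p-th powers by [y, x^p] = [y, x]^p
    modulo [N]. *)
Lemma S2_comm m u y : LCp p 1 u -> S m y -> S m.+2 (commutator u y).
Proof.
move=> Ku Sy; pose N := Normal (stallings_normal G p m.+2).
suff sub : LCp p 1 `<=` [set z | normal_set N (commutator z y)] by apply: sub.
have cN x g : S m.+1 x -> coset_class N g * coset_class N x = coset_class N x * coset_class N g.
  by move=> Sx; apply/comm_classP; apply: S_comm.
apply: LCp_sub; first exact: centralizer_subgroup.
  apply: generated_min; first exact: centralizer_subgroup.
  move=> _ [a [b [_ _ ->]]]; apply/comm_classP; rewrite classR.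
  by apply: three_subgroups; rewrite -!classV -!classR; apply: cN; apply: S_comm.
move=> x _; apply/comm_classP/esym/commutator1P.
have Sc : S m.+1 (commutator y x).
  by rewrite -commutatorV; apply: subgroupV; [exact: S_sub | exact: S_comm].
rewrite classX commutatorX; try by rewrite -classR; apply: cN.
rewrite -classR -classX; by apply/(class_eq1 N)/S_pow.
Qed.

Lemma endo_S (F : G -> G) k x : {morph F : x y / x * y} ->
  (forall g, LCp p 1 (F g * g^-1)) -> (0 < k)%N -> S k x -> S k.+1 (F x * x^-1).
Proof.
move=> FM F_triv; case: k => // k _; elim: k x => [x _|k IH]; first exact: F_triv.
pose N := Normal (stallings_normal G p k.+3).
have cN x g : S k.+2 x -> coset_class N g * coset_class N x = coset_class N x * coset_class N g.
  by move=> Sx; apply/comm_classP; apply: S_comm.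
suff sub : S k.+2 `<=` [set y | coset_class N (F y) = coset_class N y].
  by move=> x /sub/class_eq.
apply: S_ind; first by apply: equalizer_subgroup => u v; rewrite ?FM classM.
- move=> a b Sb /=; rewrite morphR // !classR.
  rewrite -[F b](mulgVK b) -[F a](mulgVK a).
  move: (F b * b^-1) (F a * a^-1) (IH b Sb) (F_triv a) => u v Su Kv.
  rewrite !classM; apply: commutator_central.
  + by have := cN u (v * a) Su; rewrite classM => ->.
  + by apply/comm_classP; apply: S2_comm.
  + by rewrite -classR; apply: cN; apply: S_comm.
  + by rewrite -classR; apply/esym/cN.
- move=> x Sx; rewrite /= morphX // !classX -[F x](mulgVK x).
  have Su := IH x Sx; rewrite classM expgMn; last exact/esym/cN.
  have -> : coset_class N (F x * x^-1) ^+ p = 1; last by rewrite mul1g.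
  by rewrite -classX; apply/(class_eq1 N); apply: S_pow.
Qed.

End StallingsSeries.

(** * Properties shared by the two series, and their behaviour under homomorphisms *)

Section Series.
Variables (b : series_kind) (p : nat).
Hypothesis p_prime : prime p.
Section OneGroup.
Variable G : groupType.
Local Notation D := (fun k => normal_set (series b p G k)).

Lemma series_normal k : is_normal (D k). Proof. exact: normalP. Qed.

Lemma series_sub k : is_subgroup (D k). Proof. by case: (series_normal k). Qed.

Lemma series1 x : D 1%N x.
Proof. by case: b => //=; exact: (@LC_Z G p 1 1). Qed.

Lemma series_comm k g x : D k x -> D k.+1 (commutator g x).
Proof. by case: b => /=; [exact: S_comm | exact: Z_comm]. Qed.

Lemma series_pow k x : (0 < k)%N -> D k x -> D k.+1 (x ^+ p).
Proof. by move=> k0; case: b => /=; [exact: S_pow | exact: Z_pow]. Qed.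

Lemma series_decr k : D k.+1 `<=` D k.
Proof. by case: b => /=; [exact: S_decr | exact: Z_decr]. Qed.

Lemma series_le i j : (i <= j)%N -> D j `<=` D i.
Proof.
move=> /subnK <-; elim: (j - i)%N => [//|m IH] x.
by rewrite addSn => /series_decr/IH.
Qed.

Lemma series_endo (F : G -> G) k x : {morph F : x y / x * y} ->
  (forall g, D 2%N (F g * g^-1)) -> (0 < k)%N -> D k x -> D k.+1 (F x * x^-1).
Proof.
case: b => /= FM F2 k0; first by apply: endo_S.
by apply: endo_Z => // g; apply: Z2_LCp.
Qed.

End OneGroup.

Section TwoGroups.
Variables (G H : groupType) (f : G -> H).
Hypothesis fM : {morph f : x y / x * y}.

Lemma LC_morph k x : lower_central k x -> lower_central k (f x).
Proof.
case: k => [|k] //; elim: k x => [//|k IH].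
apply: (generated_min (H := f @^-1` lower_central k.+2)).
  exact: (preim_subgroup fM (LC_normal H _).1).
move=> _ [x [y [_ Ly ->]]]; rewrite /preimage /= morphR //.
by apply: comm_subgroup_in => //; apply: IH.
Qed.

Lemma series_morph k x : normal_set (series b p G k) x -> normal_set (series b p H k) (f x).
Proof.
have := preim_subgroup fM (series_sub H k); case: b => /= sub; last first.
  move: x; apply: (Z_ind sub) => i j y i1 kij Ly.
  by rewrite /preimage /= morphX //; apply: Z_in kij _ => //; apply: LC_morph.
case: k sub => [|k] // _; elim: k x => [//|k IH].
apply: (S_ind (H := f @^-1` stallings p k.+2)).
- exact: (preim_subgroup fM (S_sub H p _)).
- by move=> g x Sx; rewrite /preimage /= morphR //; apply: S_comm; apply: IH.
- by move=> x Sx; rewrite /preimage /= morphX //; apply: S_pow; apply: IH.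
Qed.

Variable B : nat -> set H.
Hypothesis B_sub : forall k, is_subgroup (B k).
Hypothesis B1 : forall g, B 1%N (f g).
Hypothesis B_comm : forall k g y, (0 < k)%N -> B k y -> B k.+1 (commutator (f g) y).
Hypothesis B_decr : forall k, B k.+1 `<=` B k.
Hypothesis B_pow : forall k y, (0 < k)%N -> B k y ->
  B (if b is Stallings then k.+1 else k * p)%N (y ^+ p).

(** The tool for showing that an element survives in the tower: choose a target group and a
    filtration [B] there. In the Zassenhaus case p-th powers must multiply the weight by p, because
    (G_i)^(p^j) counts with weight i p^j. *)
Lemma series_filtration k x : normal_set (series b p G k.+1) x -> B k.+1 (f x).
Proof.
have sP k' := preim_subgroup fM (B_sub k').
move: B_pow; case: b => /= Bp; first last.
  have LB i y : lower_central i.+1 y -> B i.+1 (f y).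
    elim: i y => [//|i IH]; apply: (generated_min (H := f @^-1` B i.+2)) => //.
    move=> _ [u [v [_ Lv ->]]]; rewrite /preimage /= morphR //.
    by apply: B_comm => //; apply: IH.
  have Ble i j : (i <= j)%N -> B j `<=` B i.
    move=> /subnK <-; elim: (j - i)%N => [//|m IH] y.
    by rewrite addSn => /B_decr/IH.
  move: x; apply: (Z_ind (H := f @^-1` B k.+1)) => // i j y i1 kij Ly.
  rewrite /preimage /= morphX //; apply: (Ble _ _ kij).
  elim: j {kij} => [|j IH]; first by case: i i1 Ly => // i _ Ly; rewrite muln1; apply: LB.
  rewrite expnSr expgnA mulnA; apply: Bp => //.
  by rewrite muln_gt0 i1 expn_gt0 prime_gt0.
elim: k x => [//|k IH]; apply: (S_ind (H := f @^-1` B k.+2)) => //.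
- by move=> g x Sx; rewrite /preimage /= morphR //; apply: B_comm => //; apply: IH.
- by move=> x Sx; rewrite /preimage /= morphX //; apply: Bp => //; apply: IH.
Qed.

End TwoGroups.
End Series.

(** * The tower of quotients of a free group *)

Definition is_basis n (G : groupType) (x : 'I_n -> G) : Prop :=
  forall (H : groupType) (y : 'I_n -> H), exists f : {multiplicative G -> H},
    (forall j, f (x j) = y j) /\
    (forall g : {multiplicative G -> H}, (forall j, g (x j) = y j) -> g =1 f).

Lemma bij_of_comp (T : Type) (f g : T -> T) :
  bijective (f \o g) -> bijective (g \o f) -> bijective f.
Proof.
move=> [r _ fgr] [l lgf _]; exists (l \o g) => // y /=.
have e : f (g (r y)) = y := fgr y.
have e' : l (g (f (g (r y)))) = g (r y) := lgf _.
by rewrite -{1}e e' e.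
Qed.

Section Aut.
Variable G : groupType.
Implicit Types a c : automorphism G.
Lemma aut_mulE a c g : (a * c) g = a (c g). Proof. by []. Qed.
Lemma aut_oneE g : (1 : automorphism G) g = g. Proof. by []. Qed.
Lemma autVK a : cancel (aut_fun a^-1%g) a.
Proof. by move=> g; rewrite -aut_mulE mulgV. Qed.
Lemma autKV a : cancel a (aut_fun a^-1%g).
Proof. by move=> g; rewrite -aut_mulE mulVg. Qed.
End Aut.

Section Tower.
Variables (b : series_kind) (p n : nat) (Gamma : groupType) (x : 'I_n -> Gamma).
Hypothesis p_prime : prime p.
Hypothesis basis_x : is_basis x.

Local Notation D := (fun k => normal_set (series b p Gamma k)).
Local Notation N := (NN b p Gamma).
Local Notation L := (LL b p Gamma).
Definition pi m : Gamma -> N m := coset_class (series b p Gamma m.+1).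

Lemma free_hom (H : groupType) (y : 'I_n -> H) :
  exists f : Gamma -> H, {morph f : u v / u * v} /\ forall j, f (x j) = y j.
Proof. by have [f [fx _]] := basis_x y; exists f; split=> // u v; apply: gmulfM. Qed.

Lemma free_eq (H : groupType) (f g : Gamma -> H) : {morph f : u v / u * v} ->
  {morph g : u v / u * v} -> (forall j, f (x j) = g (x j)) -> f =1 g.
Proof.
move=> fM gM fg; have [h [hx h_uniq]] := basis_x (g \o x).
pose f' : {multiplicative Gamma -> H} := HB.pack f (isMultiplicative.Build _ _ f fM).
pose g' : {multiplicative Gamma -> H} := HB.pack g (isMultiplicative.Build _ _ g gM).
move=> u; have -> : f u = h u by apply: (h_uniq f').
by apply/esym; apply: (h_uniq g').
Qed.

Lemma piM m : {morph pi m : u v / u * v}. Proof. exact: classM. Qed.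
Definition pi1 m := morph1 (@piM m).
Definition piV m := morphV (@piM m).
Definition piX m := morphX (@piM m).
Definition piR m := morphR (@piM m).

Lemma pi_surj m u : exists g, u = pi m g. Proof. exact: class_surj. Qed.

Lemma pi_eq1 m g : pi m g = 1 <-> D m.+1 g. Proof. exact: class_eq1. Qed.

Lemma pi_eq m g h : pi m g = pi m h <-> D m.+1 (g * h^-1). Proof. exact: class_eq. Qed.

Lemma projE j k g : (k <= j)%N -> NN_proj b p k (pi j g) = pi k g.
Proof.
move=> kj; apply/esym/coset_eqP.
exact: (series_le (kj : (k.+1 <= j.+1)%N) (coset_reprP _ g)).
Qed.

Lemma projM j k : (k <= j)%N -> {morph (NN_proj b p k : N j -> N k) : u v / u * v}.
Proof.
move=> kj u v; have [g ->] := pi_surj u; have [h ->] := pi_surj v.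
by rewrite -piM !projE // piM.
Qed.

Lemma proj_proj i j k (u : N k) : (i <= j <= k)%N ->
  NN_proj b p i (NN_proj b p j u : N j) = NN_proj b p i u.
Proof.
move=> /andP[ij jk]; have [g ->] := pi_surj u.
by rewrite !projE // (leq_trans ij).
Qed.

Lemma proj_id k (u : N k) : NN_proj b p k u = u.
Proof. by have [g ->] := pi_surj u; rewrite projE. Qed.

Lemma proj_surj j k (u : N k) : (k <= j)%N -> exists v : N j, u = NN_proj b p k v.
Proof. by move=> kj; have [g ->] := pi_surj u; exists (pi j g); rewrite projE. Qed.

Lemma pi_factor m (H : groupType) (f : Gamma -> H) : {morph f : u v / u * v} ->
  (forall g, D m.+1 g -> f g = 1) ->
  exists f' : N m -> H, {morph f' : u v / u * v} /\ forall g, f' (pi m g) = f g.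
Proof.
move=> fM f1; exists (fun u => f (coset_repr u)).
have fE g : f (coset_repr (pi m g)) = f g.
  apply/divg1_eq; rewrite -morphV // -fM; apply: f1.
  by apply/pi_eq; rewrite /pi coset_reprK.
split=> // u v; have [g ->] := pi_surj u; have [h ->] := pi_surj v.
by rewrite -piM !fE.
Qed.

Lemma NN_eq m (H : groupType) (f g : N m -> H) : {morph f : u v / u * v} ->
  {morph g : u v / u * v} -> (forall j, f (pi m (x j)) = g (pi m (x j))) -> f =1 g.
Proof.
move=> fM gM fg u; have [h ->] := pi_surj u.
by apply: (free_eq (f := f \o pi m) (g := g \o pi m)) => // v w; rewrite /= piM ?fM ?gM.
Qed.

Lemma NN_lift m m' (f : N m -> N m') : {morph f : u v / u * v} ->
  exists F : Gamma -> Gamma,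
    {morph F : u v / u * v} /\ forall g, f (pi m g) = pi m' (F g).
Proof.
move=> fM; have [F [FM Fx]] := free_hom (fun j => coset_repr (f (pi m (x j)))).
exists F; split=> // g; apply: (free_eq (f := f \o pi m) (g := pi m' \o F)).
- by move=> u v; rewrite /= piM fM.
- by move=> u v; rewrite /= FM piM.
- by move=> j; rewrite /= Fx /pi coset_reprK.
Qed.

Lemma NN_desc m (F : Gamma -> Gamma) : {morph F : u v / u * v} ->
  exists f : N m -> N m,
    {morph f : u v / u * v} /\ forall g, f (pi m g) = pi m (F g).
Proof.
move=> FM; apply: pi_factor => [u v|g Dg]; first by rewrite FM piM.
by apply/pi_eq1; apply: series_morph.
Qed.

Lemma NN_hom m (y : 'I_n -> N m) : exists f : N m -> N m,
  {morph f : u v / u * v} /\ forall j, f (pi m (x j)) = y j.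
Proof.
have [F [FM Fx]] := free_hom (fun j => coset_repr (y j)).
have [f [fM fE]] := NN_desc m FM; exists f; split=> // j.
by rewrite fE Fx /pi coset_reprK.
Qed.

Lemma LL_P k u : L k u <-> exists2 g, D k g & u = pi k g.
Proof. by split=> [[g Dg <-]|[g Dg ->]]; exists g. Qed.

Lemma LL_proj k (u : N k.+1) : L k.+1 u <-> NN_proj b p k u = 1.
Proof.
have [g ->] := pi_surj u; rewrite projE // pi_eq1.
split=> [/LL_P[h Dh /pi_eq Dgh]|Dg]; last by apply/LL_P; exists g.
rewrite -[g](mulgVK h); apply: (subgroupM (series_sub b p _ _)) => //.
exact: (series_decr).
Qed.

Lemma LL_central k (l g : N k) : L k l -> g * l = l * g.
Proof.
move=> /LL_P[h Dh ->]; have [g' ->] := pi_surj g.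
by apply/comm_classP; apply: series_comm.
Qed.

Lemma LL_exp k (l : N k) : (0 < k)%N -> L k l -> l ^+ p = 1.
Proof.
by move=> k0 /LL_P[h Dh ->]; rewrite -piX; apply/pi_eq1; apply: series_pow.
Qed.

Lemma LL_sub k : is_subgroup (L k).
Proof.
split; first by apply/LL_P; exists 1; rewrite ?pi1 //; apply: subgroup1; apply: series_sub.
move=> _ _ /LL_P[g Dg ->] /LL_P[h Dh ->]; apply/LL_P; exists (g * h^-1).
  exact: (series_sub b p _ _).2.
by rewrite piM piV.
Qed.

Lemma LL1 (u : N 1) : L 1 u.
Proof. by have [g ->] := pi_surj u; apply/LL_P; exists g => //; apply: series1. Qed.

Lemma NN1_comm (u v : N 1) : u * v = v * u.
Proof. exact: LL_central (LL1 v). Qed.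

Lemma NN1_exp (u : N 1) : u ^+ p = 1.
Proof. exact: LL_exp (LL1 u). Qed.

(** [N 1] is the largest quotient that is abelian of exponent p. The filtration [B] is the image of
    [f] up to weight 1 and trivial from weight 2 on. *)
Lemma NN1_factor (H : groupType) (f : Gamma -> H) : {morph f : u v / u * v} ->
  (forall g h, f g * f h = f h * f g) -> (forall g, f g ^+ p = 1) ->
  exists f' : N 1 -> H, {morph f' : u v / u * v} /\ forall g, f' (pi 1 g) = f g.
Proof.
move=> fM fC fX; apply: pi_factor => // g Dg.
pose B k := [set y : H | if (k <= 1)%N then exists g, y = f g else y = 1].
suff : B 2%N (f g) by [].
have p1 := prime_gt1 p_prime.
apply: (series_filtration p_prime fM _ _ _ _ _ Dg) => [[|[|k]]|g'|k g' y k0|k|k y k0].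
- split=> [|_ _ [u ->] [v ->]]; first by exists 1; rewrite (morph1 fM).
  by exists (u * v^-1); rewrite fM (morphV fM).
- split=> [|_ _ [u ->] [v ->]]; first by exists 1; rewrite (morph1 fM).
  by exists (u * v^-1); rewrite fM (morphV fM).
- by split=> [|u v]; rewrite /B //= => -> ->; rewrite mulgV.
- by exists g'.
- case: k k0 => // -[|k] _ ; rewrite /B /=; last first.
    by move=> ->; rewrite /commutator !free_red.
  by move=> [u ->]; apply/commutator1P.
- by case: k => [|[|k]] // y; rewrite /B /= => ->; exists 1; rewrite (morph1 fM).
- move=> By.
  have yp : y ^+ p = 1.
    move: By; case: k k0 => // -[|k] _; rewrite /B /=; first by move=> [u ->].
    by move=> ->; rewrite expg1n.
  have k2 : (1 < if b is Stallings then k.+1 else k * p)%N.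
    by case: b => //; rewrite -[1%N]muln1 ?(leq_trans p1) ?leq_pmull.
  by rewrite /B /= yp; case: (leqP _ 1) => // _; exists 1; rewrite (morph1 fM).
Qed.

Lemma IA_LL k (e : N k -> N k) l : (0 < k)%N -> {morph e : u v / u * v} ->
  (forall u, NN_proj b p 1 (e u) = NN_proj b p 1 u) -> L k l -> e l = l.
Proof.
move=> k0 eM e1 /LL_P[g Dg ->]; have [F [FM FE]] := NN_lift eM.
rewrite FE; apply/pi_eq; apply: (series_endo p_prime FM) => // h.
by apply/(@pi_eq 1); rewrite -(@projE k) // -FE e1 projE.
Qed.

Section OneStep.
Variable k : nat.
Hypothesis k0 : (0 < k)%N.
Let proj1 : {morph (NN_proj b p 1 : N k.+1 -> N 1) : u v / u * v}.
Proof. exact: projM. Qed.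

Lemma kernel_bij (e : N k.+1 -> N k.+1) : {morph e : u v / u * v} ->
  (forall g, NN_proj b p k (e g) = NN_proj b p k g) -> bijective e.
Proof.
move=> eM ek.
have eL l : L k.+1 l -> e l = l.
  apply: IA_LL => // u.
  by rewrite -(@proj_proj 1 k) ?k0 ?leqnSn // ek proj_proj ?k0 ?leqnSn.
have dL g : L k.+1 (e g * g^-1).
  by apply/LL_proj; rewrite (projM (leqnSn k)) ek -(projM (leqnSn k)) mulgV -(pi1 k.+1) projE // pi1.
(* [e] multiplies [g] by an element of [L k.+1], which it fixes; dividing by that element therefore
   undoes [e]. *)
exists (fun g => (e g * g^-1)^-1 * g) => g.
  have eg : e g = (e g * g^-1) * g by rewrite mulgVK.
  have eeg : e (e g) = (e g * g^-1) * e g by rewrite {1}eg eM eL.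
  by rewrite eeg mulgK {2}eg mulKg.
have /(subgroupV (LL_sub _)) dV := dL g.
by rewrite eM (eL _ dV) !free_red.
Qed.

(** Compose with a lift of the inverse of [a]: the two composites need not be the identity, but they
    are trivial modulo [L k.+1], hence bijective by [kernel_bij]. *)
Lemma endo_bij (e : N k.+1 -> N k.+1) (a : automorphism (N k)) :
  {morph e : u v / u * v} ->
  (forall g, NN_proj b p k (e g) = a (NN_proj b p k g)) -> bijective e.
Proof.
move=> eM ea; have [F [FM FE]] := NN_lift (autM a^-1%g).
have [e' [e'M e'E]] := NN_desc k.+1 FM.
have e'a g : NN_proj b p k (e' g) = aut_fun a^-1%g (NN_proj b p k g).
  by have [h ->] := pi_surj g; rewrite e'E !projE // FE.
apply: (@bij_of_comp _ _ e'); apply: kernel_bij => [u v|g] /=; rewrite ?e'M ?eM //.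
  by rewrite ea e'a autVK.
by rewrite e'a ea autKV.
Qed.

Definition is_lift (phi : automorphism (N k.+1)) (a : automorphism (N k)) :=
  forall g, a (NN_proj b p k g) = NN_proj b p k (phi g).

Lemma lift_endo (e : N k.+1 -> N k.+1) (a : automorphism (N k)) :
  {morph e : u v / u * v} ->
  (forall g, NN_proj b p k (e g) = a (NN_proj b p k g)) ->
  exists2 phi, is_lift phi a & aut_fun phi = e.
Proof.
by move=> eM ea; exists (Automorphism eM (endo_bij eM ea)).
Qed.

Lemma lift_exists a : exists phi, is_lift phi a.
Proof.
have [F [FM FE]] := NN_lift (autM a).
have [e [eM eE]] := NN_desc k.+1 FM.
have [|phi la _] := lift_endo (a := a) eM; last by exists phi.
by move=> g; have [h ->] := pi_surj g; rewrite eE !projE // FE.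
Qed.

Lemma desc_exists phi : exists a, is_lift phi a.
Proof.
have desc (f : automorphism (N k.+1)) : exists d : N k -> N k, {morph d : u v / u * v} /\
    forall g, d (NN_proj b p k g) = NN_proj b p k (f g).
  have [F [FM FE]] := NN_lift (autM f); have [d [dM dE]] := NN_desc k FM.
  exists d; split=> // g; have [h ->] := pi_surj g.
  by rewrite FE !projE.
have [d [dM dE]] := desc phi; have [d' [_ d'E]] := desc phi^-1%g.
have db : bijective d.
  exists d' => u; have [v ->] := proj_surj u (leqnSn k).
    by rewrite dE d'E autKV.
  by rewrite d'E dE autVK.
by exists (Automorphism dM db).
Qed.

Lemma desc_uniq phi a c : is_lift phi a -> is_lift phi c -> a = c.
Proof.
move=> la lc; apply: aut_ext => u.
by have [v ->] := proj_surj u (leqnSn k); rewrite la lc.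
Qed.

Local Notation HomNL := (homs (N 1) (L k.+1)).

Lemma hom_aut f : HomNL f ->
  exists e : automorphism (N k.+1), forall g, e g = f (NN_proj b p 1 g) * g.
Proof.
move=> [fM fL]; pose e (g : N k.+1) := f (NN_proj b p 1 g) * g.
have eM : {morph e : u v / u * v}.
  move=> u v; rewrite /e proj1 fM -!mulgA; congr (_ * _).
  by rewrite !mulgA (LL_central u (fL _)).
have eb : bijective e.
  apply: kernel_bij => // g; rewrite /e (projM (leqnSn k)).
  by move/LL_proj: (fL (NN_proj b p 1 g)) => ->; rewrite mul1g.
by exists (Automorphism eM eb).
Qed.

(** The map sending g to e(g) g^-1 is multiplicative because its values are central, and it factors
    through [N 1] because they have exponent p. *)
Lemma kernel_hom (e : automorphism (N k.+1)) : is_lift e 1 ->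
  exists2 f, HomNL f & forall g, e g = f (NN_proj b p 1 g) * g.
Proof.
move=> e1; pose d g := e (pi k.+1 g) * (pi k.+1 g)^-1.
have dL g : L k.+1 (d g).
  apply/LL_proj; rewrite (projM (leqnSn k)) -e1 aut_oneE -(projM (leqnSn k)) mulgV.
  by rewrite -(pi1 k.+1) projE // pi1.
have dM : {morph d : u v / u * v}.
  move=> u v; have c := LL_central (pi k.+1 u)^-1 (dL v).
  by rewrite {1 2}/d -mulgA c /d piM autM invgM !mulgA.
have [|g|f [fM fE]] := NN1_factor dM.
- by move=> g h; apply: LL_central.
- exact: LL_exp.
exists f; first by split=> // u; have [g ->] := pi_surj u; rewrite fE.
by move=> g; have [h ->] := pi_surj g; rewrite projE // fE /d mulgVK.
Qed.

End OneStep.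
End Tower.

(** * Nontriviality of iterated commutators *)

Section SubgroupType.
Variables (G : groupType) (H : set G).

Record subgroup_type (sH : is_subgroup H) :=
  SubgroupElt { subgroup_val : G; subgroup_valP : H subgroup_val }.

Variable sH : is_subgroup H.
Local Notation T := (subgroup_type sH).
Local Notation val := (@subgroup_val sH).

Lemma subgroup_val_inj : injective val.
Proof. by move=> [u Hu] [v Hv] /= e; subst v; rewrite (Prop_irrelevance Hu Hv). Qed.

HB.instance Definition _ := gen_eqMixin T.
HB.instance Definition _ := gen_choiceMixin T.

Definition subgroup_mul (u v : T) : T :=
  SubgroupElt sH (subgroupM sH (subgroup_valP u) (subgroup_valP v)).
Definition subgroup_one : T := SubgroupElt sH (subgroup1 sH).
Definition subgroup_inv (u : T) : T := SubgroupElt sH (subgroupV sH (subgroup_valP u)).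

Lemma subgroup_mulA : associative subgroup_mul.
Proof. by move=> u v w; apply: subgroup_val_inj; apply: mulgA. Qed.
Lemma subgroup_mul1 : left_id subgroup_one subgroup_mul.
Proof. by move=> u; apply: subgroup_val_inj; apply: mul1g. Qed.
Lemma subgroup_mulg1 : right_id subgroup_one subgroup_mul.
Proof. by move=> u; apply: subgroup_val_inj; apply: mulg1. Qed.
Lemma subgroup_mulV : left_inverse subgroup_one subgroup_inv subgroup_mul.
Proof. by move=> u; apply: subgroup_val_inj; apply: mulVg. Qed.
Lemma subgroup_mulgV : right_inverse subgroup_one subgroup_inv subgroup_mul.
Proof. by move=> u; apply: subgroup_val_inj; apply: mulgV. Qed.

HB.instance Definition _ := isGroup.Build T
  subgroup_mulA subgroup_mul1 subgroup_mulg1 subgroup_mulV subgroup_mulgV.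

End SubgroupType.

(** Generation follows from the universal property: the homomorphism into [H] that extends [x],
    followed by the inclusion, agrees with the identity on the basis. *)
Lemma basis_ind n (G : groupType) (x : 'I_n -> G) (H : set G) :
  is_basis x -> is_subgroup H -> (forall j, H (x j)) -> forall g, H g.
Proof.
move=> bx sH Hx g.
have [f [fM fx]] := free_hom bx (fun j => SubgroupElt sH (Hx j)).
suff -> : g = subgroup_val (f g) by apply: subgroup_valP.
apply: (free_eq bx (f := id) (g := fun g => subgroup_val (f g))) => // [u v|j].
  by rewrite fM.
by rewrite fx.
Qed.

Section UnitriangularFiltration.
Variables (p m : nat).
Hypothesis p_prime : prime p.
Import GRing.Theory.
Local Open Scope ring_scope.
Local Notation M := 'M['F_p]_m.+1.

Definition upper k (A : M) := forall i j : 'I_m.+1, (j < i + k)%N -> A i j = 0.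

Lemma upper0 k : upper k 0. Proof. by move=> i j _; rewrite mxE. Qed.

Lemma upperD k A B : upper k A -> upper k B -> upper k (A + B).
Proof. by move=> uA uB i j ij; rewrite mxE uA // uB // addr0. Qed.

Lemma upperN k A : upper k A -> upper k (- A).
Proof. by move=> uA i j ij; rewrite mxE uA // oppr0. Qed.

Lemma upper_le k l A : (k <= l)%N -> upper l A -> upper k A.
Proof. by move=> kl uA i j ij; apply: uA; apply: leq_trans ij _; rewrite leq_add2l. Qed.

Lemma upperM k l A B : upper k A -> upper l B -> upper (k + l) (A * B).
Proof.
move=> uA uB i j ij; rewrite mxE big1 // => s _.
have [si|si] := ltnP s (i + k); first by rewrite uA // mul0r.
by rewrite uB ?mulr0 //; apply: leq_trans ij _; rewrite addnA leq_add2r.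
Qed.

Lemma upper1 : upper 0 1.
Proof. by move=> i j; rewrite addn0 mxE -val_eqE /= => ji; rewrite gtn_eqF. Qed.

Lemma upperX k A s : upper k A -> upper (k * s) (A ^+ s).
Proof.
move=> uA; elim: s => [|s IH]; first by rewrite muln0 expr0; apply: upper1.
by rewrite exprS mulnS; apply: upperM.
Qed.

Lemma upper_unit A : upper 1 (A - 1) -> A \is a GRing.unit.
Proof.
move=> uA; have tA : is_trig_mx A^T.
  apply/is_trig_mxP => i j ij; rewrite mxE.
  have := uA j i; rewrite addn1 ltnS (ltnW ij) !mxE -val_eqE /= gtn_eqF // subr0.
  by move/(_ isT).
rewrite [_ \in _]unitmxE -det_tr (det_trig tA) big1 ?unitr1 //.
move=> i _; have := uA i i; rewrite addn1 ltnSn mxE !mxE eqxx => /(_ isT)/eqP.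
by rewrite subr_eq0 => /eqP.
Qed.

Local Notation uval := (@FinRing.uval _ : {unit M} -> M).

Lemma uvalM (g h : {unit M}) : uval (g * h)%g = uval g * uval h. Proof. by []. Qed.
Lemma uval1 : uval 1%g = 1. Proof. by []. Qed.
Lemma uvalX (g : {unit M}) s : uval (g ^+ s)%g = uval g ^+ s.
Proof. exact: FinRing.val_unitX. Qed.

Definition unitri k : set {unit M} := [set g | upper k (uval g - 1)].

Lemma unitriM k : forall g h, unitri k g -> unitri k h -> unitri k (g * h)%g.
Proof.
move=> g h ug uh; rewrite /unitri /mkset uvalM.
have -> : uval g * uval h - 1 = (uval g - 1) * (uval h - 1) + (uval g - 1) + (uval h - 1).
  rewrite -{1}[uval g](subrK 1) -{1}[uval h](subrK 1).
  by rewrite mulrDl mulrDr mulr1 mul1r addrA addrK.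
by do 2!apply: upperD => //; apply: upper_le (upperM ug uh); rewrite leq_addr.
Qed.

Lemma unitri_sub k : is_subgroup (unitri k).
Proof.
have u1 : unitri k 1%g by rewrite /unitri /mkset uval1 subrr; apply: upper0.
split=> // g h ug uh; apply: unitriM => //.
(* The group of units is finite, so an inverse is a power and closure under products suffices. *)
rewrite invg_expg; elim: _.-1 => [//|s IH].
by rewrite expgS; apply: unitriM.
Qed.

Lemma unitri_le k l : (k <= l)%N -> unitri l `<=` unitri k.
Proof. by move=> kl g; apply: upper_le. Qed.

Lemma unitri_comm k l g h : unitri k g -> unitri l h -> unitri (k + l) (commutator g h).
Proof.
move=> ug uh; rewrite /unitri /mkset.
set a := uval g - 1 in ug; set b := uval h - 1 in uh.
have -> : uval (commutator g h) - 1 = (a * b - b * a) * uval (g^-1 * h^-1)%g.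
  have -> : a * b - b * a = uval (g * h)%g - uval (h * g)%g.
    have mul1 A B : (A + 1) * (B + 1) = A * B + (A + B + 1) :> M.
      by rewrite mulrDl mulrDr mulr1 mul1r -!addrA.
    rewrite !uvalM -[uval g](subrK 1) -[uval h](subrK 1) -/a -/b !mul1.
    by rewrite [b + a]addrC opprD addrACA subrr addr0.
  by rewrite mulrBl -!uvalM !mulgA mulgK mulgV uval1.
rewrite -[(k + l)%N]addn0; apply: upperM.
  by apply: upperD; [|apply: upperN; rewrite addnC]; apply: upperM.
rewrite -[uval _](subrK 1); apply: upperD; last exact: upper1.
have u0 s u : unitri s u -> unitri 0 u^-1%g.
  exact: (fun uu => subgroupV (unitri_sub 0) (unitri_le (leq0n s) uu)).
exact: (unitriM (u0 _ _ ug) (u0 _ _ uh)).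
Qed.

(** In characteristic p, g^p - 1 = (g - 1)^p. This gives the factor p demanded by the Zassenhaus
    series. *)
Lemma unitriX k g : unitri k g -> unitri (k * p) (g ^+ p)%g.
Proof.
move=> ug; rewrite /unitri /mkset uvalX.
have pM : p \in [pchar M] by rewrite pchar_lalg pchar_Fp.
have -> : uval g ^+ p = (uval g - 1) ^+ p + 1.
  rewrite -[in LHS](subrK 1 (uval g)) -!(pFrobenius_autE pM).
  by rewrite pFrobenius_autD_comm ?pFrobenius_aut1 //; apply: commr1.
by rewrite addrK; apply: upperX.
Qed.

End UnitriangularFiltration.

Section DeltaMatrix.
Import GRing.Theory.
Local Open Scope ring_scope.

Lemma mul_mx_delta (R : pzSemiRingType) m n q (A : 'M[R]_(m, n)) a (c : 'I_q) i j :
  (A *m delta_mx a c) i j = A i a *+ (j == c).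
Proof.
rewrite mxE (bigD1 a) //= big1 => [|l la]; rewrite mxE ?(negPf la) ?mulr0 //.
by rewrite eqxx /= addr0 mulr_natr.
Qed.

Lemma mul_delta_mxE (R : pzSemiRingType) m n q (A : 'M[R]_(n, q)) (a : 'I_m) c i j :
  (delta_mx a c *m A) i j = A c j *+ (i == a).
Proof.
rewrite mxE (bigD1 c) //= big1 => [|l la]; rewrite mxE ?(negPf la) ?andbF ?mul0r //.
by rewrite eqxx andbT addr0 mulr_natl.
Qed.

End DeltaMatrix.

Fixpoint iter_comm (G : groupType) (u v : G) m :=
  if m is m'.+1 then commutator u (iter_comm u v m') else v.

Section Witness.
Variables (b : series_kind) (p n : nat) (Gamma : groupType) (x : 'I_n -> Gamma).
Hypothesis p_prime : prime p.
Hypothesis basis_x : is_basis x.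
Variables i0 i1 : 'I_n.
Hypothesis i01 : i0 != i1.

Lemma iter_comm_series m : normal_set (series b p Gamma m.+1) (iter_comm (x i0) (x i1) m).
Proof. by elim: m => [|m IH]; [exact: series1 | exact: series_comm]. Qed.

Import GRing.Theory.
Local Open Scope ring_scope.

(** Send [x i0] to 1 plus a shift and [x i1] to 1 plus an entry in the last column. Each commutator
    with the first matrix moves this entry up one row; after [m] of them it sits in the corner,
    while [unitri m.+2] allows no entry there. *)
Lemma iter_comm_notin m :
  ~ normal_set (series b p Gamma m.+2) (iter_comm (x i0) (x i1) m).
Proof.
pose M := 'M['F_p]_m.+2.
pose Nm : M := \matrix_(i, j) ((j == i.+1 :> nat) && (j <= m)%N)%:R.
pose E (s : nat) : M := delta_mx (inord s) ord_max.
have uN : upper 1 Nm.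
  by move=> i j; rewrite mxE addn1 ltnS => ji; rewrite ltn_eqF.
have uE s : (s <= m)%N -> upper 1 (E s).
  move=> sm i j; rewrite mxE addn1 ltnS => ji; case: eqP => [ei|] //=.
  case: eqP => // ej; move: ji; rewrite ei ej /= inordK; last exact: ltnW.
  by rewrite ltnNge sm.
have U1 A : upper 1 A -> (1 + A : M) \is a GRing.unit.
  by move=> uA; apply: upper_unit; rewrite addrC addKr.
pose g := FinRing.Unit (U1 _ uN).
pose e s (sm : (s <= m)%N) := FinRing.Unit (U1 _ (uE s sm)).
have [f [fM fx]] := free_hom basis_x (fun j => if j == i0 then g
  else if j == i1 then e m (leqnn m) else 1%g).
have fu r (rm : (m - r <= m)%N) : (r <= m)%N ->
    f (iter_comm (x i0) (x i1) r) = e (m - r)%N rm.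
  elim: r rm => [|r IH] rm rle /=.
    by rewrite fx eq_sym (negPf i01) eqxx; apply: val_inj; rewrite /= subn0.
  have rm' : (m - r <= m)%N by apply: leq_subr.
  rewrite morphR // (IH rm' (ltnW rle)) fx eqxx.
  set s := (m - r.+1)%N in rm *; have es : (m - r)%N = s.+1 by rewrite /s subnSK.
  move: rm'; rewrite es => sm.
  suff e1 : (g * e s.+1 sm = e s rm * e s.+1 sm * g)%g by rewrite /commutator e1 !mulgK.
  apply: val_inj; rewrite /=.
  have s1E : nat_of_ord (inord s.+1 : 'I_m.+2) = s.+1.
    by rewrite inordK // ltnS; apply: leqW.
  have sE : nat_of_ord (inord s : 'I_m.+2) = s by rewrite inordK // ltnW // ltnS leqW.
  have NE : Nm * E s.+1 = E s.
    apply/matrixP=> i j; rewrite mul_mx_delta !mxE s1E sm andbT eqSS.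
    by rewrite -[in RHS](inj_eq val_inj) /= sE eq_sym -mulrnA mulnb.
  have EE : E s * E s.+1 = 0.
    apply/matrixP=> i j; rewrite mul_mx_delta !mxE -[inord _ == _](inj_eq val_inj) /=.
    by rewrite s1E eqSS ltn_eqF // andbF mul0rn.
  have EN s' : E s' * Nm = 0.
    by apply/matrixP=> i j; rewrite mul_delta_mxE !mxE /= ltn_eqF // mul0rn.
  rewrite !(mulrDl, mulrDr) !mulr1 !mul1r NE EE !EN !addr0 mul0r addr0.
  by rewrite addr0 [Nm + _]addrC !addrA.
move=> Dm; have f1 : forall h, unitri 1 (f h).
  apply: (basis_ind basis_x (H := f @^-1` unitri 1)).
    have sU := unitri_sub p m.+1 1.
    by have := preim_subgroup fM sU.
  have U1' A (uA : upper 1 A) : unitri 1 (FinRing.Unit (U1 A uA)).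
    by rewrite /unitri /mkset /= addrC addKr.
  move=> j; rewrite /preimage /= fx; case: (j == i0); first exact: U1'.
  by case: (j == i1); [exact: U1' | exact: subgroup1 (unitri_sub p m.+1 _)].
have : unitri m.+2 (f (iter_comm (x i0) (x i1) m)).
  apply: (series_filtration p_prime fM _ f1 _ _ _ Dm) => //.
  - exact: (unitri_sub p m.+1).
  - by move=> k h y k0 uy; have := unitri_comm (f1 h) uy; rewrite add1n.
  - by move=> k y; apply: unitri_le.
  move=> k y k0 uy; have := unitriX p_prime uy.
  case: (b) => //; apply: unitri_le.
  apply: leq_trans (_ : k * 2 <= _)%N; last by rewrite leq_mul2l prime_gt1 ?orbT.
  by rewrite muln2 -addnn -addn1 leq_add2l.
rewrite (fu m (leq_subr m m)) // /unitri /mkset /= addrC addKr => /(_ ord0 ord_max).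
have i0E : inord 0 = ord0 :> 'I_m.+2 by apply: val_inj; rewrite /= inordK.
by rewrite mxE subnn i0E !eqxx add0n ltnSn => /(_ isT)/eqP; rewrite oner_eq0.
Qed.
End Witness.

(** * The extensions of automorphism groups *)

Lemma innerM (G : groupType) (g : G) : {morph (fun v => g * v * g^-1) : v w / v * w}.
Proof. by move=> v w; rewrite !free_red. Qed.

Lemma inner_bij (G : groupType) (g : G) : bijective (fun v => g * v * g^-1).
Proof. by exists (fun v => g^-1 * v * g^-1^-1) => v; rewrite !free_red. Qed.

Definition inner (G : groupType) (g : G) : automorphism G :=
  Automorphism (innerM g) (inner_bij g).

Lemma innerMM (G : groupType) (g h : G) : inner (g * h) = inner g * inner h.
Proof. by apply: aut_ext => v; rewrite aut_mulE /= !free_red. Qed.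

Lemma inner1 (G : groupType) (g : G) :
  (forall v, v * g = g * v) -> inner g = 1.
Proof. by move=> gc; apply: aut_ext => v; rewrite /= -gc mulgK. Qed.

Definition innerR (G : groupType) := morphR (@innerMM G).

Section Extension.
Variables (b : series_kind) (p n k : nat) (Gamma : groupType) (x : 'I_n -> Gamma).
Hypothesis p_prime : prime p.
Hypothesis basis_x : is_basis x.
Hypothesis k0 : (0 < k)%N.
Local Notation N := (NN b p Gamma).
Local Notation L := (LL b p Gamma).
Local Notation HomNL := (homs (N 1) (L k.+1)).
Local Notation IA := (IA b p Gamma).
Local Notation pi := (@pi b p Gamma).
Local Notation proj := (NN_proj b p).

Variables (i : fun_group (N 1) (N k.+1) -> automorphism (N k.+1))
  (psi : automorphism (N k.+1) -> automorphism (N k)).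
Hypothesis iE : forall f, HomNL f -> forall g, i f g = f (proj 1 g) * g.
Hypothesis psiE : forall phi g, psi phi (proj k g) = proj k (phi g).

Lemma proj1k (v : N k.+1) : proj 1 (proj k v : N k) = proj 1 v.
Proof. by apply: proj_proj; rewrite k0 leqnSn. Qed.

Lemma psi_uniq phi a : is_lift phi a -> psi phi = a.
Proof. by move=> la; apply: desc_uniq la. Qed.

Lemma psiM phi phi' : psi (phi * phi') = psi phi * psi phi'.
Proof. by apply: psi_uniq => g; rewrite aut_mulE !psiE. Qed.

Lemma psi1 : psi 1 = 1. Proof. exact: psi_uniq. Qed.

Lemma psi_surj a : exists phi, psi phi = a.
Proof.
have [phi la] := lift_exists p_prime basis_x k0 a.
by exists phi; apply: psi_uniq.
Qed.

Lemma HomNL_sub : is_subgroup HomNL.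
Proof.
have [L1 Ld] := LL_sub b p Gamma k.+1.
split=> [|f g [fM fL] [gM gL]]; first by split=> [u v|u] //; rewrite mulg1.
split=> [u v|u]; last exact: Ld.
rewrite /= -![(f * g^-1) _]/(f _ * (g _)^-1) fM gM invgM.
rewrite -!mulgA; congr (_ * _); rewrite mulgA.
apply/esym/(LL_central p_prime); exact: (Ld _ _ (fL v) (gL v)).
Qed.

Lemma iM f g : HomNL f -> HomNL g -> i (f * g) = i f * i g.
Proof.
move=> Hf Hg; apply: aut_ext => u; rewrite aut_mulE !iE //; last first.
  by apply: (subgroupM HomNL_sub).
rewrite -[(f * g) _]/(f _ * g _) -mulgA; congr (f _ * _).
rewrite projM // (_ : proj 1 (g _) = 1) ?mul1g //.
have /LL_proj gL := Hg.2 (proj 1 u).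
by rewrite -proj1k gL -(pi1 b p Gamma k) projE // pi1.
Qed.

Lemma i_kernel e : psi e = 1 <-> exists2 f, HomNL f & i f = e.
Proof.
split=> [e1|[f Hf <-]]; last first.
  apply: psi_uniq => g; have /LL_proj fg := Hf.2 (proj 1 g).
  by rewrite iE // projM // fg mul1g.
have [f Hf fE] : exists2 f, HomNL f & forall g, e g = f (proj 1 g) * g.
  by apply: (kernel_hom p_prime) => g; rewrite -e1 psiE.
by exists f => //; apply: aut_ext => g; rewrite iE.
Qed.

Lemma i_inj : set_inj HomNL i.
Proof.
move=> f g /set_mem Hf /set_mem Hg fg; apply/funext => u.
have [v ->] : exists v : N k.+1, u = proj 1 v by apply: proj_surj.
by apply: (mulIg v); rewrite -!iE // fg.
Qed.

Lemma full_extension : is_extension HomNL setT setT i psi.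
Proof.
split.
- by split; [exact: HomNL_sub | exact: subgroupT | | move=> f g; apply: iM].
- by split; [exact: subgroupT | exact: subgroupT | | move=> *; apply: psiM].
- exact: i_inj.
- by move=> a _; have [phi <-] := psi_surj a; exists phi.
- by apply/seteqP; split=> [_ [f Hf <-]|e [_ /i_kernel[f Hf <-]]];
    [split=> //; apply/i_kernel; exists f | exists f].
Qed.

Lemma IA_sub m : is_subgroup (IA m).
Proof.
split=> [|e e' He He' g] //; rewrite aut_mulE He.
by rewrite -[in RHS](autVK e' g) He'.
Qed.

Lemma IA_psi phi : IA k.+1 phi <-> IA k (psi phi).
Proof.
split=> He g.
  have [h ->] := proj_surj g (leqnSn k).
  by rewrite psiE !proj1k He.
by rewrite -[LHS]proj1k -[RHS]proj1k -psiE He.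
Qed.

Lemma i_IA f : HomNL f -> IA k.+1 (i f).
Proof.
move=> Hf; apply/IA_psi; rewrite (_ : psi _ = 1) //.
by apply/i_kernel; exists f.
Qed.

Lemma IA_extension : is_extension HomNL (IA k.+1) (IA k) i psi.
Proof.
split.
- by split; [exact: HomNL_sub | exact: IA_sub | move=> f; apply: i_IA | move=> f g; apply: iM].
- by split; [exact: IA_sub | exact: IA_sub | move=> phi; apply: (IA_psi _).1 | move=> *; apply: psiM].
- exact: i_inj.
- by move=> a Ha; have [phi pa] := psi_surj a; exists phi => //; apply/IA_psi; rewrite pa.
- by apply/seteqP; split=> [_ [f Hf <-]|e [_ /i_kernel[f Hf <-]]];
    [split; [exact: i_IA | apply/i_kernel; exists f] | exists f].
Qed.

Lemma IA_central : is_central_extension HomNL (IA k.+1) i.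
Proof.
move=> f e Hf He; apply: aut_ext => g; rewrite !aut_mulE !iE // He autM.
congr (_ * _); apply/esym.
exact: (IA_LL p_prime basis_x (ltn0Sn k) (autM e) He (Hf.2 _)).
Qed.

Variables i0 i1 : 'I_n.
Hypothesis i01 : i0 != i1.
Local Notation u m := (iter_comm (x i0) (x i1) m).

Lemma transvection m : exists e : automorphism (N m),
  e (pi m (x i1)) = pi m (x i1 * x i0) /\ forall j, j != i1 -> e (pi m (x j)) = pi m (x j).
Proof.
pose y (z : Gamma) j := if j == i1 then x i1 * z else x j.
have [F [FM Fx]] := free_hom basis_x (y (x i0)).
have [F' [F'M F'x]] := free_hom basis_x (y (x i0)^-1).
have [e [eM eE]] := NN_desc b p m FM; have [e' [e'M e'E]] := NN_desc b p m F'M.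
have FF' : F \o F' =1 id.
  apply: (free_eq basis_x) => [v w|//|j]; first by rewrite /= F'M FM.
  rewrite /= F'x /y; case: eqP => [->|]; rewrite ?FM ?(morphV FM) !Fx /y ?eqxx.
    by rewrite (negPf i01) mulgK.
  by move/eqP/negPf->.
have F'F : F' \o F =1 id.
  apply: (free_eq basis_x) => [v w|//|j]; first by rewrite /= FM F'M.
  rewrite /= Fx /y; case: eqP => [->|]; rewrite ?F'M !F'x /y ?eqxx.
    by rewrite (negPf i01) mulgVK.
  by move/eqP/negPf->.
have eb : bijective e.
  by exists e' => v; have [g ->] := pi_surj v; rewrite ?eE ?e'E ?eE ?e'E; congr (pi _ _);
    [apply: F'F | apply: FF'].
exists (Automorphism eM eb); split=> [|j j1] /=; rewrite eE Fx /y ?eqxx //.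
by rewrite (negPf j1).
Qed.

(** Take [f] with value [l] at [x i0] and 1 at the other generators, and the transvection that
    multiplies [x i1] by [x i0]: applied to [x i1], the two orders of composition differ by [l]. *)
Lemma not_central : ~ is_central_extension HomNL setT i.
Proof.
move=> cent.
pose l := pi k.+1 (u k).
have Ll : L k.+1 l by apply/LL_P; exists (u k) => //; apply: iter_comm_series.
have l_neq1 : l <> 1 by move/pi_eq1; apply: iter_comm_notin.
have [f [fM fx]] := free_hom basis_x (fun j => if j == i0 then l else 1).
have fL g : L k.+1 (f g).
  apply: (basis_ind basis_x (H := f @^-1` L k.+1)) => [|j].
    exact: (preim_subgroup fM (LL_sub _ _ _ _)).
  by rewrite /preimage /= fx; case: eqP => // _; apply: subgroup1; apply: LL_sub.
have [|g|f' [f'M f'E]] := NN1_factor b p_prime fM; first by move=> g h; apply: LL_central.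
  exact: LL_exp.
have Hf : HomNL f'.
  by split=> // v; have [g ->] := pi_surj v; rewrite f'E.
have [e [ex e1]] := transvection k.+1.
have := cent f' e Hf I; move=> /(congr1 (fun a : automorphism _ => a (pi k.+1 (x i1)))).
rewrite !aut_mulE !iE // autM !ex !projE // !f'E fM !fx eqxx (eq_sym i1) (negPf i01).
rewrite mul1g (morph1 (autM e)) mul1g => le.
by apply: l_neq1; apply: (mulIg (pi k.+1 (x i1 * x i0))); rewrite le mul1g.
Qed.

Lemma inner_IA m (g : N m.+1) : IA m.+1 (inner g).
Proof.
move=> v; rewrite /= !projM // (NN1_comm p_prime (proj 1 g)) -mulgA -projM //.
by rewrite mulgV -(pi1 b p Gamma m.+1) projE // pi1 mulg1.
Qed.

Lemma psi_inner g : psi (inner (pi k.+1 g)) = inner (pi k g).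
Proof.
apply: psi_uniq => v; have [h ->] := pi_surj v.
by rewrite projE // /= -!piV -!piM projE.
Qed.

(** The images of [A] and [C] commute, so their values under a section do too. These values differ
    from [A] and [C] by central elements, which would make [A] and [C] commute. *)
Lemma IA_not_split : (1 < k)%N -> ~ is_split_extension (IA k.+1) (IA k) psi.
Proof.
move=> k1 [s [[sIA' sIA sS sM] psis]].
have ek : k = (k.-2).+2 by case: (k) k1 => [|[|]].
(* [u m] has weight [m.+1], so [A, C] is conjugation by an element of weight [k]: central in [N k],
   but not in [N k.+1]. *)
pose A := inner (pi k.+1 (x i0)); pose C := inner (pi k.+1 (u k.-2)).
have HA : IA k.+1 A by apply: inner_IA.
have HC : IA k.+1 C by apply: inner_IA.
have HR : IA k.+1 (commutator A C) by rewrite /A /C -innerR; apply: inner_IA.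
have AC' : psi A * psi C = psi C * psi A.
  apply/commutator1P; rewrite /A /C !psi_inner -innerR -piR; apply: inner1 => v.
  apply: LL_central => //; apply/LL_P; exists (u k.-2.+1) => //.
  by rewrite {1}ek; apply: iter_comm_series.
have HA' := (IA_psi A).1 HA; have HC' := (IA_psi C).1 HC.
have ker_s a : IA k.+1 a -> forall e, IA k.+1 e -> (s (psi a) * a^-1) * e = e * (s (psi a) * a^-1).
  move=> Ha e He; have [|f Hf <-] := (i_kernel (s (psi a) * a^-1)).1.
    rewrite psiM psis; last exact: (IA_psi a).1.
    by rewrite -psiM mulgV psi1.
  exact: IA_central.
have sA : IA k.+1 (s (psi A)) by apply: sS.
have : commutator (s (psi A)) (s (psi C)) = 1.
  by apply/commutator1P; rewrite -!sM // AC'.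
rewrite -[s (psi A)](mulgVK A) -[s (psi C)](mulgVK C) commutator_central.
- rewrite /A /C -innerR -piR => /(congr1 (fun a : automorphism _ => a (pi k.+1 (x i0)))).
  rewrite aut_oneE /= => /(congr1 (fun v => v * pi k.+1 (u k.-2.+1))); rewrite mulgVK => e.
  have : normal_set (series b p Gamma k.+2) (u k.-2.+2).
    by apply/(comm_classP (series b p Gamma k.+2)); apply/esym.
  by rewrite -ek; apply: iter_comm_notin.
- by rewrite mulgVK; apply: (ker_s C).
- exact: (ker_s A).
- exact: (ker_s A).
- exact: (ker_s C).
Qed.

Lemma split_IA : is_split_extension setT setT psi ->
  is_split_extension (IA k.+1) (IA k) psi.
Proof.
move=> [s [[_ _ _ sM] psis]]; exists s; split=> [|a _]; last exact: psis.
split; [exact: IA_sub | exact: IA_sub | | by move=> a c _ _; apply: sM].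
by move=> a Ha; apply/IA_psi; rewrite psis.
Qed.

(** The group [IA 1] is trivial, the projection of [N 1] to itself being the identity. *)
Lemma IA1_split : k = 1%N -> is_split_extension (IA k.+1) (IA k) psi.
Proof.
move=> ek; have IA1 a : IA k a -> a = 1.
  move=> Ha; apply: aut_ext => g; rewrite aut_oneE.
  by move: (Ha g); move: a g {Ha}; rewrite ek => a g; rewrite !proj_id.
exists (fun=> 1); split=> [|a /IA1->]; last exact: psi1.
split=> [||a _|a c _ _]; [exact: IA_sub | exact: IA_sub | by [] | by rewrite mulg1].
Qed.

End Extension.

(** * Splittings for k = 1 *)

Lemma commutatorVV (G : groupType) (u v : G) :
  commutator u v * (v * u) = v * u * commutator u v ->
  commutator u^-1 v^-1 = commutator u v.
Proof.
move=> c; have -> : commutator u^-1 v^-1 = (v * u)^-1 * (commutator u v * (v * u)).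
  by rewrite /commutator !free_red.
by rewrite c mulKg.
Qed.

Section SplitCriterion.
Variables (b : series_kind) (p n k : nat) (Gamma : groupType) (x : 'I_n -> Gamma).
Local Notation N := (NN b p Gamma).
Variable psi : automorphism (N k.+1) -> automorphism (N k).
Hypothesis psiM : forall phi phi', psi (phi * phi') = psi phi * psi phi'.

Lemma split_of_complement (H : set (automorphism (N k.+1))) :
  (forall e e', H e -> H e' -> H (e * e')) ->
  (forall a, exists2 e, H e & psi e = a) ->
  (forall e e', H e -> H e' -> psi e = psi e' -> e = e') ->
  is_split_extension setT setT psi.
Proof.
move=> HM Hs Hi.
have ex a : exists e, H e /\ psi e = a by have [e He ea] := Hs a; exists e.
have [s sP] := choice ex.
exists s; split=> [|a _]; last by case: (sP a).
split=> // a c _ _; have [[Ha pa] [Hc pc]] := (sP a, sP c).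
have [Hac pac] := sP (a * c); apply: Hi => //; first exact: HM.
by rewrite psiM pa pc.
Qed.

End SplitCriterion.

(** * The Zassenhaus series for p odd: the centralizer of an involution *)

Section OddZassenhaus.
Variables (p n : nat) (Gamma : groupType) (x : 'I_n -> Gamma).
Hypothesis p_prime : prime p.
Hypothesis p_odd : odd p.
Hypothesis basis_x : is_basis x.
Local Notation N := (NN Zassenhaus p Gamma).
Local Notation L := (LL Zassenhaus p Gamma).
Local Notation pi := (@pi Zassenhaus p Gamma).
Local Notation proj := (NN_proj Zassenhaus p).
Variable psi : automorphism (N 2) -> automorphism (N 1).
Hypothesis psiE : forall phi g, psi phi (proj 1 g) = proj 1 (phi g).

Let psiM := psiM psiE.

Lemma inversion1 : exists a : automorphism (N 1), forall u, a u = u^-1.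
Proof.
have aM : {morph (fun u : N 1 => u^-1) : u v / u * v}.
  by move=> u v; rewrite invgM (NN1_comm p_prime).
have ab : bijective (fun u : N 1 => u^-1) by exists (fun u : N 1 => u^-1) => u; rewrite invgK.
by exists (Automorphism aM ab).
Qed.

(** For p odd, [L 2] is generated by commutators, and in class two inverting both arguments does not
    change a commutator. *)
Lemma inversion2 : exists t : automorphism (N 2),
  [/\ forall g, proj 1 (t g) = (proj 1 g)^-1 & forall l, L 2 l -> t l = l].
Proof.
have [a aE] := inversion1.
have [F [FM Fx]] := free_hom basis_x (fun j => (x j)^-1).
have [e [eM eE]] := NN_desc Zassenhaus p 2 FM.
have F1 : forall g, pi 1 (F g) = (pi 1 g)^-1.
  apply: (free_eq basis_x (f := pi 1 \o F) (g := fun g => (pi 1 g)^-1)).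
  - by move=> u v; rewrite /= FM piM.
  - by move=> u v; rewrite piM invgM (NN1_comm p_prime).
  - by move=> j; rewrite /= Fx piV.
have ea g : proj 1 (e g) = a (proj 1 g).
  by have [h ->] := pi_surj g; rewrite eE !projE // aE F1.
have [t la te] := lift_endo p_prime basis_x (isT : (0 < 1)%N) eM ea; exists t.
split=> [g|l /LL_P[h Dh ->]]; first by rewrite -la aE.
rewrite te eE; have central g : zassenhaus p 2 g -> forall v : N 2, v * pi 2 g = pi 2 g * v.
  by move=> Zg v; apply: (LL_central p_prime); apply/LL_P; exists g.
have FM2 : {morph pi 2 \o F : u v / u * v} by move=> u v; rewrite /= FM piM.
have sE := equalizer_subgroup FM2 (@piM Zassenhaus p Gamma 2).
move: h Dh; apply: (Z_ind sE) => i j y i1 kij Ly /=.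
case: j kij => [|j] kij; last first.
  (* Here p >= 3 enters: p-th powers have weight p and already vanish in [N 2]. *)
  have Z3 z : zassenhaus p 3 (z ^+ (p ^ j.+1)).
    apply: (@Z_in _ _ 3 1) => //; rewrite mul1n expnS; apply: leq_trans (_ : p * 1 <= _)%N.
      by rewrite muln1; case: (p) p_prime p_odd => [|[|[|]]].
    by rewrite leq_mul2l expn_gt0 prime_gt0 // orbT.
  by rewrite morphX //; rewrite (pi_eq1 _ _ _ _).2 1?(pi_eq1 _ _ _ _).2 //=.
rewrite expn0 expg1; have {kij Ly i1} : lower_central 2 y.
  by apply: LC_le Ly; rewrite expn0 muln1 in kij.
move: y; apply: (generated_min sE) => _ [u [v [_ _ ->]]] /=.
have FE w : exists2 z, zassenhaus p 2 z & F w = z * w^-1.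
  exists (F w * w); last by rewrite mulgK.
  have /(pi_eq1 Zassenhaus p 1) : pi 1 (F w * w) = 1 by rewrite piM F1 mulVg.
  by [].
have [[z Zz Fu] [z' Zz' Fv]] := (FE u, FE v).
have cR : zassenhaus p 2 (commutator u v).
  by apply: (Z_comm p_prime); exact: (@LC_Z Gamma p 1 1).
rewrite (morphR FM) Fu Fv !piR !piM commutator_central.
- by rewrite !piV commutatorVV // -piM -piR -central.
- by apply/esym/central.
- by apply/esym/central.
- by apply/esym/central.
- by apply/esym/central.
Qed.

Lemma odd_Zassenhaus_split : is_split_extension setT setT psi.
Proof.
have [t [t1 tL]] := inversion2.
pose C := [set e : automorphism (N 2) | e * t = t * e].
have ker_hom e : psi e = 1 -> exists2 f, homs (N 1) (L 2) f & forall g, e g = f (proj 1 g) * g.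
  by move=> e1; apply: (kernel_hom p_prime) => g; rewrite -psiE e1.
have ker_p e : psi e = 1 -> e ^+ p = 1.
  move=> /ker_hom[f [fM fL] fE]; apply: aut_ext => g; rewrite aut_oneE.
  have eL l : L 2 l -> e l = l.
    by move=> Ll; have p1 := (LL_proj l).1 Ll; rewrite fE p1 (morph1 fM) mul1g.
  have -> m : (e ^+ m) g = f (proj 1 g) ^+ m * g.
    elim: m => [|m IH]; first by rewrite !expg0 mul1g.
    rewrite expgS aut_mulE IH autM eL; last exact: subgroupX (LL_sub _ _ _ _) (fL _).
    by rewrite fE mulgA -expgSr.
  by rewrite (LL_exp p_prime) ?mul1g.
have ker_t e : psi e = 1 -> t * e * t^-1 = e^-1.
  move=> /ker_hom[f [fM fL] fE].
  apply: (mulIg e); rewrite mulVg; apply: aut_ext => g.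
  have tV1 v : proj 1 (aut_fun t^-1 v) = (proj 1 v)^-1.
    by rewrite -[in RHS](autVK t v) t1 invgK.
  have f1 v : proj 1 (f v : N 2) = 1 by apply/LL_proj; apply: fL.
  rewrite !aut_mulE (fE (aut_fun t^-1 _)) tV1 autM autVK tL // fE projM // f1 mul1g.
  by rewrite (morphV fM) mulKg.
have psi_t a : a * psi t = psi t * a.
  apply: aut_ext => u; rewrite !aut_mulE.
  have tV v : psi t v = v^-1 by have [g ->] := proj_surj v (leqnSn 1); rewrite psiE t1.
  by rewrite !tV (morphV (autM a)).
apply: (split_of_complement psiM (H := C)).
- by move=> e e'; rewrite /C /= => eC e'C; rewrite -mulgA e'C mulgA eC mulgA.
- move=> a; have [A pA] : exists A, psi A = a.
    have [A la] := lift_exists p_prime basis_x (isT : (0 < 1)%N) a.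
    by exists A; apply: (psi_uniq psiE).
  have [K At pK] : exists2 K, A * t = K * t * A & psi K = 1.
    exists (A * t * A^-1 * t^-1); first by rewrite !free_red.
    have pV e : psi e^-1 = (psi e)^-1 by apply: morphV.
    by rewrite !psiM !pV psi_t mulgK mulgV.
  (* A square root of the inverse of [K], since [K ^+ p = 1] with p odd. As [t] inverts [h],
     multiplying [A] by [h] makes it commute with [t]. *)
  pose h := K ^+ p./2.
  have ph : psi h = 1 by rewrite /h (morphX psiM) pK expg1n.
  exists (h * A); last by rewrite psiM ph mul1g.
  rewrite /C /mkset.
  rewrite -mulgA At !mulgA; congr (_ * A).
  have th : t * h = h^-1 * t by rewrite -(ker_t h ph) mulgVK.
  rewrite th; congr (_ * t); apply: (mulgI h); rewrite mulgV /h.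
  rewrite mulgA -expgnDr addnn -expgSr -(ker_p _ pK); congr (_ ^+ _).
  by rewrite -{2}(odd_double_half p) p_odd.
(* [d] is both fixed and inverted by [t], so its order divides 2 and the odd number p. *)
- move=> e e' Ce Ce' ee'; pose d := e * e'^-1.
  have pd : psi d = 1.
    by rewrite /d psiM (morphV psiM) ee' mulgV.
  have dt : t * d * t^-1 = d.
    rewrite /d mulgA -Ce -[e * t * _ in LHS]mulgA.
    have -> : t * e'^-1 = e'^-1 * t by apply: (mulIg e'); apply: (mulgI e'); rewrite !free_red Ce'.
    by rewrite mulgA mulgK.
  have d2 : d ^+ 2 = 1 by rewrite expg2 -{1}dt (ker_t _ pd) mulVg.
  have dq q : odd q -> d ^+ q = d.
    by move=> oq; rewrite -(odd_double_half q) oq -muln2 mulnC expgnDr expgnA d2 expg1n mulg1.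
  by apply/divg1_eq; rewrite -[LHS]/d -(dq p) // ker_p.
Qed.

End OddZassenhaus.

(* ((a, b, c), (d, e, f)) stands for
     X^a Y^b Z^c [Y, X]^d [Z, X]^e [Z, Y]^f
   in a group of class two where p-th powers of commutators and p^2-th powers
   are trivial. *)
Definition vec := (nat * nat * nat)%type.
Definition word := (vec * vec)%type.
Definition endo := (word * word * word)%type.

Section WordArithmetic.
Variable p : nat.

Definition word_mul (w v : word) : word :=
  let: ((a, b, c), (d, e, f)) := w in
  let: ((a', b', c'), (d', e', f')) := v in
  ((((a + a') %% (p * p))%N, ((b + b') %% (p * p))%N, ((c + c') %% (p * p))%N),
   (((d + d' + b * a') %% p)%N, ((e + e' + c * a') %% p)%N, ((f + f' + c * b') %% p)%N)).

Definition word_exp (w : word) m : word := iter m (word_mul w) ((0, 0, 0), (0, 0, 0))%N.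

Definition word_comm (v u : word) : word :=
  let: (_, (d, e, f)) := word_mul v u in
  let: (_, (d', e', f')) := word_mul u v in
  ((0, 0, 0)%N, (((d + (p - d')) %% p)%N, ((e + (p - e')) %% p)%N, ((f + (p - f')) %% p)%N)).

Definition word_subst (s : endo) (w : word) : word :=
  let: (u, v, t) := s in let: ((a, b, c), (d, e, f)) := w in
  word_mul (word_mul (word_mul (word_exp u a) (word_exp v b)) (word_exp t c))
    (word_mul (word_mul (word_exp (word_comm v u) d) (word_exp (word_comm t u) e))
       (word_exp (word_comm t v) f)).

Definition endo_mul (s s' : endo) : endo :=
  let: (u, v, t) := s' in (word_subst s u, word_subst s v, word_subst s t).

Definition endo_one : endo :=
  (((1, 0, 0), (0, 0, 0)), ((0, 1, 0), (0, 0, 0)), ((0, 0, 1), (0, 0, 0)))%N.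

(** All products g_1^(i_1) ... g_r^(i_r) with each i_j below the bound paired with g_j. In the lists
    below the bounds multiply to the order of GL_n(F_p): 6, 48 and 168. *)
Definition endo_products (gens : seq (endo * nat)) : seq endo :=
  foldr (fun g acc => flatten [seq [seq iter i (endo_mul g.1) w | w <- acc] | i <- iota 0 g.2])
    [:: endo_one] gens.

Definition vec_mod (v : vec) : vec := let: (a, b, c) := v in (a %% p, b %% p, c %% p)%N.

Definition endo_mod (s : endo) : vec * vec * vec :=
  let: (u, v, t) := s in (vec_mod u.1, vec_mod v.1, vec_mod t.1).

Definition matrix_vec (m : vec * vec * vec) (v : vec) : vec :=
  let: ((a, b, c), (a', b', c'), (a'', b'', c'')) := m in let: (i, j, k) := v in
  ((a * i + a' * j + a'' * k)%N, (b * i + b' * j + b'' * k)%N, (c * i + c' * j + c'' * k)%N).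

(* Certificate that the products of the generators form a group that maps
   isomorphically onto the invertible matrices with columns in V, V and W. *)
Definition check_complement (gens : seq (endo * nat)) (V W : seq vec) : bool :=
  let L := endo_products gens in
  let ML := map endo_mod L in
  [&& endo_one \in L,
      all (fun g => (g.1 \in L) && all (fun w => endo_mul g.1 w \in L) L) gens,
      uniq ML,
      all (fun m => [&& m.1.1 \in V, m.1.2 \in V & m.2 \in W]) ML
    & all (fun u => all (fun v => all (fun t => ((u, v, t) \in ML) ||
        has (fun i => (i != (0, 0, 0)%N) && (vec_mod (matrix_vec (u, v, t) i) == (0, 0, 0)%N)) V)
        W) V) V].

End WordArithmetic.

(** In rank two the third coordinate is a placeholder with 0 as its only value. *)
Definition vecs (p n : nat) : seq vec :=
  [seq (v, c) | v <- [seq (a, b) | a <- iota 0 p, b <- iota 0 p], c <- iota 0 (if n == 3 then p else 1)%N] .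

(** Exponents are modulo 4, so 3 stands for -1: these are x -> y, y -> y^-1 x^-1 of order 3 and x ->
    y^-1, y -> x^-1 of order 2. *)
Definition gens22 : seq (endo * nat) :=
  [:: (((0, 1, 0), (0, 0, 0), ((3, 3, 0), (1, 0, 0)), ((0, 0, 1), (0, 0, 0))), 3);
      (((0, 3, 0), (0, 0, 0), ((3, 0, 0), (0, 0, 0)), ((0, 0, 1), (0, 0, 0))), 2)]%N.

(* Lifts along the factorisation GL_2(F_3) = SD_16 . C_3. *)
Definition gens32 : seq (endo * nat) :=
  [:: (((0, 1, 0), (0, 0, 0), ((1, 4, 0), (0, 0, 0)), ((0, 0, 1), (0, 0, 0))), 8);
      (((1, 0, 0), (1, 0, 0), ((4, 8, 0), (0, 0, 0)), ((0, 0, 1), (0, 0, 0))), 2);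
      (((1, 6, 0), (0, 0, 0), ((7, 7, 0), (1, 0, 0)), ((0, 0, 1), (0, 0, 0))), 3)]%N.

(* Lifts along the factorisation GL_3(F_2) = (7 : 3) . D_8. *)
Definition gens23 : seq (endo * nat) :=
  [:: (((0, 1, 0), (0, 1, 0), ((2, 2, 3), (1, 0, 1)), ((3, 3, 0), (1, 1, 0))), 7);
      (((0, 0, 3), (0, 0, 0), ((2, 3, 3), (0, 0, 1)), ((3, 2, 1), (1, 0, 1))), 3);
      (((0, 0, 1), (0, 0, 1), ((2, 1, 1), (0, 1, 0)), ((3, 0, 0), (0, 1, 1))), 4);
      (((0, 0, 1), (0, 0, 0), ((2, 3, 2), (0, 1, 0)), ((1, 0, 0), (0, 0, 0))), 2)]%N.

Definition third_fixed (s : endo) := s.2 == ((0, 0, 1), (0, 0, 0))%N.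

Lemma check22 : check_complement 2 gens22 (vecs 2 2) [:: (0, 0, 1)%N]
  && all third_fixed (endo_products 2 gens22).
Proof. by vm_compute. Qed.

Lemma check32 : check_complement 3 gens32 (vecs 3 2) [:: (0, 0, 1)%N]
  && all third_fixed (endo_products 3 gens32).
Proof. by vm_compute. Qed.

Lemma check23 : check_complement 2 gens23 (vecs 2 3) (vecs 2 3).
Proof. by vm_compute. Qed.

Lemma uniq_map_inj (T U : eqType) (f : T -> U) (s : seq T) :
  uniq (map f s) -> {in s &, injective f}.
Proof.
elim: s => //= z s IH /andP[nz us] u v; rewrite !inE.
move=> /orP[/eqP->|us'] /orP[/eqP->|vs] // fuv; last exact: IH.
  by rewrite fuv map_f in nz.
by rewrite -fuv map_f in nz.
Qed.

Section WordEvaluation.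
Variables (G : groupType) (p : nat).
Hypothesis p_gt0 : (0 < p)%N.
Hypothesis class2 : forall g h k : G, k * commutator g h = commutator g h * k.
Hypothesis comm_exp : forall g h : G, commutator g h ^+ p = 1.
Hypothesis exp_pp : forall g : G, g ^+ (p * p) = 1.
Implicit Types X Y Z : G.

Lemma exp_mod (g : G) q m : g ^+ q = 1 -> g ^+ (m %% q) = g ^+ m.
Proof. by move=> gq; rewrite {2}(divn_eq m q) expgnDr mulnC expgnA gq expg1n mul1g. Qed.

Lemma swap_exp Z X c a : Z ^+ c * X ^+ a = commutator Z X ^+ (c * a) * (X ^+ a * Z ^+ c).
Proof.
have swap1 : Z * X ^+ a = commutator Z X ^+ a * (X ^+ a * Z).
  by rewrite -commutatorX // mulgA {1}/commutator !free_red.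
elim: c => [|c IH]; first by rewrite mul0n !expg0 !mul1g mulg1.
rewrite expgS -mulgA IH mulgA commuteX; last exact: class2.
rewrite -mulgA [Z * _]mulgA swap1 mulSn expgnDr -!mulgA.
by rewrite !mulgA; congr (_ * _ * _ * _); rewrite -!expgnDr addnC.
Qed.

Lemma pull_central (u v w k : G) : (forall g, g * k = k * g) -> u * (k * v) * w = k * (u * v * w).
Proof. by move=> ck; rewrite !mulgA (ck u). Qed.

Lemma centralX (g h k : G) m : k * commutator g h ^+ m = commutator g h ^+ m * k.
Proof. exact: commuteX. Qed.

Variables X Y Z : G.
Definition ev_vec (v : vec) : G := X ^+ v.1.1 * Y ^+ v.1.2 * Z ^+ v.2.
Definition ev_comm (v : vec) : G :=
  commutator Y X ^+ v.1.1 * commutator Z X ^+ v.1.2 * commutator Z Y ^+ v.2.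
Definition ev (w : word) : G := ev_vec w.1 * ev_comm w.2.

Lemma ev_comm_central v k : k * ev_comm v = ev_comm v * k.
Proof. by rewrite /ev_comm; apply: commuteM; [apply: commuteM|]; apply: centralX. Qed.

Lemma ev_commD d e f d' e' f' :
  ev_comm (d, e, f) * ev_comm (d', e', f') = ev_comm (d + d', e + e', f + f')%N.
Proof.
rewrite /ev_comm /=; set A := commutator Y X; set B := commutator Z X; set C := commutator Z Y.
have -> : A ^+ d * B ^+ e * C ^+ f * (A ^+ d' * B ^+ e' * C ^+ f') =
    A ^+ d * B ^+ e * (C ^+ f * (A ^+ d' * B ^+ e')) * C ^+ f' by rewrite !mulgA.
rewrite -(centralX Z Y (A ^+ d' * B ^+ e') f) -/C.
have -> : A ^+ d * B ^+ e * (A ^+ d' * B ^+ e' * C ^+ f) * C ^+ f' =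
    A ^+ d * (B ^+ e * A ^+ d') * (B ^+ e' * C ^+ f * C ^+ f') by rewrite !mulgA.
by rewrite (centralX Y X (B ^+ e) d') -/A !expgnDr !mulgA.
Qed.

Lemma ev_vecM a b c a' b' c' : ev_vec (a, b, c) * ev_vec (a', b', c') =
  ev_comm (b * a', c * a', c * b')%N * ev_vec (a + a', b + b', c + c')%N.
Proof.
rewrite /ev_vec /=.
have -> : X ^+ a * Y ^+ b * Z ^+ c * (X ^+ a' * Y ^+ b' * Z ^+ c') =
    X ^+ a * Y ^+ b * (Z ^+ c * X ^+ a') * (Y ^+ b' * Z ^+ c') by rewrite !mulgA.
rewrite (swap_exp Z X) pull_central; last by move=> g; apply: centralX.
have -> : X ^+ a * Y ^+ b * (X ^+ a' * Z ^+ c) * (Y ^+ b' * Z ^+ c') =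
    X ^+ a * (Y ^+ b * X ^+ a') * (Z ^+ c * Y ^+ b' * Z ^+ c') by rewrite !mulgA.
rewrite (swap_exp Y X) pull_central; last by move=> g; apply: centralX.
have -> : X ^+ a * (X ^+ a' * Y ^+ b) * (Z ^+ c * Y ^+ b' * Z ^+ c') =
    X ^+ a * X ^+ a' * Y ^+ b * (Z ^+ c * Y ^+ b') * Z ^+ c' by rewrite !mulgA.
rewrite (swap_exp Z Y) pull_central; last by move=> g; apply: centralX.
by rewrite /ev_comm /= !expgnDr !mulgA (centralX Y X (commutator Z X ^+ (c * a'))).
Qed.

Lemma ev_mul w v : ev (word_mul p w v) = ev w * ev v.
Proof.
case: w => -[[a b] c] [[d e] f]; case: v => -[[a' b'] c'] [[d' e'] f'].
rewrite /ev /word_mul [fst _]/= [snd _]/=.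
have -> : ev_vec ((a + a') %% (p * p), (b + b') %% (p * p), (c + c') %% (p * p))%N =
    ev_vec (a + a', b + b', c + c')%N by rewrite /ev_vec /= !exp_mod.
have -> r s t : ev_comm (r %% p, s %% p, t %% p)%N = ev_comm (r, s, t)
  by rewrite /ev_comm /= !exp_mod.
rewrite -ev_commD; have := ev_vecM a b c a' b' c'; have := ev_commD d e f d' e' f'.
have := ev_comm_central (d, e, f) (ev_vec (a', b', c')).
have := ev_comm_central (b * a', c * a', c * b')%N.
move: (ev_vec _) (ev_vec _) (ev_vec _) (ev_comm _) (ev_comm _) (ev_comm _) (ev_comm _).
move=> S U W D F E Q cQ cE <- UW.
by rewrite mulgA cQ [RHS]mulgA -[U * E * W]mulgA -cE [U * _]mulgA UW !mulgA.
Qed.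

Lemma ev_one : ev ((0, 0, 0), (0, 0, 0))%N = 1.
Proof. by rewrite /ev /ev_vec /ev_comm /= !expg0 !mulg1. Qed.

Lemma ev_exp w m : ev (word_exp p w m) = ev w ^+ m.
Proof.
elim: m => [|m IH]; first exact: ev_one.
by rewrite /word_exp iterS ev_mul expgS -IH.
Qed.

(** The summand [0 * k] is the collection term that [word_mul] produces when the left factor is a
    product of commutators. *)
Lemma mod_sub_add d d' k : (d' < p)%N -> ((d %% p + (p - d')) %% p + d' + 0 * k)%% p = d %% p.
Proof.
move=> d'p; rewrite mul0n addn0 modnDml -addnA subnK; last exact: ltnW.
by rewrite addnC modnDl modn_mod.
Qed.

(** Already on words, [word_comm p v u] is the factor that turns the product u v into v u. *)
Lemma ev_word_comm v u : ev (word_comm p v u) = commutator (ev v) (ev u).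
Proof.
have e : word_mul p (word_comm p v u) (word_mul p u v) = word_mul p v u.
  case: v => -[[a b] c] [[d e] f]; case: u => -[[a' b'] c'] [[d' e'] f'].
  rewrite /word_comm /word_mul.
  by rewrite !mod_sub_add ?ltn_mod // !add0n !modn_mod ![(_ + a)%N]addnC ![(_ + b)%N]addnC ![(_ + c)%N]addnC.
apply: (mulIg (ev u * ev v)); rewrite -ev_mul -ev_mul e ev_mul.
by rewrite ev_mul /commutator !free_red.
Qed.

Lemma ev_subst (phi : G -> G) s w : {morph phi : u v / u * v} ->
  phi X = ev s.1.1 -> phi Y = ev s.1.2 -> phi Z = ev s.2 ->
  phi (ev w) = ev (word_subst p s w).
Proof.
case: s => -[u v] t; case: w => -[[a b] c] [[d e] f] phiM /= pX pY pZ.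
rewrite !ev_mul !ev_exp !ev_word_comm -pX -pY -pZ.
by rewrite /ev /ev_vec /ev_comm /= !phiM !(morphX phiM) !(morphR phiM).
Qed.

End WordEvaluation.

(** * Complements from certified lists of automorphisms *)

Section SmallSplit.
Variables (b : series_kind) (p n : nat) (Gamma : groupType) (x : 'I_n -> Gamma).
Hypothesis p_prime : prime p.
Hypothesis basis_x : is_basis x.
Local Notation N := (NN b p Gamma).
Local Notation L := (LL b p Gamma).
Local Notation pi := (@pi b p Gamma).
Local Notation proj := (NN_proj b p).
Variable psi : automorphism (N 2) -> automorphism (N 1).
Hypothesis psiE : forall phi g, psi phi (proj 1 g) = proj 1 (phi g).

Lemma N2_comm_LL (g h : N 2) : L 2 (commutator g h).
Proof.
apply/LL_proj; rewrite (morphR (@projM b p Gamma 2 1 isT)).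
by apply/commutator1P; apply: NN1_comm.
Qed.

Lemma N2_class2 (g h k : N 2) : k * commutator g h = commutator g h * k.
Proof. by apply: (LL_central p_prime); apply: N2_comm_LL. Qed.

Lemma N2_comm_exp (g h : N 2) : commutator g h ^+ p = 1.
Proof. by apply: (LL_exp p_prime) => //; apply: N2_comm_LL. Qed.

Lemma N2_exp (g : N 2) : g ^+ (p * p) = 1.
Proof.
have [h ->] := pi_surj g; rewrite -piX expgnA; apply/pi_eq1.
by do 2!apply: (series_pow p_prime) => //; apply: series1.
Qed.

(* Generators of Gamma, the last of which may be trivial. *)
Variables Y0 Y1 Y2 : Gamma.
Hypothesis gen_eq : forall (m : nat) (f g : N 2 -> N m),
  {morph f : u v / u * v} -> {morph g : u v / u * v} ->
  f (pi 2 Y0) = g (pi 2 Y0) -> f (pi 2 Y1) = g (pi 2 Y1) ->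
  f (pi 2 Y2) = g (pi 2 Y2) -> f =1 g.
Variables (gens : seq (endo * nat)) (V W : seq vec).
Hypothesis gensP : check_complement p gens V W.
Local Notation E := (endo_products p gens).
Local Notation ev2 := (ev (pi 2 Y0) (pi 2 Y1) (pi 2 Y2)).
Local Notation ev1 := (ev_vec (pi 1 Y0) (pi 1 Y1) (pi 1 Y2)).

Definition represents (f : N 2 -> N 2) (s : endo) :=
  [/\ f (pi 2 Y0) = ev2 s.1.1, f (pi 2 Y1) = ev2 s.1.2 & f (pi 2 Y2) = ev2 s.2].

Hypothesis E_ex : forall s, s \in E ->
  exists2 f : N 2 -> N 2, {morph f : u v / u * v} & represents f s.
Hypothesis V0 : (0, 0, 0)%N \in V.
Hypothesis V_ex : forall w : N 1, exists2 v, v \in V & w = ev1 v.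
Hypothesis V_inj : forall v v', v \in V -> v' \in V -> ev1 v = ev1 v' -> v = v'.
Hypothesis W_ex : forall a : automorphism (N 1), exists2 v, v \in W & a (pi 1 Y2) = ev1 v.
Hypothesis W_inj : forall v v', v \in W -> v' \in W -> ev1 v = ev1 v' -> v = v'.

Lemma represents_mul f f' s s' : {morph f : u v / u * v} ->
  represents f s -> represents f' s' -> represents (f \o f') (endo_mul p s s').
Proof.
move=> fM [f0 f1 f2]; case: s' => -[u v] t [g0 g1 g2].
have sub w : f (ev2 w) = ev2 (word_subst p s w).
  by apply: ev_subst; [exact: prime_gt0|exact: N2_class2|exact: N2_comm_exp|exact: N2_exp|..].
by split; rewrite /= ?g0 ?g1 ?g2 sub.
Qed.

Lemma represents_uniq f f' s : {morph f : u v / u * v} -> {morph f' : u v / u * v} ->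
  represents f s -> represents f' s -> f =1 f'.
Proof. by move=> fM f'M [f0 f1 f2] [g0 g1 g2]; apply: gen_eq; rewrite ?f0 ?f1 ?f2. Qed.

Lemma products_sub gens' : {subset gens' <= gens} -> {subset endo_products p gens' <= E}.
Proof.
have [one_E clE _ _ _] := and5P gensP.
elim: gens' => [|g gens' IH] sub s; first by rewrite inE => /eqP->.
move=> /flattenP[_ /mapP[i _ ->] /mapP[w w_in ->]].
have {}w_in : w \in E by apply: IH w_in => h hin; apply: sub; rewrite inE hin orbT.
have /andP[_ /allP cl] := allP clE g (sub g (mem_head _ _)).
by elim: i => [//|i IHi]; rewrite iterS; apply: cl.
Qed.

Definition in_complement f := exists2 s, s \in E & represents f s.

(** The certificate covers left multiplication by generators only, so [f] is decomposed one
    generator at a time, each partial product being realised by an endomorphism. *)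
Lemma complement_mul f f' : {morph f : u v / u * v} -> {morph f' : u v / u * v} ->
  in_complement f -> in_complement f' -> in_complement (f \o f').
Proof.
have [one_E clE _ _ _] := and5P gensP.
move=> fM f'M [s sE]; have sub : {subset gens <= gens} by [].
elim: {-2}gens sub s sE f f' fM f'M => [|g gens' IH] sub s sE f f' fM f'M fs [s' s'E f's'].
  move: sE fs; rewrite inE => /eqP-> fs; exists s' => //.
  have f_id : f =1 id.
    by case: fs => r0 r1 r2; apply: gen_eq => //; rewrite (r0, r1, r2);
      rewrite /ev /ev_vec /ev_comm /= !expg0 !mulg1 ?mul1g.
  by case: f's' => g0 g1 g2; split; rewrite /= f_id.
have subt : {subset gens' <= gens} by move=> h hin; apply: sub; rewrite inE hin orbT.
have /andP[gE /allP cl] := allP clE g (sub g (mem_head _ _)).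
have [fg fgM fgr] := E_ex gE.
move: sE => /flattenP[_ /mapP[i _ ->] /mapP[w w_in es]].
elim: i s es f fM fs => [|i IHi] s es f fM fs.
  by apply: (IH subt w) => //; [move: fs; rewrite es | exists s'].
have tE : iter i (endo_mul p g.1) w \in E.
  have {}w_in := products_sub subt w_in.
  by elim: (i) => [//|j IHj]; rewrite iterS; apply: cl.
have [ft ftM ftr] := E_ex tE.
have [s'' s''E r''] := IHi _ erefl ft ftM ftr.
exists (endo_mul p g.1 s''); first exact: cl.
have ff : f =1 fg \o ft.
  apply: (represents_uniq fM _ fs) => [u v|]; first by rewrite /= ftM fgM.
  by rewrite es iterS; apply: represents_mul.
have [h0 h1 h2] := represents_mul fgM fgr r''.
by split; rewrite /= ff.
Qed.

Lemma ev1_mod v : ev1 (vec_mod p v) = ev1 v.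
Proof.
have X (g : N 1) m : g ^+ (m %% p) = g ^+ m by apply: exp_mod; apply: NN1_exp.
by case: v => -[i j] k; rewrite /ev_vec /= !X.
Qed.

Lemma N1_comm1 (g h : N 1) : commutator g h = 1.
Proof. by apply/commutator1P; apply: NN1_comm. Qed.

Lemma proj_ev w : proj 1 (ev2 w) = ev1 (vec_mod p w.1).
Proof.
have pM := @projM b p Gamma 2 1 isT.
rewrite ev1_mod /ev /ev_comm /ev_vec !pM !(morphX pM) !(morphR pM) !projE //.
by rewrite !N1_comm1 !expg1n !mulg1.
Qed.

Lemma ev1D a c d a' c' d' :
  ev1 (a, c, d) * ev1 (a', c', d') = ev1 (a + a', c + c', d + d')%N.
Proof.
rewrite ev_vecM => [|g h k]; last exact: NN1_comm.
by rewrite /ev_comm !N1_comm1 !expg1n !mul1g.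
Qed.

Lemma ev1X a c d m : ev1 (a, c, d) ^+ m = ev1 (a * m, c * m, d * m)%N.
Proof.
elim: m => [|m IH]; first by rewrite !muln0 /ev_vec /= !expg0 !mulg1.
by rewrite expgS IH ev1D !mulnS.
Qed.

Lemma ev1_matrix m v (a : N 1 -> N 1) : {morph a : u v / u * v} ->
  a (pi 1 Y0) = ev1 m.1.1 -> a (pi 1 Y1) = ev1 m.1.2 -> a (pi 1 Y2) = ev1 m.2 ->
  a (ev1 v) = ev1 (matrix_vec m v).
Proof.
move=> aM; rewrite {1}/ev_vec !aM !(morphX aM) => -> -> ->.
case: m => -[[[? ?] ?] [[? ?] ?]] [[? ?] ?]; case: v => -[? ?] ?.
by rewrite /= !ev1X !ev1D.
Qed.

(** An automorphism of [N 1] has columns in [V], [V] and [W]. A nonzero vector in the kernel would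
    contradict its injectivity, so its matrix is among the certified ones. *)
Lemma small_split : is_split_extension setT setT psi.
Proof.
have [_ _ uE /allP VE /allP full] := and5P gensP.
pose H := [set e : automorphism (N 2) | in_complement e].
apply: (split_of_complement (psiM psiE) (H := H)).
- move=> e e' He He'; apply: complement_mul => //; exact: autM.
- move=> a; have [u uV ea] := V_ex (a (pi 1 Y0)); have [v vV eb] := V_ex (a (pi 1 Y1)).
  have [t tW ec] := W_ex a.
  have := allP (allP (full u uV) v vV) t tW => /orP[/mapP[s sE es]|/hasP[i iV /andP[i0 /eqP mi]]].
    have [f fM fs] := E_ex sE.
    have fa g : proj 1 (f g) = a (proj 1 g).
      case: (s) es fs => -[s0 s1] s2 [es0 es1 es2] [r0 r1 r2].
      apply: (gen_eq (f := fun g => proj 1 (f g)) (g := fun g => a (proj 1 g))).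
      - by move=> g' h; rewrite fM projM.
      - by move=> g' h; rewrite projM // autM.
      - by rewrite r0 proj_ev projE // ea es0.
      - by rewrite r1 proj_ev projE // eb es1.
      - by rewrite r2 proj_ev projE // ec es2.
    have [e la ef] := lift_endo p_prime basis_x (isT : (0 < 1)%N) fM fa.
    exists e; last exact: (psi_uniq psiE).
    by exists s; rewrite // ef.
  have e1 : a (ev1 i) = a 1.
    rewrite (ev1_matrix (m := (u, v, t)) _ (autM a)) // -ev1_mod mi (morph1 (autM a)).
    by rewrite /ev_vec /= !expg0 !mulg1.
  have /(V_inj iV V0) i_eq : ev1 i = ev1 (0, 0, 0)%N.
    by apply: (bij_inj (aut_bij a)); rewrite e1 /ev_vec /= !expg0 !mulg1.
  by rewrite i_eq eqxx in i0.
- move=> e e' [s sE es] [s' s'E es'] ee'.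
  suff ss' : s = s'.
    by apply: aut_ext; apply: represents_uniq es _; rewrite ?ss'; [exact: autM|exact: autM|].
  have/and3P[m0 m1 m2] := VE _ (map_f _ sE); have/and3P[m0' m1' m2'] := VE _ (map_f _ s'E).
  have pe g : proj 1 (e g) = proj 1 (e' g) by rewrite -!psiE ee'.
  have : endo_mod p s = endo_mod p s'.
    case: es es' => [r0 r1 r2] [r0' r1' r2'].
    have := pe (pi 2 Y0); rewrite r0 r0' !proj_ev.
    have := pe (pi 2 Y1); rewrite r1 r1' !proj_ev.
    have := pe (pi 2 Y2); rewrite r2 r2' !proj_ev.
    case: (s) (s') m0 m1 m2 m0' m1' m2' => [[s0 s1] s2] [[s0' s1'] s2'] /= m0 m1 m2 m0' m1' m2'.
    by move=> /(W_inj m2 m2')-> /(V_inj m1 m1')-> /(V_inj m0 m0')->.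
  exact: (uniq_map_inj uE).
Qed.

End SmallSplit.

Lemma mem_vecs p n v : (v \in vecs p n) =
  [&& (v.1.1 < p)%N, (v.1.2 < p)%N & (v.2 < if n == 3 then p else 1)%N].
Proof.
case: v => -[i j] k; apply/idP/idP.
  case/allpairsP=> -[u c] [/allpairsP[[a d] [ain din ->]] cin [-> -> ->]] /=.
  by move: ain din cin; rewrite !mem_iota !add0n /= => -> -> ->.
case/and3P=> ip jp kp; apply/allpairsP; exists ((i, j), k); split=> //=; last by rewrite mem_iota.
by apply/allpairsP; exists (i, j); rewrite !mem_iota.
Qed.

Section Coordinates.
Variables (b : series_kind) (p n : nat) (Gamma : groupType) (x : 'I_n -> Gamma).
Hypothesis p_prime : prime p.
Hypothesis basis_x : is_basis x.
Local Notation N := (NN b p Gamma).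
Local Notation pi := (@pi b p Gamma).
Import GRing.Theory.
Local Open Scope ring_scope.

Lemma coordinate1 i : exists chi : N 1 -> 'Z_p,
  {morph chi : u v / (u * v)%g >-> u + v} /\ forall j, chi (pi 1 (x j)) = (j == i)%:R.
Proof.
have [f [fM fx]] := @free_hom _ _ _ basis_x 'Z_p (fun j => (j == i)%:R).
have [|g|chi [chiM chiE]] := NN1_factor b p_prime fM.
- by move=> g h; apply: addrC.
- by rewrite FinRing.zmodXgE -mulr_natl pchar_Zp ?mul0r ?prime_gt1.
- by exists chi; split=> // j; rewrite chiE fx.
Qed.

Lemma chi_ev (chi : N 1 -> 'Z_p) X Y Z v : {morph chi : u v / (u * v)%g >-> u + v} ->
  chi (ev_vec X Y Z v) = chi X *+ v.1.1 + chi Y *+ v.1.2 + chi Z *+ v.2.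
Proof.
move=> chiM; have chiX u m : chi (u ^+ m)%g = chi u *+ m.
  exact: (morphX (f := chi : N 1 -> 'Z_p) chiM).
by rewrite /ev_vec !chiM !chiX.
Qed.

Lemma nat_inj_Zp i j : (i < p)%N -> (j < p)%N -> i%:R = j%:R :> 'Z_p -> i = j.
Proof.
move=> ip jp /(congr1 (@nat_of_ord _)).
by rewrite !val_Zp_nat ?prime_gt1 // !modn_small.
Qed.

Lemma Zp_lt (c : 'Z_p) : (c < p)%N.
Proof. exact: leq_trans (ltn_ord c) (eq_leq (Zp_cast (prime_gt1 p_prime))). Qed.

Lemma Zp_bool (t : bool) : nat_of_ord (t%:R : 'Z_p) = t.
Proof. by rewrite val_Zp_nat ?prime_gt1 // modn_small //; case: t; rewrite ?prime_gt1 ?prime_gt0. Qed.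

Lemma Zp_coord_morph (chi chi' chi'' : N 1 -> 'Z_p) X Y Z :
  {morph chi : u v / (u * v)%g >-> u + v} -> {morph chi' : u v / (u * v)%g >-> u + v} ->
  {morph chi'' : u v / (u * v)%g >-> u + v} ->
  {morph (fun w : N 1 => ev_vec X Y Z (chi w : nat, chi' w : nat, chi'' w : nat) : N 1) : u v / (u * v)%g}.
Proof.
move=> chiM chi'M chi''M u v.
have [[g ->] [g' ->] [g'' ->]] := And3 (pi_surj X) (pi_surj Y) (pi_surj Z).
rewrite (ev1D b p_prime) chiM chi'M chi''M /ev_vec /=.
have X_mod (h : N 1) (c d : 'Z_p) : (h ^+ nat_of_ord (c + d)%R = h ^+ (c + d)%N)%g.
  have -> : nat_of_ord (c + d)%R = ((c + d) %% p)%N.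
    exact: (congr1 (modn (c + d)) (Zp_cast (prime_gt1 p_prime))).
  by apply: exp_mod; apply: NN1_exp.
by rewrite !X_mod.
Qed.

End Coordinates.

Section Instances.
Variables (b : series_kind) (p : nat) (Gamma : groupType).
Hypothesis p_prime : prime p.
Local Notation N := (NN b p Gamma).
Local Notation pi := (@pi b p Gamma).
Local Notation proj := (NN_proj b p).
Variable psi : automorphism (N 2) -> automorphism (N 1).
Hypothesis psiE : forall phi g, psi phi (proj 1 g) = proj 1 (phi g).

Lemma split3 (x : 'I_3 -> Gamma) gens : is_basis x ->
  check_complement p gens (vecs p 3) (vecs p 3) -> is_split_extension setT setT psi.
Proof.
move=> bx chk.
pose o0 := @Ordinal 3 0 isT; pose o1 := @Ordinal 3 1 isT; pose o2 := @Ordinal 3 2 isT.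
have o3 (j : 'I_3) : [\/ j = o0, j = o1 | j = o2].
  by case: j => -[|[|[|]]] // i; [constructor 1|constructor 2|constructor 3]; apply: val_inj.
have p1 := prime_gt1 p_prime; have p0 := prime_gt0 p_prime.
have [c0 [c0M c0x]] := coordinate1 b p_prime bx o0.
have [c1 [c1M c1x]] := coordinate1 b p_prime bx o1.
have [c2 [c2M c2x]] := coordinate1 b p_prime bx o2.
have V_ex (w : N 1) : exists2 v, v \in vecs p 3 & w = ev_vec (pi 1 (x o0)) (pi 1 (x o1)) (pi 1 (x o2)) v.
  exists (c0 w : nat, c1 w : nat, c2 w : nat); first by rewrite mem_vecs /= !Zp_lt.
  apply: (NN_eq bx (f := id) (g := fun w => ev_vec _ _ _ (c0 w : nat, c1 w : nat, c2 w : nat))) => //.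
    by apply: Zp_coord_morph.
  move=> j; rewrite c0x c1x c2x /ev_vec !Zp_bool //.
  by have [->|->|->] := o3 j; rewrite /= !expg0 ?mulg1 ?mul1g.
have V_inj v v' : v \in vecs p 3 -> v' \in vecs p 3 ->
    ev_vec (pi 1 (x o0)) (pi 1 (x o1)) (pi 1 (x o2)) v = ev_vec (pi 1 (x o0)) (pi 1 (x o1)) (pi 1 (x o2)) v' -> v = v'.
  rewrite !mem_vecs; case: v v' => -[i j] k [[i' j'] k'] /= /and3P[ip jp kp] /and3P[ip' jp' kp'] e.
  have := congr1 c0 e; have := congr1 c1 e; have := congr1 c2 e.
  rewrite !chi_ev // !c0x !c1x !c2x /= !GRing.mul0rn ?GRing.addr0 ?GRing.add0r.
  by move=> /(nat_inj_Zp p_prime kp kp')-> /(nat_inj_Zp p_prime jp jp')-> /(nat_inj_Zp p_prime ip ip')->.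
have gen_eq m (f g : N 2 -> N m) : {morph f : u v / u * v} -> {morph g : u v / u * v} ->
    f (pi 2 (x o0)) = g (pi 2 (x o0)) -> f (pi 2 (x o1)) = g (pi 2 (x o1)) ->
    f (pi 2 (x o2)) = g (pi 2 (x o2)) -> f =1 g.
  move=> fM gM e0 e1 e2; apply: (NN_eq bx) => // j.
  by have [->|->|->] := o3 j.
apply: (small_split p_prime bx psiE gen_eq chk) => //.
- move=> s _; have [f [fM fx]] := NN_hom (b := b) (p := p) (m := 2) bx
    (fun j => ev (pi 2 (x o0)) (pi 2 (x o1)) (pi 2 (x o2))
       (if j == o0 then s.1.1 else if j == o1 then s.1.2 else s.2)).
  by exists f => //; split; rewrite fx.
- by rewrite mem_vecs /= p0.
Qed.

(** Rank two reuses the words in three letters with the third letter equal to 1; [third_fixed] and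
    the singleton [W] keep that letter in place. *)
Lemma split2 (x : 'I_2 -> Gamma) gens : is_basis x ->
  check_complement p gens (vecs p 2) [:: (0, 0, 1)%N] && all third_fixed (endo_products p gens) ->
  is_split_extension setT setT psi.
Proof.
move=> bx /andP[chk /allP fixed3].
pose o0 := @Ordinal 2 0 isT; pose o1 := @Ordinal 2 1 isT.
have o2 (j : 'I_2) : j = o0 \/ j = o1.
  by case: j => -[|[|]] // i; [left|right]; apply: val_inj.
have p1 := prime_gt1 p_prime; have p0 := prime_gt0 p_prime.
have [c0 [c0M c0x]] := coordinate1 b p_prime bx o0.
have [c1 [c1M c1x]] := coordinate1 b p_prime bx o1.
have one_ev1 m : ev_vec (pi m (x o0)) (pi m (x o1)) (pi m 1) (0, 0, 1)%N = 1.
  by rewrite /ev_vec /= !expg0 !mul1g expg1 pi1.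
have V_ex (w : N 1) : exists2 v, v \in vecs p 2 & w = ev_vec (pi 1 (x o0)) (pi 1 (x o1)) (pi 1 1) v.
  exists (c0 w : nat, c1 w : nat, (0%R : 'Z_p) : nat); first by rewrite mem_vecs /= !Zp_lt.
  apply: (NN_eq bx (f := id) (g := fun w => ev_vec _ _ _ (c0 w : nat, c1 w : nat, (0%R : 'Z_p) : nat))) => //.
    have c2M : {morph (fun=> 0%R : 'Z_p) : u v / (u * v : N 1) >-> (u + v)%R}.
      by move=> u v; rewrite GRing.addr0.
    exact: (Zp_coord_morph p_prime _ _ _ c0M c1M c2M).
  move=> j; rewrite c0x c1x /ev_vec !Zp_bool //.
  by have [->|->] := o2 j; rewrite /= !expg0 ?mulg1 ?mul1g.
have V_inj v v' : v \in vecs p 2 -> v' \in vecs p 2 ->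
    ev_vec (pi 1 (x o0)) (pi 1 (x o1)) (pi 1 1) v = ev_vec (pi 1 (x o0)) (pi 1 (x o1)) (pi 1 1) v' -> v = v'.
  rewrite !mem_vecs; case: v v' => -[i j] k [[i' j'] k'] /= /and3P[ip jp kp] /and3P[ip' jp' kp'] e.
  have ck (c : N 1 -> 'Z_p) : {morph c : u v / u * v >-> (u + v)%R} -> c (pi 1 1) = 0%R.
    by move=> cM; rewrite pi1; apply: (morph1 (f := c : N 1 -> 'Z_p)).
  have := congr1 c0 e; have := congr1 c1 e.
  rewrite !chi_ev // !c0x !c1x !ck // /= !GRing.mul0rn ?GRing.addr0 ?GRing.add0r.
  move=> /(nat_inj_Zp p_prime jp jp')-> /(nat_inj_Zp p_prime ip ip')->.
  by move: kp kp'; rewrite !ltnS !leqn0 => /eqP-> /eqP->.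
have gen_eq m (f g : N 2 -> N m) : {morph f : u v / u * v} -> {morph g : u v / u * v} ->
    f (pi 2 (x o0)) = g (pi 2 (x o0)) -> f (pi 2 (x o1)) = g (pi 2 (x o1)) ->
    f (pi 2 1) = g (pi 2 1) -> f =1 g.
  move=> fM gM e0 e1 _; apply: (NN_eq bx) => // j.
  by have [->|->] := o2 j.
apply: (small_split p_prime bx psiE gen_eq chk) => //.
- move=> s sE; have [f [fM fx]] := NN_hom (b := b) (p := p) (m := 2) bx
    (fun j => ev (pi 2 (x o0)) (pi 2 (x o1)) (pi 2 1) (if j == o0 then s.1.1 else s.1.2)).
  exists f => //; split; rewrite ?fx //.
  rewrite (eqP (fixed3 s sE)) pi1 (morph1 fM) -(pi1 b p Gamma 2) /ev one_ev1.
  by rewrite /ev_comm /= !expg0 !mulg1.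
- by rewrite mem_vecs /= p0.
- move=> a; exists (0, 0, 1)%N; first by rewrite inE.
  by rewrite one_ev1 pi1 (morph1 (autM a)).
- by move=> v v'; rewrite !inE => /eqP-> /eqP->.
Qed.

End Instances.

(** * Obstructions for k = 1 *)

Section UnipotentRing.
Import GRing.Theory.
Local Open Scope ring_scope.
Variable R : pzRingType.
Implicit Types X Y : R.

Lemma add1_comm X Y : (1 + X) * (1 + Y) = (1 + Y) * (1 + X) -> X * Y = Y * X.
Proof.
rewrite !mulrDl !mulrDr !mul1r !mulr1 -!addrA => /addrI.
by rewrite [X + (Y + _)]addrCA => /addrI/addrI.
Qed.

Lemma add1_sq X : (1 + X) ^+ 2 = 1 -> X + X + X * X = 0.
Proof.
rewrite expr2 mulrDl !mulrDr !mul1r !mulr1 -!addrA => e.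
by apply: (addrI 1); rewrite e addr0.
Qed.

Lemma add1_expr X m : X ^+ 4 = 0 ->
  (1 + X) ^+ m = 1 + (X *+ m + X ^+ 2 *+ 'C(m, 2) + X ^+ 3 *+ 'C(m, 3)).
Proof.
move=> X4; elim: m => [|m IH]; first by rewrite expr0 !bin0n !mulr0n !addr0.
rewrite exprS IH mulrDl mul1r mulrDr mulr1 !mulrDr !mulrnAr -!exprS X4 mul0rn addr0.
rewrite !binS bin1 !mulrnDr mulrS -[LHS]addrA; congr (1 + _).
rewrite [X + _]addrA [LHS]addrACA [X *+ m + _ + _]addrACA; congr (_ + _ + _).
by rewrite addrC.
Qed.

End UnipotentRing.

Section Elementary.
Import GRing.Theory.
Local Open Scope ring_scope.
Variables (R : comNzRingType) (P : R) (n : nat).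
Hypothesis PP : P * P = 0.
Local Notation M := 'M[R]_n.+1.

(* Lifts along R -> R/P of the elementary matrix with an entry 1 at (i, j). *)
Definition elementary_lift i j (A B : M) := A = 1 + (delta_mx i j + P *: B).

Lemma mul_lift (E E' B B' : M) : E * E' = 0 ->
  (E + P *: B) * (E' + P *: B') = P *: (E * B' + B * E').
Proof.
move=> EE; rewrite mulrDl !mulrDr EE add0r -!scalerAl -!scalerAr scalerA PP.
by rewrite scale0r addr0 -scalerDr.
Qed.

Lemma mxDE (A B : M) i j : (A + B) i j = A i j + B i j. Proof. by rewrite mxE. Qed.
Lemma mxZE c (A : M) i j : (c *: A) i j = c * A i j. Proof. by rewrite mxE. Qed.

Lemma delta_sq (i j k l : 'I_n.+1) : j != k -> (delta_mx i j : M) * delta_mx k l = 0.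
Proof. exact: mul_delta_mx_0. Qed.

Lemma elementary_comm i j k l A B A' B' : elementary_lift i j A B ->
  elementary_lift k l A' B' -> j != k -> l != i -> A * A' = A' * A -> forall r s,
  P * (B' j s *+ (r == i) + B r k *+ (s == l)) =
  P * (B l s *+ (r == k) + B' r i *+ (s == j)).
Proof.
move=> -> -> jk li /add1_comm; rewrite !mul_lift ?delta_sq // => /matrixP e r s.
move: (e r s).
by rewrite !(mxZE, mxDE) !mul_delta_mxE !mul_mx_delta.
Qed.

Lemma elementary_sq i j A B : P = 2%:R -> elementary_lift i j A B -> i != j ->
  A ^+ 2 = 1 -> P * (1 + B j j + B i i) = 0.
Proof.
move=> P2 -> ij /add1_sq; rewrite mul_lift ?delta_sq 1?eq_sym //.
move/matrixP/(_ i j).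
rewrite !(mxZE, mxDE) mul_delta_mxE mul_mx_delta [delta_mx _ _ _ _]mxE [RHS]mxE !eqxx /= => e.
rewrite -addrA mulrDr mulr1 -e; congr (_ + _).
by rewrite addrACA -!mulr2n -[_ * _ *+ 2]mulr_natl -P2 mulrA PP mul0r addr0.
Qed.

(** Writing A = 1 + X and E for the elementary part, X^2 and X^3 are multiples of P and X^4 = 0. At
    (i, j) the linear term contributes P, and the cubic term contributes through E B E, whose entry
    is B_ji. *)
Lemma elementary_pow m i j A B : m%:R = P -> P *+ 'C(m, 2) = 0 ->
  elementary_lift i j A B -> i != j -> A ^+ m = 1 -> P * (1 + B j i *+ 'C(m, 3)) = 0.
Proof.
move=> mP C2 -> ij; have ji : j != i by rewrite eq_sym.
set X := _ + P *: B; set E : M := delta_mx i j in X *.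
have EE : E * E = 0 by apply: delta_sq.
have X2 : X ^+ 2 = P *: (E * B + B * E) by rewrite expr2 mul_lift.
have X3 : X ^+ 3 = P *: (E * B * E).
  rewrite exprSr X2 -scalerAl mulrDr -scalerAr scalerDr scalerA PP scale0r addr0.
  by rewrite mulrDl -[B * E * E]mulrA EE mulr0 addr0.
have X4 : X ^+ 4 = 0.
  rewrite exprSr X3 -scalerAl mulrDr -scalerAr scalerDr scalerA PP scale0r addr0.
  by rewrite -[E * B * E * E]mulrA EE mulr0 scaler0.
rewrite (add1_expr m X4) X2 X3 => e.
have {e} : X *+ m + P *: (E * B + B * E) *+ 'C(m, 2) + P *: (E * B * E) *+ 'C(m, 3) = 0.
  by apply: (addrI 1); rewrite e addr0.
rewrite scalerMnl C2 scale0r addr0 => /matrixP/(_ i j).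
rewrite -scaler_nat mP -scaler_nat !(mxZE, mxDE) mul_mx_delta mul_delta_mxE.
rewrite [delta_mx _ _ _ _]mxE [RHS]mxE !eqxx /= => e.
rewrite mulrDr mulr1 -[RHS]e mulrDr mulr1 mulrA PP mul0r addr0.
by rewrite -[in LHS]mulr_natl !mulrA [P * _%:R]mulrC.
Qed.

(** For p >= 5 the coefficient C(p, 3) is divisible by p, and [elementary_pow] reduces to P = 0. *)
Lemma no_elementary5 m i j A B : P <> 0 -> m%:R = P -> P *+ 'C(m, 2) = 0 -> P *+ 'C(m, 3) = 0 ->
  elementary_lift i j A B -> i != j -> A ^+ m = 1 -> False.
Proof.
move=> P0 mP C2 C3 lA ij /(elementary_pow mP C2 lA ij); rewrite mulrDr mulr1 mulrnAr -mulrnAl.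
by rewrite C3 mul0r addr0.
Qed.

(** The cube of [A] gives P (1 + B_ji) = 0, and commutation with a lift at (i, l), read at the entry
    (j, l), gives P B_ji = 0. *)
Lemma no_elementary3 i j l A B A' B' : P <> 0 -> P = 3%:R ->
  elementary_lift i j A B -> elementary_lift i l A' B' -> uniq [:: i; j; l] ->
  A ^+ 3 = 1 -> A * A' = A' * A -> False.
Proof.
move=> P0 P3 lA lA' /and3P[]; rewrite !inE !negb_or => /andP[ij il] jl _ Ap AA'.
have ji : j != i by rewrite eq_sym.
have li : l != i by rewrite eq_sym.
have lj : l != j by rewrite eq_sym.
have C2 : P *+ 'C(3, 2) = 0 by rewrite -mulr_natr /= -P3.
have := elementary_comm lA lA' ji li AA' j l.
have := elementary_pow (esym P3) C2 lA ij Ap.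
rewrite (negPf ji) (negPf lj) eqxx !mulr0n !mulr1n !add0r mulr0.
by move=> + e; rewrite mulrDr e addr0 mulr1.
Qed.

(** Four commutations force P B_(r1,r1) = P B_(c1,c1) for the lift at (r1, c1), whereas its square
    gives P (1 + B_(c1,c1) + B_(r1,r1)) = 0. Since 2 P = 0, this leaves P = 0. *)
Lemma no_elementary2 (r1 r2 c1 c2 : 'I_n.+1) (A B : bool -> bool -> M) :
  P <> 0 -> P = 2%:R -> uniq [:: r1; r2; c1; c2] ->
  (forall a c, elementary_lift (if a then r2 else r1) (if c then c2 else c1) (A a c) (B a c)) ->
  (forall a c, A a c ^+ 2 = 1) ->
  (forall a c a' c', A a c * A a' c' = A a' c' * A a c) -> False.
Proof.
move=> P0 P2 /and5P[+ + + _ _]; rewrite !inE !negb_or.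
move=> /and3P[r12 rc11 rc12] /andP[rc21 rc22] c12 lA Ap AA.
have comm a c a' c' r s :
  P * (B a' c' (if c then c2 else c1) s *+ (r == (if a then r2 else r1)) +
     B a c r (if a' then r2 else r1) *+ (s == (if c' then c2 else c1))) =
  P * (B a c (if c' then c2 else c1) s *+ (r == (if a' then r2 else r1)) +
     B a' c' r (if a then r2 else r1) *+ (s == (if c then c2 else c1))).
  apply: elementary_comm (lA a c) (lA a' c') _ _ (AA _ _ _ _) _ _.
    by case: (c); case: (a'); rewrite eq_sym.
  by case: (c'); case: (a); rewrite eq_sym.
have := elementary_sq P2 (lA false false) rc11 (Ap _ _).
have := comm false false false true r1 c2.
have := comm false false true false r2 c1.
have := comm false false true true r2 c2.
have := comm false true true false r2 c2.
rewrite !eqxx /= ![r2 == _]eq_sym ![c2 == _]eq_sym !(negPf r12) !(negPf c12).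
rewrite /= !mulr0n !mulr1n ?add0r ?addr0 ?mulr0.
have dbl y : P * y + P * y = 0 by rewrite -mulr2n -mulr_natl -P2 mulrA PP mul0r.
rewrite !mulrDr mulr1; move: (dbl (B false true c1 c2)) (dbl (B false false c1 c1)).
move: (P * B false true c1 c2) (P * B true false r2 r1) (P * B false false r2 r2)
  (P * B false false c2 c2) (P * B false false c1 c1) (P * B false false r1 r1).
move=> b t R2 C2 C1 R1 bb cc /esym/eqP; rewrite addr_eq0 => /eqP bt R2C R2t bR e.
apply: P0; rewrite -e.
have tb : t = b by apply/eqP; rewrite -[t]opprK -bt eq_sym -addr_eq0 bb.
have R1C : R1 = C1 by apply: (addrI b); rewrite bR -R2C R2t tb addrC.
by rewrite R1C -addrA cc addr0.
Qed.

End Elementary.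

(** * From a section to matrices over Z/p^2 *)

Section NotSplit.
Variables (b : series_kind) (p n : nat) (Gamma : groupType) (x : 'I_n.+1 -> Gamma).
Hypothesis p_prime : prime p.
Hypothesis basis_x : is_basis x.
Hypothesis b_p : b = Stallings \/ p = 2.
Local Notation N := (NN b p Gamma).
Local Notation L := (LL b p Gamma).
Local Notation pi := (@pi b p Gamma).
Local Notation proj := (NN_proj b p).
Import GRing.Theory.
Local Open Scope ring_scope.
Local Notation Z := 'Z_(p ^ 2).
Local Notation P := (p%:R : Z).

Lemma sqp_gt1 : (1 < p ^ 2)%N.
Proof. by rewrite -(exp1n 2) ltn_sqr prime_gt1. Qed.

Lemma modPP : P * P = 0.
Proof. by rewrite -natrM mulnn pchar_Zp ?sqp_gt1. Qed.

Lemma modP_neq0 : P <> 0.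
Proof.
move/(congr1 val); rewrite Zp_nat /= Zp_cast ?sqp_gt1 // modn_small.
  by move=> p0; move: p_prime; rewrite p0.
by rewrite -[X in (X < _)%N]expn1 ltn_exp2l // prime_gt1.
Qed.

(** Exponent sums modulo p^2. The filtration is Z/p^2, then its multiples of p, then 0 from weight 3
    on; p-th powers raise weight 1 exactly to weight 2 because the series is Stallings or p = 2. *)
Lemma coordinate i : exists chi : N 2 -> Z,
  [/\ {morph chi : u v / (u * v)%g >-> u + v},
      forall j, chi (pi 2 (x j)) = (j == i)%:R
    & forall l, L 2 l -> exists c, chi l = P * c].
Proof.
have [f [fM fx]] := @free_hom _ _ _ basis_x Z (fun j => (j == i)%:R).
pose B k := [set y : Z | if (k <= 1)%N then True else if (k == 2)%N then exists c, y = P * c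
   else y = 0].
have B_sub k : is_subgroup (B k).
  case: k => [|[|[|k]]]; rewrite /B; split=> //=.
  - by exists 0; rewrite mulr0.
  - by move=> _ _ [c ->] [d ->]; exists (c - d); rewrite mulrBr.
  - by move=> _ _ -> ->; apply: subr0.
have fB k g : normal_set (series b p Gamma k.+1) g -> B k.+1 (f g).
  apply: (series_filtration p_prime fM) => //.
  - move=> k' g' y k0 _; have -> : commutator (f g') y = 0.
      by apply/commutator1P; apply: addrC.
    by apply: (subgroup1 (B_sub k'.+1)).
  - move=> [|[|[|k']]] y //; rewrite /B //= => ->; by exists 0; rewrite mulr0.
  - move=> k' y k0 By; rewrite FinRing.zmodXgE -mulr_natl.
    case: k' k0 By => [|[|k']] // _ By.
      have -> : (if b is Stallings then 2 else 1 * p)%N = 2%N.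
        by case: b_p => [->|p2]; [|case: (b) => //; rewrite mul1n].
      by exists y.
    have -> : P * y = 0; last by apply: (subgroup1 (B_sub _)).
    move: By; case: k' => [|k'] /= => [[c ->]|->]; last by rewrite mulr0.
    by rewrite mulrA modPP mul0r.
have [chi [chiM chiE]] := pi_factor (m := 2) fM (fun g Dg => fB 2 g Dg).
exists chi; split=> //.
- by move=> j; rewrite chiE fx.
- by move=> l /LL_P[g Dg ->]; rewrite chiE; apply: (fB 1%N).
Qed.

Lemma coordinates : exists chi : 'I_n.+1 -> N 2 -> Z,
  [/\ forall i, {morph chi i : u v / (u * v)%g >-> u + v},
      forall i j, chi i (pi 2 (x j)) = (j == i)%:R
    & forall i l, L 2 l -> exists c, chi i l = P * c].
Proof.
have [chi chiP] := choice coordinate.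
by exists chi; split=> i; case: (chiP i).
Qed.

Variable psi : automorphism (N 2) -> automorphism (N 1).
Hypothesis psiE : forall phi g, psi phi (proj 1 g) = proj 1 (phi g).

Definition is_transvection i j (e : automorphism (N 1)) :=
  forall l, e (pi 1 (x l)) = (pi 1 (x l) * (if l == j then pi 1 (x i) else 1))%g.

Lemma transvection_exists i j : i != j -> exists e, is_transvection i j e.
Proof.
move=> ij; have [e [ej el]] := transvection b p basis_x ij 1.
exists e => l; case: eqP => [->|/eqP/el->]; last by rewrite mulg1.
by rewrite ej piM.
Qed.

Lemma aut_eq_gen (e e' : automorphism (N 1)) :
  (forall l, e (pi 1 (x l)) = e' (pi 1 (x l))) -> e = e'.
Proof. by move=> ee'; apply: aut_ext; apply: (NN_eq basis_x) => //; apply: autM. Qed.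

Lemma transvection_comm i j k l e e' : is_transvection i j e -> is_transvection k l e' ->
  j != k -> l != i -> (e * e' = e' * e)%g.
Proof.
move=> eT e'T jk li; apply: aut_eq_gen => s; rewrite !aut_mulE eT e'T !autM eT e'T.
have -> : e (if s == l then pi 1 (x k) else 1%g) = (if s == l then pi 1 (x k) else 1%g).
  by case: eqP => _; [rewrite eT eq_sym (negPf jk) mulg1 | rewrite (morph1 (autM e))].
have -> : e' (if s == j then pi 1 (x i) else 1%g) = (if s == j then pi 1 (x i) else 1%g).
  by case: eqP => _; [rewrite e'T eq_sym (negPf li) mulg1 | rewrite (morph1 (autM e'))].
by rewrite -!mulgA; congr (_ * _)%g; apply: NN1_comm.
Qed.

Lemma transvection_exp i j e : is_transvection i j e -> i != j -> (e ^+ p = 1)%g.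
Proof.
move=> eT ij; apply: aut_eq_gen => s; rewrite aut_oneE.
set y := if s == j then pi 1 (x i) else 1%g.
have ey : e y = y.
  rewrite /y; case: eqP => _; last exact: (morph1 (autM e)).
  by rewrite eT (negPf ij) mulg1.
have -> m : aut_fun (e ^+ m)%g (pi 1 (x s)) = (pi 1 (x s) * y ^+ m)%g.
  elim: m => [|m IH]; first by rewrite !expg0 mulg1.
  by rewrite expgS aut_mulE IH autM (morphX (autM e)) ey eT -/y expgS mulgA.
by rewrite NN1_exp // mulg1.
Qed.

Section FromSection.
Variable s : automorphism (N 1) -> automorphism (N 2).
Hypothesis sM : forall a c, s (a * c)%g = (s a * s c)%g.
Hypothesis psis : forall a, psi (s a) = a.

(** [s e] acts linearly on the exponent sums of [N 2], so its matrix is multiplicative in [e];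
    elements of [L 2] have sums divisible by p, so modulo p it is the matrix of [e]. *)
Lemma section_matrix : exists A : automorphism (N 1) -> 'M[Z]_n.+1,
  [/\ forall a c, A (a * c)%g = A a * A c,
      A 1%g = 1
    & forall i j e, is_transvection i j e -> exists B, elementary_lift P i j (A e) B].
Proof.
have [chi [chiM chix chiL]] := coordinates.
pose A (e : automorphism (N 1)) : 'M[Z]_n.+1 := \matrix_(i, j) chi i (s e (pi 2 (x j))).
have chi_sum e i g : chi i (s e g) = \sum_l A e i l * chi l g.
  apply: (@NN_eq _ _ _ _ _ basis_x 2 Z (fun g => chi i (s e g))
           (fun g => \sum_l A e i l * chi l g)) => [u v|u v|j].
  - by rewrite autM chiM.
  - by rewrite FinRing.zmodMgE -big_split; apply: eq_bigr => l _; rewrite chiM mulrDr.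
  - rewrite (bigD1 j) //= chix eqxx mulr1 big1 ?addr0 ?mxE // => l lj.
    by rewrite chix eq_sym (negPf lj) mulr0.
have s1 : s 1%g = 1%g by apply: morph1.
exists A; split.
- move=> a c; apply/matrixP=> i j; rewrite mxE sM aut_mulE chi_sum [RHS]mxE.
  by apply: eq_bigr => l _; congr (_ * _); rewrite mxE.
- by apply/matrixP=> i j; rewrite !mxE s1 aut_oneE chix eq_sym.
move=> i j e eT.
have ex r c : exists B, A e r c = (1 : 'M[Z]_n.+1) r c + (delta_mx i j : 'M[Z]_n.+1) r c + P * B.
  pose y := if c == j then x i else 1%g.
  have ey : e (pi 1 (x c)) = pi 1 (x c * y)%g.
    by rewrite eT piM /y; case: eqP => // _; rewrite pi1.
  have [l el [B lB]] : exists2 l, s e (pi 2 (x c)) = (l * (pi 2 (x c) * pi 2 y))%g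
      & exists B, chi r l = P * B.
    exists (s e (pi 2 (x c)) * (pi 2 (x c * y)%g)^-1)%g; first by rewrite -piM mulgVK.
    have e1 : proj 1 (s e (pi 2 (x c))) = pi 1 (x c * y)%g by rewrite -psiE psis projE // ey.
    by apply: chiL; apply/LL_proj; rewrite -piV projM // e1 projE // piV mulgV.
  exists B; rewrite mxE el !chiM lB addrC chix !mxE eq_sym; congr (_ + _ + _).
  rewrite /y; case: eqP => _; first by rewrite chix eq_sym andbT.
  by rewrite pi1 andbF; apply: (morph1 (f := chi r : N 2 -> Z) (chiM r)).
have [B BE] := choice (fun rc : 'I_n.+1 * 'I_n.+1 => ex rc.1 rc.2).
exists (\matrix_(r, c) B (r, c)); apply/matrixP => r c.
have /= -> := BE (r, c).
by rewrite mxDE mxDE mxZE -addrA; congr (_ + (_ + P * _)); rewrite mxE.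
Qed.

End FromSection.

Lemma inord_neq i j : (i <= n)%N -> (j <= n)%N -> i != j ->
  (inord i : 'I_n.+1) != inord j.
Proof. by move=> il jl ij; rewrite -(inj_eq val_inj) /= !inordK. Qed.

(** The rank is [n.+1]: the three alternatives are rank at least 2 for p >= 5, at least 3 for p = 3
    and at least 4 for p = 2. *)
Lemma not_split :
  [|| (3 < p)%N && (0 < n)%N, (p == 3) && (1 < n)%N | (p == 2) && (2 < n)%N] ->
  ~ is_split_extension setT setT psi.
Proof.
move=> pn [s [[_ _ _ sM] psis]].
have [A [AM A1 AT]] := section_matrix (fun a c => sM a c I I) (fun a => psis a I).
have AX a m : A (a ^+ m)%g = A a ^+ m.
  by elim: m => [|m IH]; [exact: A1 | rewrite expgS AM IH exprS].
have PP := modPP; have P0 := modP_neq0.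
have p2 : (1 < p)%N := prime_gt1 p_prime.
case/or3P: pn => /andP[pE nE].
- have ij := inord_neq (leq0n n) nE isT.
  have [e eT] := transvection_exists ij; have [B lB] := AT _ _ _ eT.
  have Cp k : (0 < k < p)%N -> P *+ 'C(p, k) = 0.
    by move=> /(prime_dvd_bin p_prime)/dvdnP[c ->]; rewrite (mulnC c) mulrnA -[P *+ p]mulr_natr PP mul0rn.
  apply: (no_elementary5 PP P0 (m := p) erefl _ _ lB ij).
  + by apply: Cp; apply: leq_trans pE.
  + by apply: Cp; apply: leq_trans pE.
  + by rewrite -AX (transvection_exp eT ij).
- have n0 : (0 < n)%N by apply: ltnW.
  have ij := inord_neq (leq0n n) n0 isT; have il := inord_neq (leq0n n) nE isT.
  have jl := inord_neq n0 nE isT.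
  have [e eT] := transvection_exists ij; have [B lB] := AT _ _ _ eT.
  have [e' e'T] := transvection_exists il; have [B' lB'] := AT _ _ _ e'T.
  have Ae := transvection_exp eT ij; move/eqP: pE => pE.
  have P3 : P = 3%:R by apply: (congr1 (fun m => m%:R : Z) pE).
  apply: (no_elementary3 PP P0 P3 lB lB').
  + by rewrite /= !inE !negb_or ij il jl.
  + by rewrite -AX -A1 -Ae; congr (A (_ ^+ _)%g).
  + by rewrite -!AM (transvection_comm eT e'T) // eq_sym.
- move/eqP: pE => pE.
  (* Row indices 0, 1 and column indices 2, 3 are disjoint, so the four transvections commute. *)
  pose R (a : bool) : 'I_n.+1 := if a then inord 1 else inord 0.
  pose C (a : bool) : 'I_n.+1 := if a then inord 3 else inord 2.
  have n1 : (1 <= n)%N by apply: leq_trans nE. 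
  have n2 : (2 <= n)%N by apply: leq_trans nE.
  have RC a c : R a != C c by case: a; case: c; apply: inord_neq.
  have [e eT] := choice (fun ac : bool * bool => transvection_exists (RC ac.1 ac.2)).
  have [B lB] := choice (fun ac : bool * bool => AT _ _ _ (eT ac)).
  have P2 : P = 2%:R by apply: (congr1 (fun m => m%:R : Z) pE).
  apply: (@no_elementary2 _ P n PP (R false) (R true) (C false) (C true)
            (fun a c => A (e (a, c))) (fun a c => B (a, c)) P0 P2).
  + by rewrite /= !inE !negb_or !inord_neq.
  + by move=> a c; have := lB (a, c); case: a; case: c.
  + by move=> a c; rewrite -AX -A1 -(transvection_exp (eT (a, c)) (RC _ _)); congr (A (_ ^+ _)%g).
  + move=> a c a' c'; have CR d d' : C d != R d' by rewrite eq_sym.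
    by rewrite -!AM (transvection_comm (eT (a, c)) (eT (a', c')) (CR _ _) (CR _ _)).
Qed.

End NotSplit.

Section SplitCases.
Variables (b : series_kind) (p n : nat) (Gamma : groupType) (x : 'I_n -> Gamma).
Hypothesis p_prime : prime p.
Hypothesis basis_x : is_basis x.
Variable psi : automorphism (NN b p Gamma 2) -> automorphism (NN b p Gamma 1).
Hypothesis psiE : forall phi g, psi phi (NN_proj b p 1 g) = NN_proj b p 1 (phi g).

Lemma split_listed : listed_split_case b p n 1 \/ unlisted_split_case p n 1 ->
  is_split_extension setT setT psi.
Proof.
have small_case : (p = 3 /\ n = 2) \/ (p = 2 /\ n = 2) \/ (p = 2 /\ n = 3) ->
    is_split_extension setT setT psi.
  move=> [[pE nE]|[[pE nE]|[pE nE]]]; subst p n.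
  - exact: (split2 _ psiE basis_x check32).
  - exact: (split2 _ psiE basis_x check22).
  - exact: (split3 _ psiE basis_x check23).
case=> [|[_ p2 [n2|n3]]]; [|by apply: small_case; auto|by apply: small_case; auto].
case: b psi psiE small_case => psi' psi'E small_case /= [_].
  by move=> [[pE nE]|[pE nE]]; apply: small_case; auto.
by move=> p_odd; apply: (odd_Zassenhaus_split p_prime p_odd basis_x psi'E).
Qed.

Hypothesis n_gt1 : (1 < n)%N.

Lemma listed_split : is_split_extension setT setT psi ->
  listed_split_case b p n 1 \/ unlisted_split_case p n 1.
Proof.
move=> split_psi; apply: contrapT => not_listed.
have b_p : b = Stallings \/ p = 2.
  have [p2|podd] := even_prime p_prime; first by right.
  by left; case: (b) not_listed => // not_listed; case: not_listed; left.
have bound : [|| (3 < p)%N && (0 < n.-1)%N, (p == 3) && (1 < n.-1)%N | (p == 2) && (2 < n.-1)%N].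
  have n1 : n = n.-1.+1 by rewrite prednK // ltnW.
  have [p2|p_neq2] := eqVneq p 2.
    rewrite p2 /=; case: (n) n_gt1 not_listed => [|[|[|[|n']]]] //= _ [].
      by right; split=> //; left.
    by right; split=> //; right.
  have [p3|p_neq3] := eqVneq p 3.
    rewrite p3 /=; case: (n) n_gt1 not_listed => [|[|[|n']]] //= _ [].
    left; case: b_p => [->|p2]; last by rewrite p2 in p3.
    by rewrite /= p3; split=> //; left.
  have -> : (0 < n.-1)%N by rewrite -ltnS -n1.
  rewrite /= orbF andbT.
  by rewrite ltn_neqAle eq_sym p_neq3 ltn_neqAle eq_sym p_neq2 prime_gt1.
move: b_p bound split_psi; case: n x basis_x n_gt1 => // n' x' bx' _ b_p bound.
exact: (not_split p_prime bx' b_p psiE bound).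
Qed.

End SplitCases.

Theorem theorem1p1 (p n k : nat) (b : series_kind) (Gamma : groupType)
    (p_prime : prime p) (n_gt1 : (1 < n)%N) (Gamma_free : free_of_rank n Gamma)
    (k_gt0 : (1 <= k)%N) :
  let N := NN b p Gamma in
  let HomNL := homs (N 1%N) (LL b p Gamma k.+1) in
  exists (i : fun_group (N 1%N) (N k.+1) -> automorphism (N k.+1))
         (psi : automorphism (N k.+1) -> automorphism (N k)),
    [/\ (forall f, HomNL f ->
           forall g : N k.+1, i f g = f (NN_proj b p 1 g) * g) /\
        (forall phi (g : N k.+1),
           psi phi (NN_proj b p k g) = NN_proj b p k (phi g)),
        is_extension HomNL setT setT i psi /\
        ~ is_central_extension HomNL setT i,
        is_split_extension setT setT psi <->
        (listed_split_case b p n k \/ unlisted_split_case p n k)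
      & [/\ is_extension HomNL (IA b p Gamma k.+1) (IA b p Gamma k) i psi,
            is_central_extension HomNL (IA b p Gamma k.+1) i
          & is_split_extension (IA b p Gamma k.+1) (IA b p Gamma k) psi <->
            k = 1%N]].
Proof.
move=> N HomNL; have [x basis_x] : exists x : 'I_n -> Gamma, is_basis x := Gamma_free.
(* [i] must be defined on all functions; outside [HomNL] it takes the default value 1. *)
have ex_i (f : fun_group (N 1%N) (N k.+1)) : exists e : automorphism (N k.+1),
    HomNL f -> forall g, e g = f (NN_proj b p 1 g) * g.
  have [Hf|nHf] := pselect (HomNL f); last by exists 1.
  by have [e eE] := hom_aut p_prime basis_x k_gt0 Hf; exists e.
have [i iE] := choice ex_i.
have ex_psi (phi : automorphism (N k.+1)) : exists a : automorphism (N k),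
    forall g, a (NN_proj b p k g) = NN_proj b p k (phi g).
  exact: (@desc_exists b p n Gamma x basis_x k phi).
have [psi psiE] := choice ex_psi.
exists i, psi.
pose i0 : 'I_n := Ordinal (ltnW n_gt1); pose i1 : 'I_n := Ordinal n_gt1.
have i01 : i0 != i1 by [].
have k1_or : k = 1%N \/ (1 < k)%N.
  by move: k_gt0; rewrite leq_eqVlt => /orP[/eqP<-|]; auto.
split.
- by split.
- split; first exact: (full_extension p_prime basis_x k_gt0 iE psiE).
  exact: (not_central p_prime basis_x iE i01).
- case: k1_or => [kE|k_gt1]; last first.
    have nk1 : k <> 1%N by move=> kE; rewrite kE in k_gt1.
    split=> [sp|].
      case: (IA_not_split p_prime basis_x k_gt0 iE psiE i01 k_gt1).
      exact: (split_IA k_gt0 psiE).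
    by case=> [|[]] //; case: (b) => -[].
  subst k; split.
    exact: (listed_split p_prime basis_x psiE n_gt1).
  exact: (split_listed p_prime basis_x psiE).
- split; first exact: (IA_extension p_prime basis_x k_gt0 iE psiE).
    exact: (IA_central p_prime basis_x iE).
  split=> [sp|]; last exact: (IA1_split psiE).
  case: k1_or => // k_gt1.
  by case: (IA_not_split p_prime basis_x k_gt0 iE psiE i01 k_gt1).
Qed.
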